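(* Let $M$ be a closed surface endowed with a metric $g$ of constant negative curvature equal to $-1$, let $R>0$, let $U_R\subset T^*M$ be the neighbourhood of radius $R$ about the zero section $M$, and let $\alpha$ be a non-trivial free homotopy class of loops in $M$. For every $\epsilon>0$ there exists a magnetic field (closed $2$-form) $\sigma$ on $M$ with $\|\sigma\|_{C^1}<\epsilon$ such that, with respect to the symplectic form $\omega=\omega_0+\pi^*\sigma$, $$c_{BPS}(U_R,M;\alpha)=+\infty.$$
   Context: $\pi:T^*M\to M$ is the projection, $\lambda$ is the canonical (Liouville) $1$-form on $T^*M$, and $\omega_0=d\lambda$ is the standard symplectic form. $M$ is identified with the zero section of $T^*M$. The neighbourhood of radius $R$ is $U_R=\{(x,p)\in T^*M:\|p\|<R\}$, with the norm on fibres induced by $g$. $\|\sigma\|_{C^1}$ is the $C^1$-norm with respect to $g$. $S^1=\mathbb{R}/\mathbb{Z}$. Free homotopy classes of loops in $T^*M$, $U_R$ and $M$ are identified through $\pi$. Biran-Polterovich-Salamon capacity: let $(N,\omega)$ be an open symplectic manifold, $A\subset N$ compact, $\alpha$ a free homotopy class of loops in $N$. Let $\mathcal{H}(N)$ be the family of smooth Hamiltonians with compact support in $S^1\times N$, let $\mathcal{P}(H;\alpha)$ be the set of $1$-periodic orbits in the class $\alpha$ of the Hamiltonian flow of $H$ with respect to $\omega$ (vector field $X_{H_t}$ given by $\iota_{X_{H_t}}\omega=-dH_t$), and let $\mathcal{H}_k(N,A)=\{H\in\mathcal{H}(N):\inf_{S^1\times A}H\ge k\}$. Then $c_{BPS}(N,A;\alpha)=\inf\{k>0:\mathcal{P}(H;\alpha)\ne\emptyset\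 \text{for all } H\in\mathcal{H}_k(N,A)\}$, with $\inf\emptyset=+\infty$. *)

(* Defs.v *)
From HB Require Import structures.
From mathcomp Require Import all_boot all_order all_algebra.
From mathcomp Require Import all_classical all_reals all_analysis.
Set Implicit Arguments.
Unset Strict Implicit.
Unset Printing Implicit Defensive.
Import Order.TTheory GRing.Theory Num.Theory.
Import numFieldNormedType.Exports.
Local Open Scope classical_set_scope.
Local Open Scope ring_scope.

(* C^oo on an open set [U]: every iterated directional derivative is
   differentiable at every point of [U]. *)
Definition smooth_on (R : realType) (V W : normedModType R) (U : set V)
    (f : V -> W) : Prop :=
  forall (vs : seq V) (x : V), U x ->
    differentiable (foldr (fun v (h : V -> W) => 'D_v h) f vs) x.

Definition partial (R : realType) (n : nat) (W : normedModType R) (k : 'I_n)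
    (f : 'rV[R]_n -> W) : 'rV[R]_n -> W :=
  'D_(delta_mx ord0 k) f.

(* A chart is a homeomorphism from the open set [cdom] onto an open subset of
   R^n; [cmap] and [cinv] are arbitrary outside [cdom] and its image. *)
Record chart (R : realType) (n : nat) (M : topologicalType) := Chart {
  cdom : set M ;
  cmap : M -> 'rV[R]_n ;
  cinv : 'rV[R]_n -> M ;
  cdom_open : open cdom ;
  cimg_open : open (cmap @` cdom) ;
  cmapK : forall x, cdom x -> cinv (cmap x) = x ;
  cmap_continuous : forall x, cdom x -> {for x, continuous cmap} ;
  cinv_continuous : forall x, cdom x -> {for cmap x, continuous cinv} }.

(* A smooth manifold structure without boundary on [M]. The atlas comes with a
   preferred chart [chart_at x] around every point [x]. *)
Record smooth_atlas (R : realType) (n : nat) (M : topologicalType) := SmoothAtlas {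
  cidx : Type ;
  ch : cidx -> chart R n M ;
  chart_at : M -> cidx ;
  chart_atP : forall x, cdom (ch (chart_at x)) x ;
  transition_smooth : forall i j : cidx,
    smooth_on (cmap (ch i) @` (cdom (ch i) `&` cdom (ch j)))
              (cmap (ch j) \o cinv (ch i)) }.

Definition closed_surface (R : realType) (M : topologicalType)
    (A : smooth_atlas R 2 M) : Prop :=
  [/\ hausdorff_space M, compact [set: M] & connected [set: M]].

(* The cotangent bundle: [fibre] lists the components of the covector in the
   preferred chart [chart_at A base]. *)
Record cotangent (R : realType) (n : nat) (M : topologicalType)
    (A : smooth_atlas R n M) := Cotangent { base : M ; fibre : 'rV[R]_n }.

HB.instance Definition _ (R : realType) (n : nat) (M : topologicalType)
  (A : smooth_atlas R n M) := gen_eqMixin (cotangent A).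
HB.instance Definition _ (R : realType) (n : nat) (M : topologicalType)
  (A : smooth_atlas R n M) := gen_choiceMixin (cotangent A).

Section Manifold.
Variables (R : realType) (n : nat) (M : topologicalType).
Variable A : smooth_atlas R n M.
Implicit Types (i j : cidx A) (q : 'rV[R]_n) (x : M).

Definition dom i : set M := cdom (ch i).
Definition crd i : M -> 'rV[R]_n := cmap (ch i).
Definition pnt i : 'rV[R]_n -> M := cinv (ch i).
Definition img i : set 'rV[R]_n := crd i @` dom i.

(* Jacobian at [x] of the change of coordinates from chart [i] to chart [j]:
   tangent vectors are row vectors, with components v_j = v_i *m jac i j x. *)
Definition jac i j x : 'M[R]_n := jacobian (crd j \o pnt i) (crd i x).

(* Covariant 2-tensor fields, given by their components in all charts. *)
Definition tensor2 : Type := cidx A -> 'rV[R]_n -> 'M[R]_n.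

Definition is_tensor2 (T : tensor2) : Prop :=
  (forall i a b, smooth_on (img i) (fun q => T i q a b)) /\
  (forall i j x, dom i x -> dom j x ->
     T i (crd i x) = jac i j x *m T j (crd j x) *m (jac i j x)^T).

Definition riemannian_metric (g : tensor2) : Prop :=
  is_tensor2 g /\
  forall i q, img i q ->
    (g i q)^T = g i q /\
    forall v : 'rV[R]_n, v != 0 -> 0 < (v *m g i q *m v^T) ord0 ord0.

Definition two_form (s : tensor2) : Prop :=
  is_tensor2 s /\ forall i q, img i q -> (s i q)^T = - s i q.

Definition closed_form (s : tensor2) : Prop :=
  forall i q, img i q -> forall a b c,
    partial a (fun q => s i q b c) q + partial b (fun q => s i q c a) q
    + partial c (fun q => s i q a b) q = 0.

Section Metric.
Variable g : tensor2.

Definition ginv i q : 'M[R]_n := invmx (g i q).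

(* [christoffel i l j k q] is the symbol Gamma^l_{jk}. *)
Definition christoffel i (l j k : 'I_n) q : R :=
  2^-1 * \sum_m ginv i q l m *
    (partial j (fun q => g i q m k) q + partial k (fun q => g i q m j) q
     - partial m (fun q => g i q j k) q).

(* [riemann i l c a b q] is dx^l (Rm(e_a, e_b) e_c), where
   Rm(X, Y) = nabla_X nabla_Y - nabla_Y nabla_X - nabla_[X, Y]. *)
Definition riemann i (l c a b : 'I_n) q : R :=
  partial a (christoffel i l b c) q - partial b (christoffel i l a c) q
  + \sum_m (christoffel i l a m q * christoffel i m b c q
            - christoffel i l b m q * christoffel i m a c q).

(* Components (nabla_k s)_{ab}. *)
Definition nabla2 (s : tensor2) i (k : 'I_n) q : 'M[R]_n :=
  \matrix_(a, b) (partial k (fun q => s i q a b) q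
    - \sum_l christoffel i l k a q * s i q l b
    - \sum_l christoffel i l k b q * s i q a l).

(* Pointwise norms of s and nabla s as covariant tensors of rank 2 and 3. *)
Definition norm2 (s : tensor2) i q : R :=
  Num.sqrt (\sum_a \sum_b \sum_a' \sum_b'
    ginv i q a a' * ginv i q b b' * s i q a b * s i q a' b').

Definition norm_nabla2 (s : tensor2) i q : R :=
  Num.sqrt (\sum_k \sum_a \sum_b \sum_k' \sum_a' \sum_b'
    ginv i q k k' * ginv i q a a' * ginv i q b b'
    * nabla2 s i k q a b * nabla2 s i k' q a' b').

Definition C1norm (s : tensor2) : \bar R :=
  (ereal_sup [set y | exists i q, img i q /\ y = (norm2 s i q)%:E] +
   ereal_sup [set y | exists i q, img i q /\ y = (norm_nabla2 s i q)%:E])%E.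

End Metric.

(* The bundle chart (q, p) of T*M over chart [i]; covectors transform by the
   transposed Jacobian. *)
Definition bcrd i (w : cotangent A) : 'rV[R]_n * 'rV[R]_n :=
  (crd i (base w), fibre w *m (jac i (chart_at A (base w)) (base w))^T).

Definition bpnt i (z : 'rV[R]_n * 'rV[R]_n) : cotangent A :=
  let x := pnt i z.1 in
  Cotangent A x (z.2 *m (jac (chart_at A x) i x)^T).

(* The topology of T*M is the one generated by the bundle charts. *)
Definition cot_open (W : set (cotangent A)) : Prop :=
  forall w, W w -> forall i, dom i (base w) ->
    \forall z \near bcrd i w, W (bpnt i z).

Lemma cot_openT : cot_open setT.
Proof. by move=> w _ i _; exact: filterT. Qed.

Lemma cot_openI : setI_closed cot_open.
Proof.
move=> U V oU oV w [Uw Vw] i iw.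
by apply: filterI; [exact: oU|exact: oV].
Qed.

Lemma cot_open_bigU (I : Type) (f : I -> set (cotangent A)) :
  (forall k, cot_open (f k)) -> cot_open (\bigcup_k f k).
Proof.
move=> of_ w [k _ fkw] i iw.
have := of_ k w fkw i iw; apply: filterS => z fz.
by exists k.
Qed.

HB.instance Definition _ := isOpenTopological.Build (cotangent A)
  cot_openT cot_openI cot_open_bigU.

Definition zero_section : set (cotangent A) := [set w | fibre w = 0].

Definition conorm (g : tensor2) (w : cotangent A) : R :=
  let c := chart_at A (base w) in
  Num.sqrt ((fibre w *m ginv g c (crd c (base w)) *m (fibre w)^T) ord0 ord0).

Definition disk_bundle (g : tensor2) (r : R) : set (cotangent A) :=
  [set w | conorm g w < r].

Definition phase : normedModType R := ('rV[R]_n * 'rV[R]_n)%type.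

(* lambda = p dq in a bundle chart. *)
Definition liouville (z v : phase) : R := (z.2 *m v.1^T) ord0 ord0.

(* d theta (u, v) for constant vector fields u, v. *)
Definition ext_deriv (theta : phase -> phase -> R) (z u v : phase) : R :=
  'D_u (fun y => theta y v) z - 'D_v (fun y => theta y u) z.

(* 2-forms on T*M, given by their values in all bundle charts. *)
Definition cot_form : Type := cidx A -> phase -> phase -> phase -> R.

(* omega_0 + pi^* s with omega_0 = d lambda. *)
Definition twisted_form (s : tensor2) : cot_form := fun i z u v =>
  ext_deriv liouville z u v + (u.1 *m s i z.1 *m v.1^T) ord0 ord0.

(* S^1 = R/Z: loops and time-dependent Hamiltonians are 1-periodic. *)
Definition loop (T : topologicalType) (a : R -> T) : Prop :=
  continuous a /\ forall t, a (t + 1) = a t.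

Definition freely_homotopic (T : topologicalType) (a b : R -> T) : Prop :=
  exists F : R * R -> T,
    [/\ {within [set y : R * R | 0 <= y.1 <= 1], continuous F},
        forall s t, 0 <= s <= 1 -> F (s, t + 1) = F (s, t),
        forall t, F (0, t) = a t &
        forall t, F (1, t) = b t].

Definition free_class (T : topologicalType) (alpha : set (R -> T)) : Prop :=
  exists a, loop a /\ alpha = [set b | loop b /\ freely_homotopic a b].

Definition nontrivial_class (T : topologicalType) (alpha : set (R -> T)) : Prop :=
  forall x : T, ~ alpha (cst x).

(* H(N) for an open subset N of T*M: smooth functions with compact support in
   S^1 x N, extended by 0. *)
Definition hamiltonian (N : set (cotangent A)) (H : R -> cotangent A -> R) : Prop :=
  [/\ forall t w, H (t + 1) w = H t w,
      forall i, smooth_on [set y : (R * phase)%type | img i y.2.1]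
                  (fun y => H y.1 (bpnt i y.2) : R) &
      exists K : set (cotangent A),
        [/\ compact K, K `<=` N & forall t w, ~ K w -> H t w = 0]].

Definition hamiltonian_ge (N Z : set (cotangent A)) (k : R)
    (H : R -> cotangent A -> R) : Prop :=
  hamiltonian N H /\
  (k%:E <= ereal_inf [set (H y.1 y.2)%:E | y in [set: R] `*` Z])%E.

(* Integral curves in N of the field X_H with omega(X_H, .) = - dH. *)
Definition hamiltonian_orbit (N : set (cotangent A)) (omega : cot_form)
    (H : R -> cotangent A -> R) (gam : R -> cotangent A) : Prop :=
  [/\ continuous gam, forall t, N (gam t) &
      forall t i, dom i (base (gam t)) ->
        let z : phase := bcrd i (gam t) in
        exists2 X : phase,
          is_derive t (1 : R) (fun u => bcrd i (gam u) : phase) X &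
          forall v : phase,
            omega i z X v = - 'd (fun y : phase => H t (bpnt i y) : R) z v].

(* P(H; alpha), with free homotopy classes identified through the projection. *)
Definition periodic_orbits (N : set (cotangent A)) (omega : cot_form)
    (H : R -> cotangent A -> R) (alpha : set (R -> M)) : set (R -> cotangent A) :=
  [set gam | [/\ hamiltonian_orbit N omega H gam,
                 loop gam & alpha (fun t => base (gam t))]].

Definition cBPS (N : set (cotangent A)) (omega : cot_form) (Z : set (cotangent A))
    (alpha : set (R -> M)) : \bar R :=
  ereal_inf [set k%:E | k in [set k : R | 0 < k /\
    forall H, hamiltonian_ge N Z k H ->
      periodic_orbits N omega H alpha !=set0]].

End Manifold.

Arguments zero_section {R n M} A _.

Definition gauss_curvature (R : realType) (M : topologicalType)
    (A : smooth_atlas R 2 M) (g : tensor2 A) (i : cidx A) (q : 'rV[R]_2) : R :=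
  let e1 : 'I_2 := ord0 in let e2 : 'I_2 := ord_max in
  (\sum_l g i q e1 l * riemann g i l e2 e1 e2 q) / \det (g i q).

(* Main.v *)
From HB Require Import structures.
Require Import Defs.
From mathcomp Require Import all_boot all_order all_algebra.
From mathcomp Require Import all_classical all_reals all_analysis.
From mathcomp Require Import ring lra.
Import Order.TTheory GRing.Theory Num.Theory.
Import numFieldNormedType.Exports.
Local Open Scope classical_set_scope.
Local Open Scope ring_scope.
Set Implicit Arguments.
Unset Strict Implicit.
Unset Printing Implicit Defensive.

(* A form [sigma], a fibre metric and a function [F] are built so that at every
   point either [dF] is bounded below or there is a chart neighbourhood of uniform
   size where the fibre metric is Euclidean and [sigma] is a nonzero constant
   multiple of the area form. These local models are glued by cutting off in thin
   shells around finitely many circles, and [F] is perturbed so as to have no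
   critical point there.

   For each [k] a Hamiltonian [H >= k] on the zero section is the sum of a wall
   [k A(t) chi(Q / dl)], [Q] being the squared fibre norm, supported very close to
   the zero section, and a push [b(t) F chi(Q / rh)] with [\int b] tiny over a
   period, where [A] vanishes and [b = k] on a short time interval. Over one
   period the base point of an orbit cannot leave a chart ball, so that a closed
   orbit projects to a contractible loop:
   - if [Q >= rh] at some time, the orbit avoids the wall and the push moves it
     very little;
   - if [Q < rh] and [dF] is not small at the base point, the push translates the
     covector away from the wall while the wall is off, in forward or in backward
     time, and from then on the base point is at rest;
   - if [Q < rh] and [dF] is small, [sigma] is constant near the base point and
     the guiding centre [p + c x J] is almost conserved; as [p] is small, so is
     the displacement of [x]. *)

(** A wall alone is not enough: where its cutoff varies it drives base points along twisted
    geodesics at a speed of order [k / sqrt dl], and its closed orbits may represent [alpha]. Two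
    mechanisms oppose this, and neither is available everywhere. A constant field on a flat metric
    turns small covectors into small circles, but such a structure is only local; a push removes
    covectors from the wall, but a smooth function on a compact surface has critical points. Hence
    the transitions between local models are confined to places where [dF] does not vanish.

    The fibre metric is built independently of [g] and is compared with it only to place the
    supports inside [U_R].

    The order of the choices matters because [k] comes after [sigma]. The scale [c] of the form, the
    width [rh] of the push and the bound [eta] on its time integral are fixed without [k]. Then [k]
    determines the clock, and so the kick [k * clkt] given while the wall is off; the width [dl] of
    the wall comes last and is small compared with the square of that kick. Switching the wall off
    does not spoil [H >= k], because [F >= 1]. *)

(** * Smooth functions *)

Section SmoothCalculus.
Variable R : realType.
Implicit Types V W X : normedModType R.

(** Differentiating a product or a composite produces other functions, so [smooth_on] carries no
    induction by itself. The order [n] supplies one, with the functions generalised. *)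
Definition diff_upto V W (n : nat) (U : set V) (f : V -> W) : Prop :=
  forall vs : seq V, (size vs <= n)%N -> forall x, U x ->
    differentiable (foldr (fun v (h : V -> W) => 'D_v h) f vs) x.

Lemma smooth_onE V W (U : set V) (f : V -> W) :
  smooth_on U f <-> forall n, diff_upto n U f.
Proof.
by split=> [sf n vs _ x|sf vs x]; [exact: sf|exact: (sf (size vs))].
Qed.

(** [foldr] applies the last vector of the list first; the innermost derivative is therefore peeled
    off with [rcons]. *)
Lemma diff_uptoS V W n (U : set V) (f : V -> W) :
  diff_upto n.+1 U f <->
  (forall x, U x -> differentiable f x) /\ forall v, diff_upto n U ('D_v f).
Proof.
split=> [df|[df dDf]].
  split=> [x Ux|v vs svs x Ux]; first exact: (df [::]).
  by have := df (rcons vs v); rewrite size_rcons foldr_rcons; apply.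
by case/lastP=> [//|vs v]; rewrite size_rcons foldr_rcons => svs x; exact: dDf.
Qed.

Lemma diff_upto0 V W (U : set V) (f : V -> W) :
  diff_upto 0 U f <-> forall x, U x -> differentiable f x.
Proof.
by split=> [df x Ux|df [|//] _ x /df//]; exact: (df [::]).
Qed.

Lemma diff_uptoW V W n (U : set V) (f : V -> W) :
  diff_upto n.+1 U f -> diff_upto n U f.
Proof. by move=> df vs svs; apply: df; exact: leqW. Qed.

Lemma diff_upto_diff V W n (U : set V) (f : V -> W) x :
  diff_upto n U f -> U x -> differentiable f x.
Proof. by move=> df; exact: (df [::]). Qed.

Lemma smooth_diff V W (U : set V) (f : V -> W) x :
  smooth_on U f -> U x -> differentiable f x.
Proof. by move=> sf; exact: (sf [::]). Qed.

Lemma smooth_cont V W (U : set V) (f : V -> W) x :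
  smooth_on U f -> U x -> {for x, continuous f}.
Proof. by move=> sf Ux; apply/differentiable_continuous/(smooth_diff sf). Qed.

Lemma smooth_D V W (U : set V) (f : V -> W) v :
  smooth_on U f -> smooth_on U ('D_v f).
Proof. by move=> sf vs x Ux; rewrite -foldr_rcons; exact: sf. Qed.

Lemma smooth_onW V W (U U' : set V) (f : V -> W) :
  U `<=` U' -> smooth_on U' f -> smooth_on U f.
Proof. by move=> UU' sf vs x /UU'; exact: sf. Qed.

Lemma eq_derive_on V W (U : set V) (f g : V -> W) v x : open U ->
  {in U, f =1 g} -> U x -> 'D_v f x = 'D_v g x.
Proof.
move=> oU fg Ux; apply: near_eq_derive; apply: filterS (open_nbhs_nbhs (conj oU Ux)).
by move=> y Uy; apply: fg; rewrite inE.
Qed.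

Lemma eq_diff_near V W (f g : V -> W) x :
  (\forall y \near x, f y = g y) -> differentiable f x -> differentiable g x.
Proof.
move=> fg df; have gx : f x = g x := nbhs_singleton fg.
have [cf ef] := (diff_locallyP x f).1 df.
(* The differential of [f] satisfies the expansion that characterises the differential of [g], and
   uniqueness identifies the two. *)
have eg : g \o shift x = cst (g x) + 'd f x +o_ 0 id.
  apply/eqaddoP => e e0; move/eqaddoP : ef => /(_ e e0).
  have fg0 : \forall y \near 0, f (y + x) = g (y + x).
    by move: fg; rewrite (near_shift 0 x) /= ; apply: filterS => y; rewrite /= subr0.
  by apply: filterS2 fg0 => y fgy; rewrite /= !fctE /= fgy -gx.
have dg := diff_unique cf eg.
by apply/diff_locallyP; rewrite dg; split.
Qed.

Lemma eq_diff_upto V W n (U : set V) (f g : V -> W) : open U ->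
  (forall x, U x -> f x = g x) -> diff_upto n U f -> diff_upto n U g.
Proof.
move=> oU; have nU x : U x -> \forall y \near x, U y.
  by move=> Ux; exact: open_nbhs_nbhs.
elim: n f g => [|n IH] f g fg.
  move=> /diff_upto0 df; apply/diff_upto0 => x Ux; apply: eq_diff_near (df x Ux).
  by apply: filterS (nU x Ux).
move=> /diff_uptoS[df dDf]; apply/diff_uptoS; split=> [x Ux|v].
  by apply: eq_diff_near (df x Ux); apply: filterS (nU x Ux).
apply: IH (dDf v) => x Ux; apply: near_eq_derive.
by apply: filterS (nU x Ux).
Qed.

Lemma eq_smooth V W (U : set V) (f g : V -> W) : open U ->
  (forall x, U x -> f x = g x) -> smooth_on U f -> smooth_on U g.
Proof.
move=> oU fg /smooth_onE sf; apply/smooth_onE => n.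
exact: eq_diff_upto (sf n).
Qed.

Lemma smooth_on_local V W (U : set V) (f : V -> W) :
  (forall x, U x -> exists N g, [/\ open N, N x, smooth_on N g &
     forall y, N y -> g y = f y]) -> smooth_on U f.
Proof.
move=> loc vs x /loc [N [g [oN Nx sg gf]]].
by apply: (eq_smooth oN gf sg).
Qed.

Lemma smooth_cst V W (U : set V) (c : W) : smooth_on U (cst c).
Proof.
apply/smooth_onE => n; elim: n c => [|n IH] c.
  by apply/diff_upto0 => x _; exact: differentiable_cst.
apply/diff_uptoS; split=> [x _|v]; first exact: differentiable_cst.
have -> : 'D_v (cst c : V -> W) = cst 0 by apply/funext => x; rewrite derive_cst.
exact: IH.
Qed.

Lemma diff_uptoD V W n (U : set V) (f g : V -> W) : open U ->
  diff_upto n U f -> diff_upto n U g -> diff_upto n U (fun x => f x + g x).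
Proof.
move=> oU; elim: n f g => [|n IH] f g.
  move=> /diff_upto0 df /diff_upto0 dg; apply/diff_upto0 => x Ux.
  by apply: differentiableD; [exact: df|exact: dg].
move=> /diff_uptoS[df dDf] /diff_uptoS[dg dDg]; apply/diff_uptoS; split=> [x Ux|v].
  by apply: differentiableD; [exact: df|exact: dg].
apply: eq_diff_upto (IH _ _ (dDf v) (dDg v)) => // x Ux.
by rewrite -deriveD //; apply/diff_derivable; [exact: df|exact: dg].
Qed.

Lemma smoothD V W (U : set V) (f g : V -> W) : open U ->
  smooth_on U f -> smooth_on U g -> smooth_on U (fun x => f x + g x).
Proof.
move=> oU /smooth_onE sf /smooth_onE sg; apply/smooth_onE => n.
exact: diff_uptoD.
Qed.

Lemma diff_uptoM V n (U : set V) (f g : V -> R) : open U ->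
  diff_upto n U f -> diff_upto n U g -> diff_upto n U (fun x => f x * g x).
Proof.
move=> oU; elim: n f g => [|n IH] f g.
  move=> /diff_upto0 df /diff_upto0 dg; apply/diff_upto0 => x Ux.
  by apply: differentiableM; [exact: df|exact: dg].
move=> df1 dg1; move: (df1) (dg1).
move=> /diff_uptoS[df dDf] /diff_uptoS[dg dDg]; apply/diff_uptoS; split=> [x Ux|v].
  by apply: differentiableM; [exact: df|exact: dg].
apply: eq_diff_upto (diff_uptoD oU (IH _ _ (diff_uptoW df1) (dDg v))
  (IH _ _ (diff_uptoW dg1) (dDf v))) => // x Ux.
rewrite -[LHS]/(f x *: 'D_v g x + g x *: 'D_v f x).
by rewrite -deriveM //; apply/diff_derivable; [exact: df|exact: dg].
Qed.

Lemma smoothM V (U : set V) (f g : V -> R) : open U ->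
  smooth_on U f -> smooth_on U g -> smooth_on U (fun x => f x * g x).
Proof.
move=> oU /smooth_onE sf /smooth_onE sg; apply/smooth_onE => n.
exact: diff_uptoM.
Qed.

Lemma smooth_scale V (U : set V) (c : R) (f : V -> R) : open U ->
  smooth_on U f -> smooth_on U (fun x => c * f x).
Proof. by move=> oU; apply: smoothM => //; exact: smooth_cst. Qed.

Lemma smoothN V (U : set V) (f : V -> R) : open U ->
  smooth_on U f -> smooth_on U (fun x => - f x).
Proof.
move=> oU sf; apply: eq_smooth (smooth_scale (-1) oU sf) => // x _.
by rewrite mulN1r.
Qed.

Lemma smooth_sum V I (s : seq I) (U : set V) (f : I -> V -> R) : open U ->
  (forall i, smooth_on U (f i)) -> smooth_on U (fun x => \sum_(i <- s) f i x).
Proof.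
move=> oU sf; elim: s => [|i s IH].
  by under eq_fun do rewrite big_nil; exact: smooth_cst.
by under eq_fun do rewrite big_cons; exact: smoothD.
Qed.

Lemma diff_uptoV V n (U : set V) (f : V -> R) : open U ->
  (forall x, U x -> f x != 0) ->
  diff_upto n U f -> diff_upto n U (fun x => (f x)^-1).
Proof.
move=> oU f0; elim: n => [|n IH].
  move=> /diff_upto0 df; apply/diff_upto0 => x Ux.
  by have := @differentiableV R V f x (df x Ux) (f0 x Ux).
move=> df1; move: (df1) => /diff_uptoS[df dDf].
have IHn := IH (diff_uptoW df1); apply/diff_uptoS; split=> [x Ux|v].
  by have := @differentiableV R V f x (df x Ux) (f0 x Ux).
have cN1 : diff_upto n U (fun _ : V => - 1 : R).
  by have /smooth_onE := @smooth_cst V R U (-1); exact.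
apply: eq_diff_upto (diff_uptoM oU cN1 (diff_uptoM oU (diff_uptoM oU IHn IHn) (dDf v)))
  => // x Ux.
rewrite [RHS](deriveV (f0 x Ux) (diff_derivable (df x Ux))).
by rewrite mulN1r -exprVn expr2 -scaleNr.
Qed.

Lemma smoothV V (U : set V) (f : V -> R) : open U ->
  (forall x, U x -> f x != 0) -> smooth_on U f -> smooth_on U (fun x => (f x)^-1).
Proof.
move=> oU f0 /smooth_onE sf; apply/smooth_onE => n.
exact: diff_uptoV.
Qed.

Lemma derive_comp V W X (f : V -> W) (h : W -> X) x v :
  differentiable f x -> differentiable h (f x) ->
  'D_v (h \o f) x = 'd h (f x) ('D_v f x).
Proof.
move=> df dh; rewrite (deriveE _ (differentiable_comp df dh)) (deriveE _ df).
by rewrite (diff_comp df dh).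
Qed.

Lemma smooth_comp_linear V W X (L : {linear V -> W}) (U : set W) (f : W -> X) :
  continuous L -> open U -> smooth_on U f -> smooth_on (L @^-1` U) (f \o L).
Proof.
move=> cL oU /smooth_onE sf; apply/smooth_onE => n.
have oV : open (L @^-1` U) by apply: open_comp => // x _; exact: cL.
have dL x : differentiable L x by exact: linear_differentiable.
elim: n f {sf}(sf n) => [|n IH] f.
  move=> /diff_upto0 df; apply/diff_upto0 => x Ux.
  exact: (differentiable_comp (dL x) (df _ Ux)).
move=> /diff_uptoS[df dDf]; apply/diff_uptoS; split=> [x Ux|v].
  exact: (differentiable_comp (dL x) (df _ Ux)).
apply: eq_diff_upto (IH _ (dDf (L v))) => // x Ux /=.
rewrite (derive_comp _ (dL x) (df _ Ux)) (deriveE _ (df _ Ux)) (deriveE _ (dL x)).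
by rewrite diff_lin.
Qed.

Lemma diff_upto_linear V W X n (L : {linear W -> X}) (U : set V) (f : V -> W) :
  continuous L -> open U -> diff_upto n U f -> diff_upto n U (L \o f).
Proof.
move=> cL oU; have dL x : differentiable L x by exact: linear_differentiable.
elim: n f => [|n IH] f.
  move=> /diff_upto0 df; apply/diff_upto0 => x Ux.
  exact: (differentiable_comp (df _ Ux) (dL _)).
move=> /diff_uptoS[df dDf]; apply/diff_uptoS; split=> [x Ux|v].
  exact: (differentiable_comp (df _ Ux) (dL _)).
apply: eq_diff_upto (IH _ (dDf v)) => // x Ux /=.
by rewrite (derive_comp _ (df _ Ux) (dL _)) diff_lin.
Qed.

Definition mx_coord m n (a : 'I_m) (b : 'I_n) (M : 'M[R]_(m, n)) : R := M a b.

Fact mx_coord_linear m n a b : linear (@mx_coord m n a b).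
Proof. by move=> k M N; rewrite /mx_coord !mxE. Qed.

HB.instance Definition _ m n a b :=
  GRing.isLinear.Build R 'M[R]_(m, n) R _ (@mx_coord m n a b)
    (@mx_coord_linear m n a b).

Lemma smooth_coord V m n (U : set V) (f : V -> 'M[R]_(m, n)) a b : open U ->
  smooth_on U f -> smooth_on U (fun x => f x a b).
Proof.
move=> oU /smooth_onE sf; apply/smooth_onE => k.
apply: (@diff_upto_linear _ _ _ k (@mx_coord m n a b)) => //.
by move=> x; exact: coord_continuous.
Qed.

(** Induction on the order with [h] generalised: the derivative of [h \o f] along [v] is ['D_v f]
    times ['D_1 h \o f], a product whose second factor falls under the induction hypothesis. *)
Lemma smooth_compR V (U : set V) (U' : set R) (f : V -> R) (h : R -> R) :
  open U -> open U' -> (forall x, U x -> U' (f x)) ->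
  smooth_on U f -> smooth_on U' h -> smooth_on U (h \o f).
Proof.
move=> oU oU' fU /smooth_onE sf /smooth_onE sh; apply/smooth_onE => n.
elim: n h {sh}(sh n) => [|n IH] h.
  move=> /diff_upto0 dh; apply/diff_upto0 => x Ux.
  apply: differentiable_comp; last exact/dh/fU.
  exact: (diff_upto_diff (sf 0)).
move=> /diff_uptoS[dh dDh]; have [df dDf] := (diff_uptoS _ _ _).1 (sf n.+1).
apply/diff_uptoS; split=> [x Ux|v].
  by apply: differentiable_comp; [exact: df|exact/dh/fU].
apply: eq_diff_upto (diff_uptoM oU (dDf v) (IH _ (dDh 1))) => // x Ux /=.
rewrite (derive_comp _ (df _ Ux) (dh _ (fU _ Ux))) (deriveE _ (dh _ (fU _ Ux))).
by rewrite -[X in _ = 'd h _ X]mulr1 [RHS]linearZ.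
Qed.

Lemma smooth_comp_rV V n (U : set V) (U' : set 'rV[R]_n) (f : V -> 'rV[R]_n)
    (h : 'rV[R]_n -> R) :
  open U -> open U' -> (forall x, U x -> U' (f x)) ->
  smooth_on U f -> smooth_on U' h -> smooth_on U (h \o f).
Proof.
move=> oU oU' fU sf0 /smooth_onE sh; apply/smooth_onE => k.
have /smooth_onE sf := sf0.
elim: k h {sh}(sh k) => [|k IH] h.
  move=> /diff_upto0 dh; apply/diff_upto0 => x Ux.
  apply: differentiable_comp; last exact/dh/fU.
  exact: (diff_upto_diff (sf 0)).
move=> /diff_uptoS[dh dDh]; have [df dDf] := (diff_uptoS _ _ _).1 (sf k.+1).
apply/diff_uptoS; split=> [x Ux|v].
  by apply: differentiable_comp; [exact: df|exact/dh/fU].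
(* The chain rule in coordinates, over an arbitrary list of indices so that sums of two terms
   suffice. *)
have sum_upto (s : seq 'I_n) : diff_upto k U
    (fun x => \sum_(i <- s) ('D_v f x) ord0 i * 'D_(delta_mx ord0 i) h (f x)).
  elim: s => [|i s IHs].
    under eq_fun do rewrite big_nil.
    by have /smooth_onE := @smooth_cst V R U 0; exact.
  under eq_fun do rewrite big_cons; apply: diff_uptoD => //.
  apply: diff_uptoM => //; last exact: (IH _ (dDh _)).
  have /smooth_onE := smooth_coord ord0 i oU (smooth_D v sf0); exact.
apply: eq_diff_upto (sum_upto (index_enum _)) => // x Ux.
rewrite (derive_comp _ (df _ Ux) (dh _ (fU _ Ux))).
rewrite [X in _ = 'd h _ X]row_sum_delta linear_sum; apply: eq_bigr => i _.
by rewrite (deriveE _ (dh _ (fU _ Ux))) linearZ.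
Qed.

End SmoothCalculus.

(** * Flat functions and a smooth cutoff *)

Section Cutoff.
Variable R : realType.
Implicit Types (x y h v : R) (n : nat).

(** The whole family is taken because it is stable under derivation: the derivative of the member
    [n] is [- n] times the member [n.+1] plus the member [n.+2], at 0 as well. Smoothness then
    follows by induction on the order for all members at once. *)
Definition flat_exp n x : R := if 0 < x then x ^- n * expR (- x^-1) else 0.

(** With [y = 1 / ((n + 1) x)], the exponential of [1 / x] is the power [n + 1] of [exp y], and
    [exp y >= 1 + y >= y]. *)
Lemma expRN_le_pow n x : 0 < x -> expR (- x^-1) <= n.+1%:R ^+ n.+1 * x ^+ n.+1.
Proof.
move=> x0; have n0 : (0 : R) < n.+1%:R by rewrite ltr0n.
have y0 : 0 < (n.+1%:R * x)^-1 by rewrite invr_gt0 mulr_gt0.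
rewrite expRN -exprMn -[leRHS]invrK lef_pV2 ?posrE ?expR_gt0 ?invr_gt0 ?exprn_gt0 ?mulr_gt0 //.
have -> : x^-1 = n.+1%:R * (n.+1%:R * x)^-1 by rewrite invfM mulVKf // gt_eqF.
rewrite expRM_natl -exprVn; apply: lerXn2r; rewrite ?nnegrE ?expR_ge0 ?(ltW y0) //.
by apply: le_trans (expR_ge1Dx _); rewrite lerDr.
Qed.

Lemma flat_exp_ge0 n x : 0 <= flat_exp n x.
Proof.
rewrite /flat_exp; case: ifPn => // x0.
by rewrite mulr_ge0 ?expR_ge0 // invr_ge0 exprn_ge0 ?ltW.
Qed.

Lemma flat_exp_gt0 n x : 0 < x -> 0 < flat_exp n x.
Proof. by move=> x0; rewrite /flat_exp x0 mulr_gt0 ?expR_gt0 // invr_gt0 exprn_gt0. Qed.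

Lemma flat_exp0 n x : x <= 0 -> flat_exp n x = 0.
Proof. by rewrite /flat_exp ltNge => ->. Qed.

Lemma flat_exp_le n x : flat_exp n x <= n.+2%:R ^+ n.+2 * `|x| ^+ 2.
Proof.
rewrite /flat_exp; case: ifPn => [x0|_]; last by rewrite mulr_ge0 // exprn_ge0.
rewrite (ger0_norm (ltW x0)) mulrC ler_pdivrMr ?exprn_gt0 // -mulrA -exprD.
by have := expRN_le_pow n.+1 x0; rewrite add2n.
Qed.

Lemma is_derive_flat_exp n x :
  is_derive x 1 (flat_exp n) (- n%:R * flat_exp n.+1 x + flat_exp n.+2 x).
Proof.
have [x0|x0|->] := ltgtP x 0.
- have nx : \forall y \near x, cst 0 y = flat_exp n y.
    near=> y; have y0 : y < 0 by near: y; exact: lt_nbhsl.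
    by rewrite flat_exp0 // ltW.
  apply: near_eq_is_derive nx _.
  by rewrite !flat_exp0 ?(ltW x0) // mulr0 addr0; exact: is_derive_cst.
- have nx : \forall y \near x, ((fun y => (y ^+ n)^-1) * (fun y => expR (- y^-1))) y
      = flat_exp n y.
    near=> y; have y0 : 0 < y by near: y; exact: lt_nbhsr.
    by rewrite /flat_exp y0.
  apply: near_eq_is_derive nx _.
  have xn0 : x != 0 by rewrite gt_eqF.
  have dV : is_derive x 1 (fun y : R => y^-1) (- x ^- 2).
    have := @is_deriveV R id x 1 1 xn0 (is_derive_id _ _).
    by move=> /is_derive_eq; apply; rewrite scaler1.
  have dE : is_derive x 1 (fun y : R => expR (- y^-1)) (expR (- x^-1) * x ^- 2).
    have dN : is_derive x 1 (fun y : R => - y^-1) (x ^- 2).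
      have := is_deriveN dV; rewrite opprK; exact.
    exact: (is_derive1_comp (is_derive_expR _) dN).
  have dX : is_derive x 1 (fun y : R => y ^+ n) (n%:R * x ^+ n.-1).
    apply: DeriveDef; first exact: exprn_derivable.
    by rewrite exp_derive -[LHS]/(_ * _ * 1) mulr1.
  have dW : is_derive x 1 (fun y : R => (y ^+ n)^-1) (- n%:R * x ^- n.+1).
    have := @is_deriveV R _ x _ 1 (expf_neq0 n xn0) dX.
    move=> /is_derive_eq; apply; case: n {dX} => [|n].
      by rewrite /= mul0r scaler0 oppr0 mul0r.
    rewrite /= -[LHS]/(_ * _) !exprSr; field; rewrite ?expf_neq0 ?xn0 //.
  have := is_deriveM dW dE; move=> /is_derive_eq; apply.
  rewrite /flat_exp x0 -[LHS]/(_ * _ + _ * _) !exprSr; field; rewrite ?expf_neq0 ?xn0 //.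
- rewrite !flat_exp0 // mulr0 addr0.
  (* At 0 the quadratic bound [flat_exp_le] makes the difference quotient at most a constant times
     [|h|]. *)
  have lim0 : h^-1 *: (flat_exp n (h *: 1 + 0) - flat_exp n 0) @[h --> 0^'] --> (0 : R).
    set C := n.+2%:R ^+ n.+2 : R.
    have C0 : 0 < C by rewrite exprn_gt0 // ltr0n.
    apply/cvgr0Pnorm_lt => e e0; near=> h.
    have h0 : h != 0 by near: h; exact: nbhs_dnbhs_neq.
    rewrite addr0 [flat_exp n 0]flat_exp0 // subr0 normrZ normfV.
    rewrite ltr_pdivrMl ?normr_gt0 // (ger0_norm (flat_exp_ge0 _ _)).
    rewrite [h *: 1]mulr1; apply: le_lt_trans (flat_exp_le _ _) _.
    rewrite expr2 mulrCA ltr_pM2l ?normr_gt0 // mulrC -ltr_pdivlMr //.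
    by near: h; apply: dnbhs0_lt; rewrite divr_gt0.
  apply: DeriveDef; first by apply/cvg_ex; exists 0.
  exact/cvg_lim.
Unshelve. all: by end_near. Qed.

Lemma derive_flat_exp n v x :
  'D_v (flat_exp n) x = v * (- n%:R * flat_exp n.+1 x + flat_exp n.+2 x).
Proof.
have [dx e] := is_derive_flat_exp n x.
have df : differentiable (flat_exp n) x by apply/derivable1_diffP.
by rewrite (deriveE _ df) -{1}[v]mulr1 linearZ /= -(deriveE _ df) e.
Qed.

Lemma smooth_flat_exp n : smooth_on setT (flat_exp n).
Proof.
apply/smooth_onE => k; elim: k n => [|k IH] n.
  apply/diff_upto0 => x _; apply/derivable1_diffP.
  by have [] := is_derive_flat_exp n x.
apply/diff_uptoS; split=> [x _|v].
  by apply/derivable1_diffP; have [] := is_derive_flat_exp n x.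
have oT := @openT R; have cst_upto c : diff_upto k setT (fun _ : R => c : R).
  by have /smooth_onE := @smooth_cst R R R setT c; exact.
apply: (eq_diff_upto oT) (diff_uptoM oT (cst_upto v)
  (diff_uptoD oT (diff_uptoM oT (cst_upto (- n%:R)) (IH n.+1)) (IH n.+2))) => x _.
by rewrite derive_flat_exp.
Qed.

(* [cutoff] is 1 on ]-oo, 1] and 0 on [4, +oo[. *)
Definition cutoff x := flat_exp 0 (4 - x) / (flat_exp 0 (4 - x) + flat_exp 0 (x - 1)).

Lemma cutoff_den_gt0 x : 0 < flat_exp 0 (4 - x) + flat_exp 0 (x - 1).
Proof.
have [x4|x4] := ltP x 4.
  by rewrite ltr_pwDl ?flat_exp_ge0 // flat_exp_gt0 // subr_gt0.
rewrite ltr_wpDl ?flat_exp_ge0 // flat_exp_gt0 // subr_gt0.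
by apply: lt_le_trans x4; rewrite ltr1n.
Qed.

Lemma cutoff_ge0 x : 0 <= cutoff x.
Proof. by rewrite divr_ge0 ?flat_exp_ge0 // ltW // cutoff_den_gt0. Qed.

Lemma cutoff_le1 x : cutoff x <= 1.
Proof. by rewrite ler_pdivrMr ?cutoff_den_gt0 // mul1r lerDl flat_exp_ge0. Qed.

Lemma cutoff1 x : x <= 1 -> cutoff x = 1.
Proof.
move=> x1; have := cutoff_den_gt0 x; rewrite /cutoff [flat_exp 0 (x - 1)]flat_exp0 ?subr_le0 //.
by rewrite addr0 => h; rewrite divff // gt_eqF.
Qed.

Lemma cutoff0 x : 4 <= x -> cutoff x = 0.
Proof. by move=> x4; rewrite /cutoff flat_exp0 ?mul0r // subr_le0. Qed.

Lemma smooth_affine (a b : R) : smooth_on setT (fun x => a * x + b).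
Proof.
have oT := @openT R; apply: smoothD => //; last exact: smooth_cst.
apply: smooth_scale => //; apply/smooth_onE; case=> [|n].
  by apply/diff_upto0 => x _; exact: ex_diff.
apply/diff_uptoS; split=> [x _|v]; first exact: ex_diff.
have -> : 'D_v (fun x : R => x) = cst v by apply/funext => x; rewrite derive_id.
by have /smooth_onE := @smooth_cst R R R setT v; exact.
Qed.

Lemma smooth_cutoff : smooth_on setT cutoff.
Proof.
have oT := @openT R.
have s1 : smooth_on setT (fun x => flat_exp 0 (4 - x)).
  have := @smooth_compR _ R setT setT _ _ oT oT (fun _ _ => I) (smooth_affine (-1) 4)
    (smooth_flat_exp 0).
  by apply: eq_smooth => // x _ /=; rewrite mulN1r addrC.
have s2 : smooth_on setT (fun x => flat_exp 0 (x - 1)).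
  have := @smooth_compR _ R setT setT _ _ oT oT (fun _ _ => I) (smooth_affine 1 (-1))
    (smooth_flat_exp 0).
  by apply: eq_smooth => // x _ /=; rewrite mul1r.
apply: smoothM => //; apply: smoothV => //; last exact: smoothD.
by move=> x _; rewrite gt_eqF ?cutoff_den_gt0.
Qed.

Lemma derive_cutoff0 x : x < 1 \/ 4 < x -> 'D_1 cutoff x = 0.
Proof.
move=> xl; have [c nx] : exists c, \forall y \near x, cutoff y = cst c y.
  case: xl => xl; [exists 1|exists 0]; near=> y.
    by rewrite cutoff1 // ltW //; near: y; exact: lt_nbhsl.
  by rewrite cutoff0 // ltW //; near: y; exact: lt_nbhsr.
by rewrite (near_eq_derive _ nx) derive_cst.
Unshelve. all: by end_near. Qed.

(** The derivative vanishes below 1 and above 4, so its maximum on [[0, 5]] bounds it everywhere;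
    adding 1 makes the bound positive. *)
Lemma derive_cutoff_bounded : exists2 C, 0 < C & forall x, `|'D_1 cutoff x| <= C.
Proof.
have cD : continuous ('D_1 cutoff).
  by move=> x; exact: (@smooth_cont R R R setT _ x (smooth_D (1 : R) smooth_cutoff) I).
have cN : {within `[0, 5], continuous (fun x => `|'D_1 cutoff x|)}.
  by apply: continuous_subspaceT => x; apply: cvg_norm; exact: cD.
have le05 : (0 : R) <= 5 by [].
have [c _ hc] := EVT_max le05 cN.
exists (`|'D_1 cutoff c| + 1); first by rewrite ltr_wpDl.
move=> x; have [x1|x1] := ltP x 1; first by rewrite derive_cutoff0 ?normr0 ?addr_ge0 //; left.
have [x4|x4] := ltP 4 x; first by rewrite derive_cutoff0 ?normr0 ?addr_ge0 //; right.
apply: (@le_trans _ _ `|'D_1 cutoff c|); last by rewrite lerDl.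
by apply: hc; rewrite in_itv /=; apply/andP; split; lra.
Qed.

End Cutoff.

(** * Continuity arguments on an interval *)

Section LeftLimit.
Variables (R : realType) (T : topologicalType).

Lemma closed_left_limit (f : R -> T) (D : set T) (a t : R) : closed D -> a < t ->
  {for t, continuous f} -> (forall s, a <= s < t -> D (f s)) -> D (f t).
Proof.
move=> cD at_ cf hD; apply: contrapT => nD.
have : \forall s \near t, (~` D) (f s).
  by apply: cf; apply: open_nbhs_nbhs; split => //; exact: closed_openC.
move=> /nbhs_ballP[e /= e0 he].
pose s := t - Num.min e (t - a) / 2.
have m0 : 0 < Num.min e (t - a) / 2 by rewrite divr_gt0 // lt_min e0 subr_gt0.
have mle : Num.min e (t - a) / 2 < Num.min e (t - a).
  by rewrite ltr_pdivrMr // ltr_pMr ?ltr1n // lt_min e0 subr_gt0.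
have st : s < t by rewrite gtrBl.
have as_ : a <= s.
  rewrite lerBrDl addrC -lerBrDl; apply: le_trans (ltW mle) _; by rewrite ge_min lexx orbT.
apply: (he s); last by apply: hD; rewrite as_.
rewrite -ball_normE /= opprB addrC subrK gtr0_norm //.
by apply: lt_le_trans mle _; by rewrite ge_min lexx.
Qed.

End LeftLimit.

Section RealTools.
Variable R : realType.
Implicit Types (f g df dg : R -> R) (a b t s : R).

(** The mean value theorem for [g - f]. Bounds on velocities are integrated in this way, [g] being
    most often a multiple of the primitive [clkB]. *)
Lemma derive_le f g df dg a b : a <= b ->
  (forall t, a <= t <= b -> is_derive t 1 f (df t)) ->
  (forall t, a <= t <= b -> is_derive t 1 g (dg t)) ->
  (forall t, a <= t <= b -> df t <= dg t) ->
  f b - f a <= g b - g a.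
Proof.
move=> ab hf hg hle; pose h := g - f; pose dh t := dg t - df t.
have hd t : t \in `[a, b] -> is_derive t 1 h (dh t).
  by rewrite in_itv /= => tab; apply: is_deriveB; [exact: hg|exact: hf].
have hc : {within `[a, b], continuous h}.
  apply: derivable_within_continuous => t tab.
  by have [] := hd t tab.
have hd' t : t \in `]a, b[ -> is_derive t 1 h (dh t).
  by move=> tab; apply: hd; exact: subset_itv_oo_cc tab.
have [c cab e] := MVT_segment ab hd' hc.
rewrite -subr_ge0; have -> : g b - g a - (f b - f a) = h b - h a.
  by rewrite /h !fctE; ring.
rewrite e mulr_ge0 ?subr_ge0 //.
by apply: hle; move: cab; rewrite in_itv.
Qed.

Lemma derive_norm_le f g df dg a b : a <= b ->
  (forall t, a <= t <= b -> is_derive t 1 f (df t)) ->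
  (forall t, a <= t <= b -> is_derive t 1 g (dg t)) ->
  (forall t, a <= t <= b -> `|df t| <= dg t) ->
  `|f b - f a| <= g b - g a.
Proof.
move=> ab hf hg hle; rewrite ler_norml; apply/andP; split; last first.
  apply: (derive_le ab hf hg) => t /hle; exact: le_trans (ler_norm _).
have hN t : a <= t <= b -> is_derive t 1 (- f) (- df t).
  by move=> tab; apply: is_deriveN; exact: hf.
have : (- f) b - (- f) a <= g b - g a.
  apply: (derive_le ab hN hg) => t /hle; apply: le_trans.
  by rewrite -normrN ler_norm.
by rewrite lerNl !fctE; apply: le_trans; rewrite !opprD !opprK.
Qed.

Lemma derive0_eq f a b : a <= b ->
  (forall t, a <= t <= b -> is_derive t 1 f 0) -> f b = f a.
Proof.
move=> ab hf; apply/eqP; rewrite -subr_eq0 -normr_le0.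
rewrite -[leRHS](subrr (cst (0 : R) b)).
apply: (@derive_norm_le f (cst 0) _ (cst 0) a b ab hf) => t _.
by rewrite normr0.
Qed.

(** Let [T] be the supremum of the times up to which [P] holds. The limit hypothesis gives [P] at
    [T], and if [T < b] the extension hypothesis contradicts the choice of [T]. *)
Lemma continuous_induction (P : R -> Prop) a b : P a ->
  (forall t, a <= t < b -> (forall s, a <= s <= t -> P s) ->
     exists2 e, 0 < e & forall s, t < s < t + e -> s <= b -> P s) ->
  (forall t, a < t <= b -> (forall s, a <= s < t -> P s) -> P t) ->
  forall t, a <= t <= b -> P t.
Proof.
move=> Pa Hr Hc t0 t0ab.
have ab : a <= b by case/andP: t0ab; exact: le_trans.
pose S := [set t | a <= t <= b /\ forall s, a <= s <= t -> P s].
have Sa : S a.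
  split; first by rewrite lexx.
  by move=> s; rewrite -eq_le => /eqP <-.
have ubS : ubound S b by move=> t [/andP[]].
have hS : has_sup S by split; [exists a|exists b].
pose T := sup S.
have aT : a <= T by apply: ub_le_sup Sa; exists b.
have Tb : T <= b by apply: ge_sup; [exists a|exact: ubS].
have PlT s : a <= s < T -> P s.
  move=> /andP[as_ sT].
  have [t [_ ht] st] := sup_gt (ex_intro _ a Sa) sT.
  by apply: ht; rewrite as_ ltW.
have PT : P T.
  have [aT'|] := ltP a T; first by apply: Hc => //; rewrite aT' Tb.
  by move=> Ta; have -> : T = a by apply/eqP; rewrite eq_le aT Ta.
have PleT s : a <= s <= T -> P s.
  by move=> /andP[as_]; rewrite le_eqVlt => /predU1P[->//|sT]; apply: PlT; rewrite as_.
have [TB|bT] := ltP T b; last first.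
  by apply: PleT; case/andP: t0ab => -> /= /le_trans; apply.
have aTb : a <= T < b by rewrite aT TB.
have [e e0 he] := Hr T aTb PleT.
pose m := T + Num.min e (b - T) / 2.
have m0 : 0 < Num.min e (b - T) / 2 by rewrite divr_gt0 // lt_min e0 subr_gt0.
have mle : Num.min e (b - T) / 2 < Num.min e (b - T).
  by rewrite ltr_pdivrMr // ltr_pMr ?ltr1n // lt_min e0 subr_gt0.
have Sm : S m.
  have mb : m <= b.
    rewrite -lerBrDl; apply: le_trans (ltW mle) _; by rewrite ge_min lexx orbT.
  split; first by rewrite mb andbT (le_trans aT) // lerDl ltW.
  move=> s /andP[as_ sm]; have [sT|Ts] := leP s T; first by apply: PleT; rewrite as_.
  apply: he; last exact: le_trans mb.
  rewrite Ts /=; apply: le_lt_trans sm _; rewrite ltrD2l; apply: lt_le_trans mle _.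
  by rewrite ge_min lexx.
have : m <= T by apply: ub_le_sup Sm; exists b.
by rewrite gerDl leNgt m0.
Qed.

(** An a priori stay in [N] improves itself to [C]. Openness of [N] prolongs the stay, and
    closedness of [C] keeps the limit point inside [N]. *)
Lemma bootstrap (T : topologicalType) (c : R -> T) (N C : set T) a b :
  {in `[a, b], forall t, {for t, continuous c}} ->
  open N -> closed C -> C `<=` N -> N (c a) ->
  (forall t, a <= t <= b -> (forall s, a <= s <= t -> N (c s)) -> C (c t)) ->
  forall t, a <= t <= b -> N (c t).
Proof.
move=> cc oN cC CN Na H; apply: continuous_induction => // t.
  move=> /andP[at_ tb] Nt.
  have ct : {for t, continuous c} by apply: cc; rewrite in_itv /= at_ ltW.
  have : \forall s \near t, N (c s).
    by apply: ct; apply: open_nbhs_nbhs; split => //; apply: Nt; rewrite at_ lexx.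
  move=> /nbhs_ballP[e /= e0 he]; exists e => // s /andP[ts se] _; apply: he.
  by rewrite -ball_normE /= ltr0_norm ?subr_lt0 // opprB ltrBlDl.
move=> /andP[at_ tb] Nt; apply: CN.
have ct : {for t, continuous c} by apply: cc; rewrite in_itv /= tb ltW.
apply: (closed_left_limit cC at_ ct) => s /andP[as_ st].
apply: H; first by rewrite as_ (le_trans (ltW st)).
by move=> s' /andP[as' s's]; apply: Nt; rewrite as' (le_lt_trans s's).
Qed.

End RealTools.

(** * Primitives and time profiles *)

Section Clock.
Variable R : realType.
Implicit Types (t s k eta : R) (f F : R -> R).

(** The integral starts at -1, so it is differentiated only to the right of -1. The normalisation at
    0 prepares the gluing with the primitive of the reflected function. *)
Lemma primitive_right f : continuous f ->
  exists F, F 0 = 0 /\ forall t, -1 < t -> is_derive t 1 F (f t).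
Proof.
move=> cf; pose G t := \int[lebesgue_measure]_(s in `[-1, t]) f s.
exists (fun t => G t - G 0); split=> [|t t1]; first exact: subrr.
have int u : lebesgue_measure.-integrable `[-1, u] (EFin \o f).
  apply: continuous_compact_integrable; first exact: segment_compact.
  exact: continuous_subspaceT.
have tt1 : t < t + 1 by rewrite ltrDl.
have [dG eG] := continuous_FTC1_closed tt1 (int (t + 1)) t1 (cf t).
rewrite derive1E in eG.
have dG' : is_derive t 1 G (f t) by apply: DeriveDef.
have := is_deriveB dG' (is_derive_cst (G 0) t 1); rewrite subr0; exact.
Qed.

Lemma is_derive_reflect F t (d : R) :
  is_derive (- t) 1 F d -> is_derive t 1 (fun s => - F (- s)) d.
Proof.
move=> dF; have dN : is_derive t 1 (fun s : R => - s) (-1).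
  exact: (@is_deriveN _ _ _ id t 1 1 (is_derive_id _ _)).
have := is_deriveN (is_derive1_comp dF dN).
by rewrite mulrN1 opprK.
Qed.

Lemma primitive_exists f : continuous f -> exists F, forall t, is_derive t 1 F (f t).
Proof.
move=> cf; have [F [F0 dF]] := primitive_right cf.
have cfN : continuous (fun t => f (- t)).
  by move=> t; apply: continuous_comp; [exact: opp_continuous|exact: cf].
have [H [H0 dH]] := primitive_right cfN.
have dHN t : t < 1 -> is_derive t 1 (fun s => - H (- s)) (f t).
  move=> t1; apply: is_derive_reflect; rewrite -[t in f t]opprK; apply: dH.
  by rewrite ltrN2.
(* Both candidates vanish at 0 and have derivative [f] on []-1, 1[]; since they agree there, the
   function glued at 0 is differentiable at 0. *)
have eqFH t : -1 < t < 1 -> F t = - H (- t).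
  move=> /andP[t1 t2]; pose D := F - (fun s => - H (- s)).
  have dD s : -1 < s < 1 -> is_derive s 1 D 0.
    move=> /andP[s1 s2]; rewrite -(subrr (f s)).
    by apply: is_deriveB; [exact: dF|exact: dHN].
  have D0 : D 0 = 0 by rewrite /D !fctE oppr0 F0 H0 !oppr0 addr0.
  suff : D t = 0 by rewrite /D !fctE => /eqP; rewrite subr_eq0 => /eqP.
  have [t0|/ltW t0] := leP 0 t.
    rewrite -D0; apply: derive0_eq => // s /andP[s0 st]; apply: dD; lra.
  rewrite -D0; apply/esym; apply: derive0_eq => // s /andP[s0 st]; apply: dD; lra.
exists (fun t => if 0 <= t then F t else - H (- t)) => t.
have [t0|t0|t0] := ltgtP t 0.
- apply: near_eq_is_derive (dHN t _); last by apply: lt_trans t0 _.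
  near=> s; have s0 : s < 0 by near: s; exact: lt_nbhsl.
  by rewrite leNgt s0.
- apply: near_eq_is_derive (dF t _); last by apply: lt_trans t0.
  near=> s; have s0 : 0 < s by near: s; exact: lt_nbhsr.
  by rewrite ltW.
- rewrite t0; apply: near_eq_is_derive (dF 0 _); last by [].
  near=> s; have s1 : s < 1 by near: s; exact: lt_nbhsl.
  have s2 : -1 < s by near: s; exact: lt_nbhsr.
  by case: ifP => // _; apply: eqFH; rewrite s1 s2.
Unshelve. all: by end_near. Qed.

(* Time profiles of the Hamiltonian: the field confining to the zero section is
   multiplied by [clkA], the pushing one by [clkb]. *)
Record clock k eta := Clock {
  clkA : R -> R ; clkb : R -> R ; clkB : R -> R ; clkt : R ;
  clkt_gt0 : 0 < clkt ;
  clkA_smooth : smooth_on setT clkA ;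
  clkb_smooth : smooth_on setT clkb ;
  clkA_per : forall t, clkA (t + 1) = clkA t ;
  clkb_per : forall t, clkb (t + 1) = clkb t ;
  clkA_ge0 : forall t, 0 <= clkA t ;
  clkb_ge0 : forall t, 0 <= clkb t ;
  clkAb : forall t, clkA t = 1 \/ clkb t = k ;
  clkA0 : forall t, `|t| <= clkt -> clkA t = 0 ;
  clkbk : forall t, `|t| <= clkt -> clkb t = k ;
  clkB_derive : forall t, is_derive t 1 clkB (clkb t) ;
  clkB_period : forall t, clkB (t + 1) - clkB t <= eta }.

Let two_pi : R := 2 * pi.

Lemma smooth_cos : smooth_on setT (@cos R).
Proof.
have oT := @openT R.
suff H n : diff_upto n setT (@cos R) /\ diff_upto n setT (@sin R).
  by apply/smooth_onE => n; case: (H n).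
have dc (x : R) : differentiable (@cos R) x.
  by apply/derivable1_diffP; case: (is_derive_cos x).
have ds (x : R) : differentiable (@sin R) x.
  by apply/derivable1_diffP; case: (is_derive_sin x).
elim: n => [|n [IHc IHs]]; first by split; apply/diff_upto0.
have cst_upto (c : R) : diff_upto n setT (fun _ : R => c : R).
  by have /smooth_onE := @smooth_cst R R R setT c; exact.
split; apply/diff_uptoS; split=> // v.
  apply: (eq_diff_upto oT) (diff_uptoM oT (cst_upto (- v)) IHs) => x _.
  rewrite (deriveE _ (dc x)) -[in RHS](mulr1 v) linearZ /= -(deriveE _ (dc x)).
  by have [_ ->] := is_derive_cos x; rewrite -[RHS]/(_ * _) mulrN mulNr.
apply: (eq_diff_upto oT) (diff_uptoM oT (cst_upto v) IHc) => x _.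
rewrite (deriveE _ (ds x)) -[in RHS](mulr1 v) linearZ /= -(deriveE _ (ds x)).
by have [_ ->] := is_derive_sin x.
Qed.

(** A smooth 1-periodic substitute for the squared distance to the integers. *)
Let u t : R := 1 - cos (two_pi * t).

Let u_smooth : smooth_on setT u.
Proof.
have oT := @openT R.
have sc := @smooth_compR _ R setT setT _ _ oT oT (fun _ _ => I)
  (smooth_affine two_pi 0) smooth_cos.
have s1 := @smooth_cst R R R setT (1 : R).
apply: (eq_smooth oT) (smoothD oT s1 (smoothN oT sc)) => x _.
by rewrite /= addr0.
Qed.

Let u_per t : u (t + 1) = u t.
Proof.
have -> : u (t + 1) = 1 - cos (two_pi * t + pi + pi).
  by rewrite /u; congr (1 - cos _); rewrite /two_pi; ring.
by rewrite !cosDpi opprK.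
Qed.

(** [u] increases on [[0, 1/2]] and is symmetric about [1/2]. *)
Let u_ge tau t : 0 < tau -> tau <= 1/2 -> tau <= t <= 1 - tau -> u tau <= u t.
Proof.
move=> tau0 tau2 /andP[t1 t2]; rewrite lerD2l lerN2.
have pi0 := pi_gt0 R.
have dec a b : 0 <= a <= b -> b <= 1/2 -> cos (two_pi * b) <= cos (two_pi * a).
  move=> /andP[a0 ab] b2; rewrite leNgt ltr_cos ?in_itv /= /two_pi.
  - by rewrite -leNgt ler_pM2l // mulr_gt0.
  - by apply/andP; split; nra.
  - by apply/andP; split; nra.
have [tl|tl] := leP t (1/2); first by apply: dec => //; rewrite t1 ltW.
have -> : cos (two_pi * t) = cos (two_pi * (1 - t)).
  rewrite -[RHS]cosN.
  have -> : - (two_pi * (1 - t)) = two_pi * t - pi - pi by rewrite /two_pi; ring.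
  have cosBpi x : cos (x - pi) = - cos x :> R.
    by rewrite -[x in RHS](subrK (pi : R)) cosDpi opprK.
  by rewrite !cosBpi opprK.
by apply: dec; [apply/andP; split; lra|lra].
Qed.

(** Both profiles are cutoffs of [u], at levels chosen to overlap: [b = k] where [u <= w] and
    [A = 1] where [u >= w], so one of the two holds at every time. Where [u <= w / 4], which
    includes a neighbourhood of 0, [A] vanishes and [b = k]. *)
Lemma clock_exists k eta : 0 < k -> 0 < eta -> clock k eta.
Proof.
move=> k0 eta0.
have oT := @openT R.
(* In each period [b] is nonzero only within [tau] of the integers and never exceeds [k], so its
   integral is at most [2 * tau * k <= eta]. *)
pose tau := Num.min (1/4) (eta / (2 * k)).
have tau0 : 0 < tau by rewrite lt_min !divr_gt0 // mulr_gt0.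
have tau4 : tau <= 1/4 by rewrite ge_min lexx.
have tauk : 2 * tau * k <= eta.
  have : tau <= eta / (2 * k) by rewrite ge_min lexx orbT.
  by rewrite ler_pdivlMr ?mulr_gt0 //; lra.
have u0 : u 0 = 0 by rewrite /u mulr0 cos0 subrr.
have pi0 := pi_gt0 R.
have utau : 0 < u tau.
  by rewrite subr_gt0 -cos0 ltr_cos ?in_itv /= /two_pi ?lexx ?mulr_gt0 ?pi_ge0 //; apply/andP; split; nra.
(* The cutoff vanishes from 4 on, so [b] vanishes as soon as [u] reaches [4 * w = u tau]. *)
pose w := u tau / 4.
have w0 : 0 < w by rewrite divr_gt0.
pose b t := k * cutoff (w^-1 * u t + 0).
pose A t := 1 - cutoff (4 / w * u t + 0).
have sb : smooth_on setT b.
  apply: smooth_scale => //.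
  apply: (@smooth_compR _ R setT setT _ (@cutoff R) oT oT (fun _ _ => I) _ (@smooth_cutoff R)).
  exact: (@smooth_compR _ R setT setT _ _ oT oT (fun _ _ => I) u_smooth (smooth_affine _ 0)).
have sA : smooth_on setT A.
  apply: smoothD => //; first exact: (@smooth_cst R R R setT 1).
  apply: smoothN => //.
  apply: (@smooth_compR _ R setT setT _ (@cutoff R) oT oT (fun _ _ => I) _ (@smooth_cutoff R)).
  exact: (@smooth_compR _ R setT setT _ _ oT oT (fun _ _ => I) u_smooth (smooth_affine _ 0)).
have bper t : b (t + 1) = b t by rewrite /b u_per.
have cb : continuous b by move=> x; exact: (@smooth_cont R R R setT _ x sb I).
have /cid[B dB] := primitive_exists cb.
have b0 t : 0 <= b t by rewrite mulr_ge0 ?cutoff_ge0 // ltW.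
have bk t : b t <= k by rewrite -[leRHS]mulr1 ler_pM2l // cutoff_le1.
have bz t : tau <= t <= 1 - tau -> b t = 0.
  move=> ht; have tau2 : tau <= 1/2 by lra.
  have h := u_ge tau0 tau2 ht.
  by rewrite /b cutoff0 ?mulr0 // addr0 mulrC ler_pdivlMr // /w; lra.
(* The increment over a period does not depend on where the period starts, so it may be estimated on
   [[0, 1]]. *)
have Bper t : B (t + 1) = B t + (B 1 - B 0).
  have dS s : is_derive s 1 (fun s => B (s + 1)) (b s).
    have dsh : is_derive s 1 (fun s : R => s + 1) 1.
      have := is_deriveD (is_derive_id s (1 : R)) (is_derive_cst (1 : R) s 1).
      by rewrite addr0; exact.
    have := @is_derive1_comp R B (fun s => s + 1) s _ _ (dB (s + 1)) dsh.
    by rewrite mulr1 bper; exact.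
  pose D := (fun s => B (s + 1)) - B.
  have dD s : is_derive s 1 D 0 by rewrite -(subrr (b s)); apply: is_deriveB.
  have : D t = D 0.
    have [t0|/ltW t0] := leP 0 t; first exact: derive0_eq.
    by apply/esym; exact: derive0_eq.
  by rewrite /D !fctE add0r => <-; rewrite subrKC.
have dk t : is_derive t 1 (fun s => k * s) k.
  have := @is_deriveZ R R R id k t 1 1 (is_derive_id _ _).
  by rewrite -[X in is_derive _ _ _ X]/(k * 1) mulr1; exact.
have Bup x y : x <= y -> B y - B x <= k * y - k * x.
  by move=> xy; apply: (@derive_le R B _ b (fun=> k)).
have cu : continuous u by move=> x; exact: (@smooth_cont R R R setT _ x u_smooth I).
have /cid2[tau1 tau10 htau1] : exists2 t1, 0 < t1 & forall t, `|t| <= t1 -> u t <= w / 4.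
  have nu : \forall t \near 0, u t < w / 4.
    have := cvgr_lt (u 0) (cu 0); rewrite u0; apply; exact: divr_gt0.
  have /nbhs_ballP[e /= e0 he] := nu.
  exists (e / 2); first by rewrite divr_gt0.
  move=> t te; apply/ltW/he; rewrite -ball_normE /= sub0r normrN.
  by apply: le_lt_trans te _; rewrite ltr_pdivrMr // ltr_pMr ?ltr1n.
have bk1 t : `|t| <= tau1 -> b t = k.
  move=> /htau1 h; rewrite /b cutoff1 ?mulr1 // addr0 mulrC ler_pdivrMr // mul1r; lra.
have Bd : B 1 - B 0 <= eta.
  have h1 := Bup 0 tau (ltW tau0).
  have le1 : 1 - tau <= 1 by lra.
  have h2 := Bup (1 - tau) 1 le1.
  have h3 : B (1 - tau) = B tau.
    have le2 : tau <= 1 - tau by lra.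
    apply: derive0_eq le2 _ => t ht; rewrite -(bz t ht); exact: dB.
  lra.
apply: (@Clock k eta A b B tau1) => //.
- by move=> t; rewrite /A u_per.
- by move=> t; rewrite subr_ge0 cutoff_le1.
- move=> t; have [h|h] := leP 4 (4 / w * u t + 0).
    by left; rewrite /A cutoff0 ?subr0.
  right; rewrite /b cutoff1 ?mulr1 //.
  have h' : 4 * u t < 4 * w by move: h; rewrite addr0 mulrAC ltr_pdivrMr.
  by rewrite addr0 mulrC ler_pdivrMr // mul1r; lra.
- move=> t /htau1 h; rewrite /A cutoff1 ?subrr // addr0 mulrAC ler_pdivrMr // mul1r; lra.
- by move=> t; rewrite Bper addrAC subrr add0r.
Qed.

End Clock.

(** * Compactness and charts *)

Section Uniformity.
Variables (R : realType) (T : topologicalType).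

(** The near-covering form of compactness, for the filter of right neighbourhoods of 0, replaces a
    finite subcover and a minimum. To suit this monotonicity, upper bounds are later written with
    [e^-1]. *)
Lemma compact_uniform (P : T -> R -> Prop) : compact [set: T] ->
  (forall (x : T) e e', 0 < e' -> e' <= e -> P x e -> P x e') ->
  (forall x : T, exists2 e, 0 < e & \forall y \near x, P y e) ->
  exists2 e, 0 < e & forall x, P x e.
Proof.
move=> /compact_near_coveringP cT mono loc.
have h : \forall e \near (0 : R)^'+, [set: T] `<=` (fun x => P x e).
  apply: (cT R _ (fun e x => P x e)) => x _; have [e e0 he] := loc x.
  exists ((fun y => P y e), [set e' | 0 < e' < e]) => /=.
    split => //; near=> e'; apply/andP; split; near: e'; first exact: nbhs_right_gt.
    exact: nbhs_right_lt.
  move=> [y e'] /= [Py /andP[e'0 e'e]]; exact: mono e'0 (ltW e'e) Py.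
near (0 : R)^'+ => e; exists e; first by near: e; exact: nbhs_right_gt.
by move=> x; have := near h e; apply.
Unshelve. all: by end_near. Qed.

End Uniformity.

Section CompactBall.
Variables (R : realType) (n : nat).

Definition cball (c : 'rV[R]_n) (r : R) : set 'rV[R]_n := [set q | `|q - c| <= r].

Lemma closed_cball c r : closed (cball c r).
Proof.
have -> : cball c r = (fun q => `|q - c|) @^-1` [set y | y <= r] by [].
apply: closed_comp; last exact: closed_le.
move=> q _; have dq : differentiable (fun p : 'rV[R]_n => p - c) q.
  by apply: differentiableB; [exact: ex_diff|exact: differentiable_cst].
have cq := differentiable_continuous dq; exact: (cvg_norm cq).
Qed.

Lemma compact_cball c r : compact (cball c r).
Proof.
apply: bounded_closed_compact (closed_cball (c := c) (r := r)).
exists (`|c| + r); split; first exact: num_real.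
move=> x xr q /= qr; apply: le_trans (ltW xr).
rewrite -(subrK c q) addrC; apply: le_trans (ler_normD _ _) _.
by rewrite lerD2l.
Qed.

Lemma nbhs_cball (U : set 'rV[R]_n) (c : 'rV[R]_n) : nbhs c U ->
  exists2 r, 0 < r & cball c r `<=` U.
Proof.
move=> /nbhs_ballP[e /= e0 he]; exists (e / 2); first by rewrite divr_gt0.
move=> q /= qc; apply: he; rewrite -ball_normE /= distrC; apply: le_lt_trans qc _.
by rewrite ltr_pdivrMr // ltr_pMr ?ltr1n.
Qed.

End CompactBall.

Section Charts.
Variables (R : realType) (n : nat) (M : topologicalType).
Variable A : smooth_atlas R n M.
Implicit Types (i j k : cidx A) (q v : 'rV[R]_n) (x y : M) (h : M -> R).

Lemma dom_open i : open (dom i). Proof. exact: cdom_open. Qed.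
Lemma img_open i : open (img i). Proof. exact: cimg_open. Qed.
Lemma dom_at x : dom (chart_at A x) x. Proof. exact: chart_atP. Qed.
Lemma crdK i x : dom i x -> pnt i (crd i x) = x. Proof. exact: cmapK. Qed.
Lemma img_crd i x : dom i x -> img i (crd i x). Proof. by move=> ix; exists x. Qed.
Lemma dom_pnt i q : img i q -> dom i (pnt i q).
Proof. by case=> x ix <-; rewrite -/(crd i x) crdK. Qed.
Lemma pntK i q : img i q -> crd i (pnt i q) = q.
Proof. by case=> x ix <-; rewrite -/(crd i x) crdK. Qed.
Lemma crd_cont i x : dom i x -> {for x, continuous (crd i)}.
Proof. exact: cmap_continuous. Qed.
Lemma pnt_cont i q : img i q -> {for q, continuous (pnt i)}.
Proof. by case=> x ix <-; exact: cinv_continuous. Qed.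

Lemma near_dom i x : dom i x -> \forall y \near x, dom i y.
Proof. by move=> ix; apply: open_nbhs_nbhs; split => //; exact: dom_open. Qed.

Lemma near_img i q : img i q -> \forall p \near q, img i p.
Proof. by move=> iq; apply: open_nbhs_nbhs; split => //; exact: img_open. Qed.

Lemma open_img_pre i (W : set M) : open W -> open (img i `&` pnt i @^-1` W).
Proof.
move=> oW; rewrite openE => q [iq Wq]; rewrite /interior.
apply: filterI; first exact: near_img.
by apply: (pnt_cont iq); apply: open_nbhs_nbhs.
Qed.

Lemma open_dom_pre i (U : set 'rV[R]_n) : open U -> open (dom i `&` crd i @^-1` U).
Proof.
move=> oU; rewrite openE => x [ix Ux]; rewrite /interior.
apply: filterI; first exact: near_dom.
by apply: (crd_cont ix); apply: open_nbhs_nbhs.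
Qed.

Definition ovl i j : set 'rV[R]_n := img i `&` pnt i @^-1` dom j.

Lemma ovl_open i j : open (ovl i j).
Proof. by apply: open_img_pre; exact: dom_open. Qed.

Lemma ovl_crd i j x : dom i x -> dom j x -> ovl i j (crd i x).
Proof. by move=> ix jx; split; [exact: img_crd|rewrite /= crdK]. Qed.

Definition trans i j : 'rV[R]_n -> 'rV[R]_n := crd j \o pnt i.

Lemma trans_crd i j x : dom i x -> trans i j (crd i x) = crd j x.
Proof. by move=> ix; rewrite /trans /= crdK. Qed.

Lemma trans_smooth i j : smooth_on (ovl i j) (trans i j).
Proof.
apply: smooth_onW (transition_smooth (s := A) (i:=i) (j:=j)).
by move=> q [iq jq]; exists (pnt i q); [split => //; exact: dom_pnt|exact: pntK].
Qed.

Lemma trans_diff i j x : dom i x -> dom j x -> differentiable (trans i j) (crd i x).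
Proof. by move=> ix jx; apply: (smooth_diff (@trans_smooth i j)); exact: ovl_crd. Qed.

(* Locked: comparing two Jacobians by conversion diverges. *)
Definition tj : cidx A -> cidx A -> M -> 'M[R]_n := locked (@jac R n M A).

Lemma tjE i j x : tj i j x = jac i j x. Proof. by rewrite /tj -lock. Qed.

Lemma mul_jac i j x v : dom i x -> dom j x ->
  v *m tj i j x = 'd (trans i j) (crd i x) v.
Proof. by move=> ix jx; rewrite tjE /jac /jacobian mul_rV_lin1. Qed.

Lemma row_jac i j x a : dom i x -> dom j x ->
  row a (tj i j x) = 'D_(delta_mx ord0 a) (trans i j) (crd i x).
Proof.
move=> ix jx; rewrite (deriveE _ (trans_diff ix jx)) rowE.
exact: mul_jac.
Qed.

Lemma jac_entry i j x a b : dom i x -> dom j x ->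
  tj i j x a b = ('D_(delta_mx ord0 a) (trans i j) (crd i x)) ord0 b.
Proof. by move=> ix jx; rewrite -row_jac // [RHS]mxE. Qed.

Lemma jac_comp i j k x : dom i x -> dom j x -> dom k x ->
  tj i j x *m tj j k x = tj i k x.
Proof.
move=> ix jx kx; apply/row_matrixP => a.
rewrite row_mul.
rewrite (row_jac a ix jx).
rewrite (row_jac a ix kx).
rewrite (mul_jac _ jx kx).
have djk : differentiable (trans j k) (trans i j (crd i x)).
  by rewrite trans_crd //; exact: trans_diff.
have dij := trans_diff ix jx.
have near_eq : \forall q \near crd i x, (trans j k \o trans i j) q = trans i k q.
  have := open_nbhs_nbhs (conj (@ovl_open i j) (ovl_crd ix jx)).
  by apply: filterS => q [iq jq]; rewrite /trans /= crdK.
by rewrite -(near_eq_derive _ near_eq) (derive_comp _ dij djk) trans_crd.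
Qed.

Lemma jacii i x : dom i x -> tj i i x = 1%:M.
Proof.
move=> ix; apply/row_matrixP => a; rewrite row_jac // row1.
have near_eq : \forall q \near crd i x, trans i i q = id q.
  by apply: filterS (near_img (img_crd ix)) => q iq; rewrite /trans /= pntK.
by rewrite (near_eq_derive _ near_eq) derive_id.
Qed.

Lemma jacK i j x : dom i x -> dom j x -> tj i j x *m tj j i x = 1%:M.
Proof. by move=> ix jx; rewrite jac_comp // jacii. Qed.

Lemma jac_unit i j x : dom i x -> dom j x -> tj i j x \in unitmx.
Proof. by move=> ix jx; have [] := mulmx1_unit (jacK ix jx). Qed.

Definition smooth_fun h := forall i, smooth_on (img i) (h \o pnt i).

(** Transition maps are smooth, so near each point smoothness in a single chart is enough. *)
Lemma smooth_fun_local h :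
  (forall x, exists i (N : set 'rV[R]_n),
     [/\ dom i x, open N, N (crd i x) & smooth_on (N `&` img i) (h \o pnt i)]) ->
  smooth_fun h.
Proof.
move=> loc k; apply: smooth_on_local => q kq.
have [i [N [ix oN Nx sh]]] := loc (pnt k q).
pose U := ovl k i `&` trans k i @^-1` N.
have oU : open U.
  rewrite openE => p [kp Np]; rewrite /interior; apply: filterI.
    by apply: open_nbhs_nbhs; split => //; exact: ovl_open.
  by apply: (smooth_cont (@trans_smooth k i) kp); apply: open_nbhs_nbhs.
have oNi : open (N `&` img i) by apply: openI => //; exact: img_open.
exists U, ((h \o pnt i) \o trans k i); split => //.
- apply: (smooth_comp_rV oU oNi _ _ sh).
    by move=> p [[kp ip] Np]; split => //; exact: img_crd.
  by apply: smooth_onW (@trans_smooth k i) => p [].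
- by move=> p [[kp ip] Np] /=; rewrite crdK.
Qed.

Lemma smooth_fun_ext h j (K : set 'rV[R]_n) : hausdorff_space M -> compact K ->
  K `<=` img j -> smooth_on (img j) (h \o pnt j) ->
  (forall x, ~ (pnt j @` K) x -> h x = 0) -> smooth_fun h.
Proof.
move=> hM cK Kj sh h0; apply: smooth_fun_local => x.
have clK : closed (pnt j @` K).
  apply: compact_closed => //; apply: continuous_compact => //.
  apply/subspace_continuousP => q /Kj jq.
  by apply: cvg_within_filter; exact: pnt_cont.
have [Kx|nKx] := pselect ((pnt j @` K) x).
  exists j, setT; split => //; last by rewrite setTI.
  - by case: Kx => q Kq <-; apply: dom_pnt; exact: Kj.
  - exact: openT.
pose i := chart_at A x; pose N := img i `&` pnt i @^-1` (~` (pnt j @` K)).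
have oN : open N by apply: open_img_pre; exact: closed_openC.
exists i, N; split => //; first exact: dom_at.
  by split; [exact/img_crd/dom_at|rewrite /= crdK //; exact: dom_at].
have oNi : open (N `&` img i) by apply: openI => //; exact: img_open.
apply: (eq_smooth oNi) (@smooth_cst R _ R _ 0) => q [[_ nq] _].
by rewrite /= h0.
Qed.

Lemma smooth_fun_cst (c : R) : smooth_fun (fun _ => c).
Proof. by move=> i; exact: smooth_cst. Qed.

Lemma smooth_funD h h' : smooth_fun h -> smooth_fun h' -> smooth_fun (fun x => h x + h' x).
Proof. by move=> sh sh' i; apply: smoothD => //; exact: img_open. Qed.

Lemma smooth_funM h h' : smooth_fun h -> smooth_fun h' -> smooth_fun (fun x => h x * h' x).
Proof. by move=> sh sh' i; apply: smoothM => //; exact: img_open. Qed.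

Lemma smooth_fun_cont h : smooth_fun h -> continuous h.
Proof.
move=> sh x; pose i := chart_at A x; have ix : dom i x := dom_at x.
have hc : {for x, continuous ((h \o pnt i) \o crd i)}.
  by apply: continuous_comp; [exact: crd_cont|exact: (smooth_cont (sh i)) (img_crd ix)].
have e : h x = ((h \o pnt i) \o crd i) x by rewrite /= crdK.
rewrite /continuous_at e; apply: cvg_trans hc.
apply: near_eq_cvg; apply: filterS (near_dom ix) => y iy.
by rewrite /= crdK.
Qed.

Definition dM h i q : 'rV[R]_n := \row_a partial a (h \o pnt i) q.

Lemma dM_jac h i j x : smooth_fun h -> dom i x -> dom j x ->
  dM h i (crd i x) = dM h j (crd j x) *m (tj i j x)^T.
Proof.
move=> sh ix jx; apply/rowP => a; rewrite !mxE /partial.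
have dij := trans_diff ix jx.
have dj : differentiable (h \o pnt j) (trans i j (crd i x)).
  by rewrite (trans_crd j ix); exact: (smooth_diff (sh j) (img_crd jx)).
have near_eq : \forall q \near crd i x, ((h \o pnt j) \o trans i j) q = (h \o pnt i) q.
  have := open_nbhs_nbhs (conj (@ovl_open i j) (ovl_crd ix jx)).
  by apply: filterS => q [iq jq]; rewrite /trans /= crdK.
rewrite -(near_eq_derive _ near_eq) (derive_comp _ dij dj) -row_jac //.
rewrite [X in 'd _ _ X]row_sum_delta linear_sum; apply: eq_bigr => b _.
rewrite linearZ /= !mxE /= mulrC -[LHS]/(_ * _); congr (_ * _).
by rewrite -(deriveE _ dj) trans_crd.
Qed.

End Charts.

(** * A function without critical points on given circles *)

Section PlaneCurves.
Variable R : realType.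

(* Pigeonhole: the curve crosses about [K^2] small steps of a subdivision, each too
   short to meet two points of a [K * K] grid of mesh [eta / 2K]. *)
Lemma curve_avoid (g0 g1 : R -> R) (a b L eta : R) : a < b -> 0 < eta ->
  (forall s t, a <= s <= b -> a <= t <= b -> `|g0 s - g0 t| <= L * `|s - t|) ->
  (forall s t, a <= s <= b -> a <= t <= b -> `|g1 s - g1 t| <= L * `|s - t|) ->
  exists u v, [/\ 0 <= u < eta, 0 <= v < eta &
    forall t, a <= t <= b -> ~ (g0 t = u /\ g1 t = v)].
Proof.
move=> ab eta0 L0 L1; apply: contrapT => noav.
have L_ge0 : 0 <= L.
  have := L0 a b; rewrite !lexx ltW //= => /(_ isT isT) h.
  have := le_trans (normr_ge0 _) h; rewrite pmulr_lge0 // normr_gt0 subr_eq0.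
  by rewrite lt_eqF.
pose w := b - a; have w0 : 0 < w by rewrite subr_gt0.
pose K := (Num.truncn (2 * w * L / eta)).+3.
have Klt : 2 * w * L / eta + 2 <= K%:R.
  have := truncnS_gt (2 * w * L / eta).
  by rewrite /K -addn2 natrD -(addn1 (Num.truncn _)) natrD => /ltW; lra.
have K0 : 0 < K%:R :> R by rewrite ltr0n.
have K2 : 2 <= K%:R :> R by rewrite ler_nat.
(* An index obtained by truncating a number of [[0, N]] takes [N + 1] values, the last one at the
   endpoint [b]. With this [N] there are [K^2 - 1] values for [K^2] grid points. *)
pose N := (K * K - 2)%N.
have KK : (2 < K * K)%N by apply: (@leq_trans (3 * 3)%N) => //; exact: leq_mul.
have NE : N%:R = K%:R * K%:R - 2 :> R by rewrite /N natrB ?natrM // ltnW.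
have N0 : 0 < N%:R :> R by rewrite ltr0n subn_gt0.
pose s := eta / (2 * K%:R); have s0 : 0 < s by rewrite divr_gt0 // mulr_gt0.
have sN : L * (w / N%:R) < s.
  rewrite mulrA ltr_pdivrMr // /s mulrAC ltr_pdivlMr ?mulr_gt0 //.
  have h : (2 * w * L + 2 * eta) <= K%:R * eta.
    rewrite -ler_pdivrMr // mulrDl mulfK ?gt_eqF //.
  rewrite NE.
  have : K%:R * (2 * w * L + 2 * eta) <= K%:R * (K%:R * eta) by rewrite ler_pM2l.
  nra.
have hit (p : 'I_K * 'I_K) : exists t, [/\ a <= t <= b, g0 t = s * p.1%:R & g1 t = s * p.2%:R].
  apply: contrapT => nhit; apply: noav; exists (s * p.1%:R), (s * p.2%:R).
  have bnd (m : 'I_K) : 0 <= s * m%:R < eta.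
    apply/andP; split; first by rewrite mulr_ge0 // ltW.
    rewrite /s mulrAC ltr_pdivrMr ?mulr_gt0 // ltr_pM2l //.
    have : m%:R < K%:R :> R by rewrite ltr_nat.
    lra.
  split=> // t tab [e0 e1]; apply: nhit; by exists t.
pose tau p := projT1 (cid (hit p)).
have tauP p : [/\ a <= tau p <= b, g0 (tau p) = s * p.1%:R & g1 (tau p) = s * p.2%:R].
  exact: projT2 (cid (hit p)).
pose idx p := Num.truncn ((tau p - a) / w * N%:R).
have idx_ge p : 0 <= (tau p - a) / w * N%:R.
  by have [/andP[h _] _ _] := tauP p; rewrite mulr_ge0 ?ler0n // divr_ge0 ?subr_ge0 // ltW.
have idx_lt p : (idx p < N.+1)%N.
  rewrite ltnS truncn_le_nat; apply: (@le_lt_trans _ _ N%:R); last by rewrite ltr_nat.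
  have [/andP[_ h] _ _] := tauP p.
  rewrite -[leRHS]mul1r ler_pM2r // ler_pdivrMr // mul1r lerD2r //.
pose f p : 'I_N.+1 := Ordinal (idx_lt p).
have finj : injective f.
  move=> p p' [] epp.
  have dtau : `|tau p - tau p'| <= w / N%:R.
    have h1 := truncn_itv (idx_ge p); have h2 := truncn_itv (idx_ge p').
    have {}epp : Num.truncn ((tau p - a) / w * N%:R) = Num.truncn ((tau p' - a) / w * N%:R) by [].
    rewrite -epp in h2; set m := Num.truncn _ in h1 h2.
    rewrite -(addn1 m) natrD in h1 h2.
    have e : tau p - tau p' = ((tau p - a) / w * N%:R - (tau p' - a) / w * N%:R) * (w / N%:R).
      by field; rewrite !gt_eqF.
    rewrite e normrM (gtr0_norm (divr_gt0 w0 N0)) -[leRHS]mul1r ler_pM2r ?divr_gt0 //.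
    by rewrite ler_norml; lra.
  have [tp gp0 gp1] := tauP p; have [tp' gp0' gp1'] := tauP p'.
  have close (x y : nat) : `|s * x%:R - s * y%:R| < s -> x = y.
    rewrite -mulrBr normrM (gtr0_norm s0) -[ltRHS]mulr1 ltr_pM2l //.
    move=> h; apply/eqP; rewrite eqn_leq -(ltnS x) -(ltnS y); apply/andP; split.
      by rewrite -(ltr_nat R) -[y.+1]addn1 natrD; move: h; rewrite ltr_norml; lra.
    by rewrite -(ltr_nat R) -[x.+1]addn1 natrD; move: h; rewrite ltr_norml; lra.
  have lt1 : L * `|tau p - tau p'| < s by apply: le_lt_trans sN; exact: ler_wpM2l.
  have e1 := close p.1 p'.1; have e2 := close p.2 p'.2.
  case: p p' {epp dtau} tp tp' gp0 gp1 gp0' gp1' lt1 e1 e2 => [p1 p2] [p1' p2'] /=.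
  move=> tp tp' gp0 gp1 gp0' gp1' lt1 e1 e2.
  congr (_, _); apply/val_inj.
    by apply: e1; rewrite -gp0 -gp0'; apply: le_lt_trans lt1; exact: L0.
  by apply: e2; rewrite -gp1 -gp1'; apply: le_lt_trans lt1; exact: L1.
have := leq_card f finj; rewrite card_prod !card_ord /N leqNgt => /negP; apply.
by move: KK; move: (K * K)%N => [|[|m]] // _; rewrite !subSS subn0 ltnSn.
Qed.

End PlaneCurves.

Section Circles.
Variable R : realType.

Lemma smooth_scalel (V W : normedModType R) (U : set V) (f : V -> R) (w : W) :
  open U -> smooth_on U f -> smooth_on U (fun x => f x *: w).
Proof.
move=> oU /smooth_onE sf; apply/smooth_onE => n.
have lL : linear (fun s : R => s *: w : W).
  by move=> k s s'; rewrite scalerDl scalerA.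
pose hL := GRing.isLinear.Build R R W _ _ lL.
pose L : {linear R -> W} := HB.pack (fun s : R => s *: w : W) hL.
apply: (@diff_upto_linear _ _ _ _ n L) => //.
exact: (@scalel_continuous _ _ w).
Qed.

Lemma smooth_row (V : normedModType R) n (U : set V) (f : V -> 'rV[R]_n) : open U ->
  (forall k, smooth_on U (fun x => f x ord0 k)) -> smooth_on U f.
Proof.
move=> oU sf.
have ss (s : seq 'I_n) :
    smooth_on U (fun x => \sum_(k <- s) f x ord0 k *: (delta_mx ord0 k : 'rV[R]_n)).
  elim: s => [|k s IH].
    by under eq_fun do rewrite big_nil; exact: smooth_cst.
  by under eq_fun do rewrite big_cons; apply: smoothD => //; exact: smooth_scalel.
apply: (eq_smooth oU) (ss (index_enum _)) => x _.
exact/esym/row_sum_delta.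
Qed.

Lemma smooth_id (V : normedModType R) (U : set V) : smooth_on U (fun x : V => x).
Proof.
apply/smooth_onE; case=> [|n]; first by apply/diff_upto0 => x _; exact: ex_diff.
apply/diff_uptoS; split=> [x _|v]; first exact: ex_diff.
have -> : 'D_v (fun x : V => x) = cst v by apply/funext => x; rewrite derive_id.
by have /smooth_onE := @smooth_cst R V V U v; exact.
Qed.

Lemma sum2 (f : 'I_2 -> R) : \sum_i f i = f ord0 + f ord_max.
Proof.
rewrite big_ord_recl big_ord1; congr (_ + f _); exact/val_inj.
Qed.

(** The norm of row vectors is the maximum norm, which is not smooth away from 0; discs and circles
    are Euclidean. *)
Definition nsq (q : 'rV[R]_2) : R := q ord0 ord0 ^+ 2 + q ord0 ord_max ^+ 2.

Lemma nsq_ge0 q : 0 <= nsq q. Proof. by rewrite addr_ge0 ?sqr_ge0. Qed.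

Lemma nsq_mul q : (q *m q^T) ord0 ord0 = nsq q.
Proof. by rewrite mxE sum2 !mxE /nsq !expr2. Qed.

Lemma entry_le_norm (q : 'rV[R]_2) k : `|q ord0 k| <= `|q|.
Proof.
rewrite [leRHS]/Num.Def.normr /= mx_normrE.
exact: (le_bigmax _ (fun i : 'I_1 * 'I_2 => `|q i.1 i.2|) (ord0, k)).
Qed.

Lemma norm_le_entries (q : 'rV[R]_2) (b : R) : 0 <= b ->
  (forall k, `|q ord0 k| <= b) -> `|q| <= b.
Proof.
move=> b0 h; rewrite [leLHS]/Num.Def.normr /= mx_normrE bigmax_le //= => -[i k] _ /=.
by rewrite (ord1 i).
Qed.

Lemma norm_nsq q : `|q| ^+ 2 <= nsq q.
Proof.
have hs : `|q| <= Num.sqrt (nsq q).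
  apply: norm_le_entries => [|k]; first exact: sqrtr_ge0.
  rewrite -sqrtr_sqr ler_sqrt ?nsq_ge0 // /nsq.
  have [->|->] : k = ord0 \/ k = ord_max.
    by case: k => [[|[|//]] hk]; [left|right]; exact/val_inj.
  - by rewrite lerDl sqr_ge0.
  - by rewrite lerDr sqr_ge0.
rewrite -[leRHS]sqr_sqrtr ?nsq_ge0 // lerXn2r ?nnegrE ?sqrtr_ge0 //.
Qed.

Lemma smooth_entry (V : normedModType R) (U : set V) (f : V -> 'rV[R]_2) k :
  open U -> smooth_on U f -> smooth_on U (fun x => f x ord0 k).
Proof. by move=> oU sf; exact: smooth_coord. Qed.

Lemma smooth_nsq (U : set 'rV[R]_2) c : open U -> smooth_on U (fun q => nsq (q - c)).
Proof.
move=> oU.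
have sk k : smooth_on U (fun q : 'rV[R]_2 => (q - c) ord0 k).
  by apply: smooth_entry => //; apply: smoothD => //; [exact: smooth_id|exact: smooth_cst].
apply: (eq_smooth oU) (smoothD oU (smoothM oU (sk ord0) (sk ord0))
  (smoothM oU (sk ord_max) (sk ord_max))) => q _.
by rewrite /nsq !expr2.
Qed.

(** Parametrised by the angle over [[- pi, pi]], the image of the circle is a Lipschitz plane curve
    and misses arbitrarily small points. The pair [(g0, g1)] will be minus the gradient of a
    function. *)
Lemma circle_avoid (U : set 'rV[R]_2) (g0 g1 : 'rV[R]_2 -> R) (c : 'rV[R]_2) (t eta : R) :
  open U -> smooth_on U g0 -> smooth_on U g1 -> 0 < t -> 0 < eta ->
  (forall q, nsq (q - c) = t ^+ 2 -> U q) ->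
  exists u v, [/\ 0 <= u < eta, 0 <= v < eta &
    forall q, nsq (q - c) = t ^+ 2 -> ~ (g0 q = u /\ g1 q = v)].
Proof.
move=> oU s0 s1 t0 eta0 cU; have oT := @openT R.
pose circ (s : R) : 'rV[R]_2 :=
  \row_k (if k == ord0 then t * cos s + c ord0 ord0 else t * sin s + c ord0 ord_max).
have ssin : smooth_on setT (@sin R).
  apply: (eq_smooth oT) (smoothN oT (smooth_D (1 : R) (@smooth_cos R))) => s _.
  by have [_ ->] := is_derive_cos s; rewrite opprK.
have sc : smooth_on setT circ.
  apply: smooth_row => // k; have [->|k0] := eqVneq k ord0.
    under eq_fun do rewrite mxE eqxx.
    by apply: smoothD => //; [apply: smooth_scale => //; exact: smooth_cos|exact: smooth_cst].
  under eq_fun do rewrite mxE (negbTE k0).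
  by apply: smoothD => //; [exact: smooth_scale|exact: smooth_cst].
have circE s : nsq (circ s - c) = t ^+ 2.
  by rewrite /nsq !mxE /= !addrK !exprMn -mulrDr cos2Dsin2 mulr1.
have circU s : setT s -> U (circ s) by move=> _; apply: cU; exact: circE.
have pi0 := pi_gt0 R.
have pile : - pi <= pi :> R by rewrite ge0_cp // ltW.
have lip (g : 'rV[R]_2 -> R) : smooth_on U g -> exists2 L, 0 <= L & forall s s', - pi <= s <= pi -> - pi <= s' <= pi ->
    `|g (circ s) - g (circ s')| <= L * `|s - s'|.
  move=> sg; have sgc : smooth_on setT (g \o circ) by refine (@smooth_comp_rV R R 2 setT U circ g oT oU circU sc sg).
  have cD : continuous ('D_(1 : R) (g \o circ)).
    by move=> x; exact: (@smooth_cont R R R setT _ x (smooth_D (1 : R) sgc) I).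
  have cN : {within `[- pi, pi], continuous (fun x => `|'D_(1 : R) (g \o circ) x|)}.
    by apply: continuous_subspaceT => x; apply: cvg_norm; exact: cD.
  have [m _ hm] := EVT_max pile cN.
  pose L := `|'D_(1 : R) (g \o circ) m|; exists L; first exact: normr_ge0.
  have dg (s : R) : is_derive s 1 (g \o circ) ('D_(1 : R) (g \o circ) s).
    apply: DeriveDef => //; apply: diff_derivable.
    exact: (@smooth_diff R R R setT _ s sgc I).
  have dL (s : R) : is_derive s 1 (fun s => L * s) L.
    have := @is_deriveZ R R R id L s 1 1 (is_derive_id _ _).
    by rewrite -[X in is_derive _ _ _ X]/(L * 1) mulr1; exact.
  have le1 s s' : - pi <= s -> s' <= pi -> s <= s' ->
      `|g (circ s') - g (circ s)| <= L * `|s - s'|.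
    move=> ps ps' ss'; rewrite (distrC s s') (ger0_norm (x := s' - s)) ?subr_ge0 // mulrBr.
    apply: (@derive_norm_le R (g \o circ) _ _ (fun=> L) s s' ss') => // x /andP[sx xs].
    by apply: hm; rewrite in_itv /= (le_trans ps sx) (le_trans xs).
  move=> s s' /andP[s1' s2'] /andP[s3 s4]; have [ss|/ltW ss] := leP s s'.
    by rewrite distrC; exact: le1.
  by rewrite [X in _ <= L * X]distrC; exact: le1.
have [L0 L00 hL0] := lip _ s0; have [L1 L10 hL1] := lip _ s1.
have pilt : - pi < pi :> R by lra.
have [u [v [hu hv huv]]] := @curve_avoid R (g0 \o circ) (g1 \o circ) (- pi) pi (L0 + L1) eta pilt eta0
  (fun s s' h h' => le_trans (hL0 s s' h h') (ler_wpM2r (normr_ge0 _) (ler_wpDr L10 (lexx _))))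
  (fun s s' h h' => le_trans (hL1 s s' h h') (ler_wpM2r (normr_ge0 _) (ler_wpDl L00 (lexx _)))).
exists u, v; split => // q qc.
pose x := (q ord0 ord0 - c ord0 ord0) / t; pose y := (q ord0 ord_max - c ord0 ord_max) / t.
have tn : t != 0 by rewrite gt_eqF.
have xy : x ^+ 2 + y ^+ 2 = 1.
  have : nsq (q - c) / t ^+ 2 = 1 by rewrite qc divff // expf_neq0.
  by rewrite /nsq !mxE mulrDl => <-; rewrite !expr_div_n.
have x1 : -1 <= x <= 1.
  by rewrite -ler_norml -(@ler_sqr _ `|x| 1) ?nnegrE // expr1n -normrX ger0_norm ?sqr_ge0 // -xy lerDl sqr_ge0.
have sy : Num.sqrt (1 - x ^+ 2) = `|y| by rewrite -xy addrC addKr sqrtr_sqr.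
(* The parametrisation is onto: [acos] gives the angle up to sign, and the sign of [y] decides. *)
have [s [sb sx sy']] : exists s, [/\ - pi <= s <= pi, cos s = x & sin s = y].
  have /andP[a0 api] : 0 <= acos x <= pi by rewrite acos_ge0 ?acos_lepi.
  have [y0|y0] := leP 0 y.
    exists (acos x); split; first by rewrite api andbT; lra.
      by rewrite acosK // in_itv.
    by rewrite sin_acos // sy ger0_norm.
  exists (- acos x); split; first by rewrite lerN2 api /=; lra.
    by rewrite cosN acosK // in_itv.
  by rewrite sinN sin_acos // sy ltr0_norm // opprK.
have -> : q = circ s.
  apply/rowP => k; rewrite mxE sx sy'; case: eqVneq => [->|k0].
    by rewrite /x mulrC divfK // subrK.
  have -> : k = ord_max by case: k k0 => [[|[|//]] hk] // _; exact/val_inj.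
  by rewrite /y mulrC divfK // subrK.
exact: huv.
Qed.

End Circles.

Section Discs.
Variables (R : realType) (M : topologicalType) (A : smooth_atlas R 2 M).
Hypotheses (hM : hausdorff_space M) (cM : compact [set: M]).
Implicit Types (i j : cidx A) (q : 'rV[R]_2) (x y : M) (h F : M -> R).

(** The chart must contain the closed disc of twice the radius: [F] is made noncritical on the
    circle of radius [d_rad], and cutoffs need the annulus beyond it. *)
Record disc := Disc {
  d_idx : cidx A ; d_ctr : 'rV[R]_2 ; d_rad : R ;
  d_rad_gt0 : 0 < d_rad ;
  d_img : forall q, nsq (q - d_ctr) <= 4 * d_rad ^+ 2 -> img d_idx q }.

Definition d_dist (d : disc) q : R := nsq (q - d_ctr d).

Lemma d_dist_cont (d : disc) : continuous (d_dist d).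
Proof.
move=> q; exact: (@smooth_cont _ _ _ setT _ q (@smooth_nsq R setT (d_ctr d) (@openT _)) I).
Qed.

Definition d_ball (d : disc) : set 'rV[R]_2 := [set q | d_dist d q <= 4 * d_rad d ^+ 2].

Lemma compact_d_ball d : compact (d_ball d).
Proof.
have cl : closed (d_ball d).
  rewrite (_ : d_ball d = d_dist d @^-1` [set y | y <= 4 * d_rad d ^+ 2]) //.
  by apply: closed_comp; [move=> q _; exact: d_dist_cont|exact: closed_le].
apply: (subclosed_compact cl (@compact_cball R 2 (d_ctr d) (2 * d_rad d))) => q hq.
have r0 : 0 <= 2 * d_rad d by rewrite mulr_ge0 // ltW // d_rad_gt0.
have : `|q - d_ctr d| ^+ 2 <= (2 * d_rad d) ^+ 2.
  by apply: le_trans (norm_nsq _) _; apply: le_trans hq _; rewrite exprMn; lra.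
by rewrite ler_sqr ?nnegrE.
Qed.

Definition ext (d : disc) (w : 'rV[R]_2 -> R) x : R :=
  if `[< dom (d_idx d) x >] then w (crd (d_idx d) x) else 0.

Lemma ext_dom d w x : dom (d_idx d) x -> ext d w x = w (crd (d_idx d) x).
Proof. by move=> dx; rewrite /ext asboolT. Qed.

Lemma ext_pnt d w q : img (d_idx d) q -> ext d w (pnt (d_idx d) q) = w q.
Proof. by move=> iq; rewrite ext_dom ?pntK //; exact: dom_pnt. Qed.

Lemma smooth_fun_ext_disc d w : smooth_on setT w ->
  (forall q, ~ d_ball d q -> w q = 0) -> smooth_fun A (ext d w).
Proof.
move=> sw w0; apply: (@smooth_fun_ext R 2 M A (ext d w) (d_idx d) (d_ball d)) => //.
- exact: compact_d_ball.
- by move=> q; exact: d_img.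
- have oi := @img_open R 2 M A (d_idx d).
  apply: (eq_smooth oi) (smooth_onW (@subsetT _ _) sw) => q iq.
  by rewrite /= ext_pnt.
- move=> x nx; rewrite /ext; case: asboolP => // dx; apply: w0 => bx.
  by apply: nx; exists (crd (d_idx d) x) => //; rewrite crdK.
Qed.

Definition crit F x : Prop := dM F (chart_at A x) (crd (chart_at A x) x) = 0.

Lemma critE F i x : smooth_fun A F -> dom i x ->
  crit F x <-> dM F i (crd i x) = 0.
Proof.
move=> sF ix; have cx := @dom_at R 2 M A x; split=> e.
  by rewrite (dM_jac sF ix cx) e mul0mx.
by rewrite /crit (dM_jac sF cx ix) e mul0mx.
Qed.

Lemma partial_cont h i k q : smooth_fun A h -> img i q ->
  {for q, continuous (partial k (h \o pnt i))}.
Proof. by move=> sh iq; apply: (smooth_cont (smooth_D _ (sh i)) iq). Qed.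

Lemma partialD h h' i k q : smooth_fun A h -> smooth_fun A h' -> img i q ->
  partial k ((fun x => h x + h' x) \o pnt i) q =
  partial k (h \o pnt i) q + partial k (h' \o pnt i) q.
Proof.
move=> sh sh' iq; apply: deriveD; apply: diff_derivable.
  exact: (smooth_diff (sh i) iq).
exact: (smooth_diff (sh' i) iq).
Qed.

Lemma partialZ h c i k q : smooth_fun A h -> img i q ->
  partial k ((fun x => c * h x) \o pnt i) q = c * partial k (h \o pnt i) q.
Proof.
move=> sh iq; apply: (@deriveZ _ _ _ (h \o pnt i)); apply: diff_derivable.
exact: (smooth_diff (sh i) iq).
Qed.

Definition d_circle (d : disc) : set M :=
  [set x | dom (d_idx d) x /\ d_dist d (crd (d_idx d) x) = d_rad d ^+ 2].

Lemma closed_d_circle d : closed (d_circle d).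
Proof.
have -> : d_circle d = pnt (d_idx d) @` [set q | d_dist d q = d_rad d ^+ 2].
  have sub q : d_dist d q = d_rad d ^+ 2 -> img (d_idx d) q.
    move=> e; apply: d_img; rewrite -/(d_dist d q) e ler_peMl ?sqr_ge0 //; lra.
  apply/seteqP; split=> [x [dx ex]|x [q e <-]].
    by exists (crd (d_idx d) x) => //; rewrite crdK.
  by split; [exact/dom_pnt/sub|rewrite pntK //; exact: sub].
apply: compact_closed => //; apply: continuous_compact.
  apply/subspace_continuousP => q /= e; apply: cvg_within_filter; apply: pnt_cont.
  apply: d_img; rewrite -/(d_dist d q) e ler_peMl ?sqr_ge0 //; lra.
have cl : closed [set q | d_dist d q = d_rad d ^+ 2].
  rewrite (_ : [set q | _] = d_dist d @^-1` [set d_rad d ^+ 2]) //.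
  by apply: closed_comp; [move=> q _; exact: d_dist_cont|exact: closed_eq].
apply: (subclosed_compact cl (@compact_d_ball d)) => q /= e.
rewrite /d_ball /= e ler_peMl ?sqr_ge0 //; lra.
Qed.

(** At each point of [G] some partial derivative of [F] is nonzero. It dominates the perturbation
    nearby, and compactness makes the allowed size uniform. *)
Lemma noncritical_stable F l0 l1 (G : set M) : closed G ->
  smooth_fun A F -> smooth_fun A l0 -> smooth_fun A l1 ->
  (forall x, G x -> ~ crit F x) ->
  exists2 e, 0 < e & forall x, G x -> forall u v, `|u| < e -> `|v| < e ->
    ~ crit (fun y => F y + (u * l0 y + v * l1 y)) x.
Proof.
move=> clG sF s0 s1 nc.
apply: (@compact_uniform R M (fun x e => G x -> forall u v, `|u| < e -> `|v| < e ->
    ~ crit (fun y => F y + (u * l0 y + v * l1 y)) x) cM).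
  move=> x e e' e'0 e'e hx Gx u v hu hv.
  by apply: hx => //; [exact: lt_le_trans hu e'e|exact: lt_le_trans hv e'e].
move=> x; have [Gx|nGx] := pselect (G x); last first.
  exists 1 => //; have : \forall y \near x, (~` G) y.
    by apply: open_nbhs_nbhs; split => //; exact: closed_openC.
  by apply: filterS => y nGy Gy.
pose i := chart_at A x; have ix : dom i x := @dom_at R 2 M A x.
have [k hk] : exists k, partial k (F \o pnt i) (crd i x) != 0.
  apply: contrapT => nk; apply: (nc x Gx); apply/rowP => k; rewrite !mxE.
  by apply/eqP; apply: contrapT => /negP hk; apply: nk; exists k.
pose m := `|partial k (F \o pnt i) (crd i x)|.
have m0 : 0 < m by rewrite normr_gt0.
have cpart h : smooth_fun A h ->
    (`|partial k (h \o pnt i) (crd i y)|) @[y --> x] --> `|partial k (h \o pnt i) (crd i x)|.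
  move=> sh; apply: cvg_norm.
  have := @continuous_comp _ _ _ (crd i) (partial k (h \o pnt i)) x (crd_cont ix) _.
  by apply; apply: partial_cont => //; exact: img_crd.
pose C := `|partial k (l0 \o pnt i) (crd i x)| + `|partial k (l1 \o pnt i) (crd i x)| + 1.
have C0 : 0 < C by rewrite ltr_wpDl // addr_ge0.
(* Nearby, the partial derivative of [F] exceeds [m / 2] in absolute value, while each of the two
   perturbing terms is at most [m / 4]. *)
exists (m / (4 * C)); first by rewrite divr_gt0 // mulr_gt0.
have n1 : \forall y \near x, m / 2 < `|partial k (F \o pnt i) (crd i y)|.
  by apply: (cvgr_gt _ (cpart F sF)); rewrite -/m; lra.
have n2 : \forall y \near x, `|partial k (l0 \o pnt i) (crd i y)| < C.
  apply: (cvgr_lt _ (cpart l0 s0)); rewrite /C -addrA ltrDl.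
  by rewrite ltr_wpDl.
have n3 : \forall y \near x, `|partial k (l1 \o pnt i) (crd i y)| < C.
  apply: (cvgr_lt _ (cpart l1 s1)).
  by rewrite /C -addrA addrCA ltrDl ltr_wpDl.
near=> y; have iy : dom i y by near: y; exact: near_dom.
have h1 : m / 2 < `|partial k (F \o pnt i) (crd i y)| by near: y.
have h2 : `|partial k (l0 \o pnt i) (crd i y)| < C by near: y.
have h3 : `|partial k (l1 \o pnt i) (crd i y)| < C by near: y.
move=> _ u v hu hv.
have su : smooth_fun A (fun y => u * l0 y) by apply: smooth_funM => //; exact: smooth_fun_cst.
have sv : smooth_fun A (fun y => v * l1 y) by apply: smooth_funM => //; exact: smooth_fun_cst.
have suv := smooth_funD su sv; have sFuv := smooth_funD sF suv.
rewrite (critE sFuv iy) => /rowP /(_ k); rewrite !mxE.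
have iq := img_crd iy.
rewrite (partialD k sF suv iq) (partialD k su sv iq) (partialZ u k s0 iq) (partialZ v k s1 iq).
set a := partial k (F \o _) _ in h1 *; set b := partial k (l0 \o _) _ in h2 *.
set c := partial k (l1 \o _) _ in h3 *; move=> e.
have : `|a| <= `|u| * `|b| + `|v| * `|c|.
  have -> : a = - (u * b + v * c) by apply/eqP; rewrite -addr_eq0 e.
  by rewrite normrN -!normrM ler_normD.
have hub : `|u| * `|b| <= m / (4 * C) * C by rewrite ler_pM // ltW.
have hvc : `|v| * `|c| <= m / (4 * C) * C by rewrite ler_pM // ltW.
have e4 : m / (4 * C) * C = m / 4 by field; rewrite gt_eqF.
lra.
Unshelve. all: by end_near. Qed.

(* Adding a cut-off linear function [u q0 + v q1] to [F] removes the critical points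
   on a circle as soon as [- (u, v)] is not in the image of the circle under [dF];
   [u] and [v] can be taken so small that the circles already treated stay free of
   critical points. *)
Lemma exists_noncritical (D : M -> disc) (l : seq M) :
  exists F, smooth_fun A F /\ forall x y, x \in l -> d_circle (D x) y -> ~ crit F y.
Proof.
elim: l => [|z l [F [sF ncF]]].
  by exists (fun _ => 0); split; [exact: smooth_fun_cst|].
pose d := D z; pose i := d_idx d; pose t := d_rad d.
have t0 : 0 < t := d_rad_gt0 d; have t20 : 0 < t ^+ 2 by rewrite exprn_gt0.
have a0 : 0 < 6 / 5 / t ^+ 2 by rewrite !divr_gt0.
(* Equal to the coordinate where [d_dist d q <= 3 / 2 * t ^+ 2], and to 0 where
   [d_dist d q >= 4 * t ^+ 2]. *)
pose w k q := cutoff ((6 / 5 / t ^+ 2) * d_dist d q + (- (4 / 5))) * q ord0 k : R.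
have oT := @openT 'rV[R]_2.
have sw k : smooth_on setT (w k).
  apply: smoothM => //; last exact: (smooth_entry k oT (@smooth_id R _ setT)).
  apply: (@smooth_compR _ _ setT setT _ (@cutoff R) oT (@openT R) (fun _ _ => I) _ (@smooth_cutoff R)).
  exact: (@smooth_compR _ _ setT setT _ _ oT (@openT R) (fun _ _ => I)
    (@smooth_nsq R setT (d_ctr d) oT) (smooth_affine _ _)).
have sl k : smooth_fun A (ext d (w k)).
  apply: smooth_fun_ext_disc => // q /negP; rewrite /d_ball /= -ltNge -/t => hq.
  rewrite /w cutoff0 ?mul0r //.
  have : 6 / 5 / t ^+ 2 * (4 * t ^+ 2) <= 6 / 5 / t ^+ 2 * d_dist d q.
    by rewrite (ler_pM2l a0) ltW.
  have -> : 6 / 5 / t ^+ 2 * (4 * t ^+ 2) = 24 / 5 by field; rewrite gt_eqF.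
  lra.
pose G := [set y | exists2 x, x \in l & d_circle (D x) y].
have clG : closed G.
  rewrite (_ : G = \bigcup_(x in [set` l]) d_circle (D x)).
    by apply: closed_bigcup => [|x _]; [exact: finite_seq|exact: closed_d_circle].
  by apply/seteqP; split=> y [x xl hx]; exists x.
have [e e0 he] := noncritical_stable clG sF (sl ord0) (sl ord_max)
  (fun y '(ex_intro2 x xl hy) => ncF x y xl hy).
have sk k : smooth_on (img i) (fun q : 'rV[R]_2 => - partial k (F \o pnt i) q).
  by apply: smoothN; [exact: img_open|exact: smooth_D].
have circ_img (q : 'rV[R]_2) : nsq (q - d_ctr d) = t ^+ 2 -> img i q.
  by move=> eq; apply: d_img; rewrite eq ler_peMl ?sqr_ge0 //; lra.
have [u [v [/andP[u0 ue] /andP[v0 ve] huv]]] :=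
  circle_avoid (@img_open R 2 M A i) (sk ord0) (sk ord_max) t0 e0 circ_img.
have su : smooth_fun A (fun y => u * ext d (w ord0) y) by apply: smooth_funM => //; exact: smooth_fun_cst.
have sv : smooth_fun A (fun y => v * ext d (w ord_max) y) by apply: smooth_funM => //; exact: smooth_fun_cst.
have suv := smooth_funD su sv; have sFuv := smooth_funD sF suv.
exists (fun y => F y + (u * ext d (w ord0) y + v * ext d (w ord_max) y)); split => //.
move=> x y; rewrite inE => /predU1P[->|xl] hy; last first.
  by apply: he; [exists x|rewrite ger0_norm|rewrite ger0_norm].
case: hy => iy ey; rewrite -/d -/i -/t in iy ey.
have iq := img_crd iy; set q := crd i y in ey iq.
rewrite (critE sFuv iy) -/q => e1.
have pw a k : partial a (ext d (w k) \o pnt i) q = (a == k)%:R.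
  have near_eq : \forall p \near q, (fun p : 'rV[R]_2 => p ord0 k) p = (ext d (w k) \o pnt i) p.
    have n1 : \forall p \near q, d_dist d p < (3 / 2) * t ^+ 2.
      by apply: (cvgr_lt _ (@d_dist_cont d q)); rewrite ey; lra.
    near=> p; have ip : img i p by near: p; exact: near_img.
    have hp : d_dist d p < (3 / 2) * t ^+ 2 by near: p.
    rewrite /= ext_pnt // /w cutoff1 ?mul1r //.
    have : 6 / 5 / t ^+ 2 * d_dist d p <= 6 / 5 / t ^+ 2 * ((3 / 2) * t ^+ 2).
      by rewrite (ler_pM2l a0) ltW.
    have -> : 6 / 5 / t ^+ 2 * ((3 / 2) * t ^+ 2) = 9 / 5 by field; rewrite gt_eqF.
    lra.
  rewrite /partial -(near_eq_derive _ near_eq).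
  have dq : differentiable (fun p : 'rV[R]_2 => p ord0 k) q by exact: differentiable_coord.
  have did : derivable (id : 'rV[R]_2 -> 'rV[R]_2) q (delta_mx ord0 a) by exact: derivable_id.
  have := derive_mx did; rewrite derive_id => /matrixP /(_ ord0 k); rewrite [in RHS]mxE => <-.
  by rewrite mxE eqxx /= eq_sym.
apply: (huv q ey); move/rowP : e1 => e1.
have pE a : partial a (F \o pnt i) q + (u * (a == ord0)%:R + v * (a == ord_max)%:R) = 0.
  have := e1 a; rewrite !mxE (partialD a sF suv iq) (partialD a su sv iq).
  by rewrite (partialZ u a (sl ord0) iq) (partialZ v a (sl ord_max) iq) !pw.
have := pE ord0; have := pE ord_max; rewrite !eqxx /= => h1 h0; split; lra.
Unshelve. all: by end_near. Qed.

End Discs.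

(** * Gluing the local models *)

Section FiniteCover.
Variable T : topologicalType.

(** Compactness is applied to the filter of properties that hold for every list containing a given
    finite list; around [x], a list serves once it contains [x]. *)
Lemma compact_seq_cover (P : T -> set T) : compact [set: T] ->
  (forall x, nbhs x (P x)) -> exists l : seq T, forall y, exists2 x, x \in l & P x y.
Proof.
move=> /compact_near_coveringP cT hP.
pose F : set_system (seq T) :=
  [set Q : set (seq T) | exists l0 : seq T, forall l : seq T, {subset l0 <= l} -> Q l].
have FF : Filter F.
  split; first by exists [::].
    move=> Q Q' [l hl] [l' hl']; exists (l ++ l') => s hs.
    by split; [apply: hl|apply: hl'] => x xl; apply: hs; rewrite mem_cat xl ?orbT.
  by move=> Q Q' QQ' [l hl]; exists l => s /hl /QQ'.
have [l0 hl0] : F (fun l => [set: T] `<=` (fun y => exists2 x, x \in l & P x y)).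
  apply: (cT _ F (fun l y => exists2 x, x \in l & P x y)) => x _.
  exists (P x, [set l : seq T | x \in l]) => /=.
    by split; [exact: hP|exists [:: x] => l; apply; rewrite mem_head].
  by move=> [y l] /= [Pxy xl]; exists x.
by exists l0 => y; exact: hl0.
Qed.

End FiniteCover.

Section Blend.
Variables (R : realType) (M : topologicalType) (m n : nat).

(** Successive interpolation along the list rather than a normalised sum: an element of weight 1
    discards everything after it, and an element of weight 0 disappears. So where all weights are 0
    or 1 and one of them is 1, the result is a single [T x]. The initial 0 is discarded as soon as
    some weight is 1. *)
Definition blend (th : M -> R) (T : M -> 'M[R]_(m, n)) (l : seq M) : 'M[R]_(m, n) :=
  foldr (fun x acc => th x *: T x + (1 - th x) *: acc) 0 l.

(** Interpolation commutes with linear maps. The relation between [T] and [T'] is asked only where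
    the weight is nonzero, because a local model has no meaning outside its chart. *)
Lemma blend_morph (L : 'M[R]_(m, n) -> 'M[R]_(m, n)) th T T' l : linear L ->
  (forall x, x \in l -> th x != 0 -> T x = L (T' x)) ->
  blend th T l = L (blend th T' l).
Proof.
move=> lL; have L0 : L 0 = 0.
  by have := lL (-1) 0 0; rewrite scaler0 addr0 scaleN1r addNr.
elim: l => [|x l IH] h /=; first by rewrite L0.
rewrite lL IH; last by move=> y yl; apply: h; rewrite inE yl orbT.
have -> : L ((1 - th x) *: blend th T' l) = (1 - th x) *: L (blend th T' l).
  by have := lL (1 - th x) (blend th T' l) 0; rewrite addr0 L0 addr0.
have [->|tx] := eqVneq (th x) 0; first by rewrite !scale0r.
by rewrite (h x (mem_head _ _) tx).
Qed.

End Blend.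

Section Geometry.
Variables (R : realType) (M : topologicalType) (A : smooth_atlas R 2 M).
Hypotheses (hM : hausdorff_space M) (cM : compact [set: M]).
Implicit Types (i j : cidx A) (q : 'rV[R]_2) (x y : M).

Lemma disc_at_exists x :
  exists d : disc A, d_idx d = chart_at A x /\ d_ctr d = crd (chart_at A x) x.
Proof.
pose i := chart_at A x; have ix : dom i x := @dom_at R 2 M A x.
have [r r0 hr] := nbhs_cball (near_img (img_crd ix)).
have hd q : nsq (q - crd i x) <= 4 * (r / 2) ^+ 2 -> img i q.
  move=> hq; apply: hr; rewrite /cball /=.
  have h : `|q - crd i x| ^+ 2 <= r ^+ 2.
    by apply: le_trans (norm_nsq _) _; apply: le_trans hq _; rewrite expr_div_n; lra.
  by move: h; rewrite ler_sqr ?nnegrE // ltW.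
by exists (Disc (divr_gt0 r0 (ltr0Sn R 1)) hd).
Qed.

Definition disc_at x : disc A := projT1 (cid (disc_at_exists x)).

Lemma disc_atP x :
  d_idx (disc_at x) = chart_at A x /\ d_ctr (disc_at x) = crd (chart_at A x) x.
Proof. exact: projT2 (cid (disc_at_exists x)). Qed.

Definition didx x := d_idx (disc_at x).
Definition ddist x y := d_dist (disc_at x) (crd (didx x) y).
Definition drad2 x := d_rad (disc_at x) ^+ 2.

Lemma drad2_gt0 x : 0 < drad2 x. Proof. by rewrite exprn_gt0 // d_rad_gt0. Qed.

Lemma ddist_cvg x y : dom (didx x) y -> ddist x z @[z --> y] --> ddist x y.
Proof.
move=> dy; have := @continuous_comp _ _ _ (crd (didx x)) (d_dist (disc_at x)) y (crd_cont dy) _.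
by apply; exact: d_dist_cont.
Qed.

(** [ddist x] is meaningless outside the chart of the disc. The doubled disc, being compact, is
    closed in [M], so a point outside the chart has a neighbourhood missing it. *)
Lemma near_outside x y : ~ dom (didx x) y ->
  \forall z \near y, dom (didx x) z -> 4 * drad2 x < ddist x z.
Proof.
move=> ndy; pose K := pnt (didx x) @` d_ball (disc_at x).
have clK : closed K.
  apply: compact_closed => //; apply: continuous_compact (@compact_d_ball _ _ _ (disc_at x)).
  by apply/subspace_continuousP => q /d_img iq; apply: cvg_within_filter; exact: pnt_cont.
have nK : (~` K) y by move=> [q /d_img iq e]; apply: ndy; rewrite -e; exact: dom_pnt.
have : \forall z \near y, (~` K) z.
  by apply: open_nbhs_nbhs; split => //; exact: closed_openC.
apply: filterS => z nKz dz; rewrite ltNge; apply/negP => hz.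
by apply: nKz; exists (crd (didx x) z) => //; rewrite crdK.
Qed.

Lemma near_noncrit (F : M -> R) y : smooth_fun A F -> ~ crit A F y -> \forall z \near y, ~ crit A F z.
Proof.
move=> sF nc.
pose i := chart_at A y; have iy : dom i y := @dom_at R 2 M A y.
have [k hk] : exists k : 'I_2, partial k (F \o pnt i) (crd i y) != 0.
  apply: contrapT => nk; apply: nc; apply/rowP => k; rewrite !mxE.
  by apply/eqP; apply: contrapT => /negP hk; apply: nk; exists k.
have cp : (`|partial k (F \o pnt i) (crd i z)|) @[z --> y] --> `|partial k (F \o pnt i) (crd i y)|.
  apply: cvg_norm.
  have := @continuous_comp _ _ _ (crd i) (partial k (F \o pnt i)) y (crd_cont iy) _.
  by apply; apply: partial_cont => //; exact: img_crd.
have n1 : \forall z \near y, 0 < `|partial k (F \o pnt i) (crd i z)|.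
  by apply: (cvgr_gt _ cp); rewrite normr_gt0.
apply: filterS2 n1 (near_dom iy) => z h iz; rewrite (critE sF iz) => /rowP /(_ k).
by rewrite !mxE => e; rewrite e normr0 ltxx in h.
Qed.

(** Finitely many open discs cover [M], and [F] is noncritical on their boundary circles. Both facts
    are open conditions, so by compactness they survive with a common margin [kap]. *)
Lemma geometry_frame : exists (l : seq M) (F : M -> R) (kap : R),
  [/\ smooth_fun A F, 0 < kap,
    forall y, exists x, [/\ x \in l, dom (didx x) y & ddist x y <= drad2 x - kap] &
    forall y x, x \in l -> dom (didx x) y -> `|ddist x y - drad2 x| <= kap -> ~ crit A F y].
Proof.
have [l hl] : exists l : seq M, forall y, exists2 x, x \in l &
    (dom (didx x) y /\ ddist x y < drad2 x).
  apply: (@compact_seq_cover M (fun x y => dom (didx x) y /\ ddist x y < drad2 x) cM) => x.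
  have [ei ec] := disc_atP x.
  have dx : dom (didx x) x by rewrite /didx ei; exact: dom_at.
  apply: filterI; first exact: near_dom.
  apply: (cvgr_lt _ (ddist_cvg dx)).
  have -> : ddist x x = 0.
    by rewrite /ddist /d_dist /didx ei ec subrr /nsq !mxE expr0n addr0.
  exact: drad2_gt0.
have [F [sF ncF]] := exists_noncritical hM cM disc_at l.
have [k1 k10 hk1] : exists2 e, 0 < e & forall y, exists x,
    [/\ x \in l, dom (didx x) y & ddist x y <= drad2 x - e].
  apply: (@compact_uniform R M (fun y e => exists x,
    [/\ x \in l, dom (didx x) y & ddist x y <= drad2 x - e]) cM).
    by move=> y e e' e'0 e'e [x [xl dy h]]; exists x; split => //; lra.
  move=> y; have [x xl [dy h]] := hl y.
  exists ((drad2 x - ddist x y) / 2); first by rewrite divr_gt0 // subr_gt0.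
  near=> z; exists x; split => //; first by near: z; exact: near_dom.
  near: z; have := cvgr_le _ (ddist_cvg dy); apply; lra.
(* For one disc: outside its chart or off its circle, points near [y] miss a thin enough shell; on
   the circle, points near [y] are noncritical. *)
have near_ok (y x : M) : exists2 e, 0 < e & x \in l ->
    \forall z \near y, dom (didx x) z -> `|ddist x z - drad2 x| <= e -> ~ crit A F z.
  have r0 := drad2_gt0 x.
  have [dy|ndy] := pselect (dom (didx x) y); last first.
    exists (drad2 x) => // _; apply: filterS (near_outside ndy) => z hz dz.
    by have := hz dz; rewrite ler_norml => h1 /andP[_ h2]; lra.
  have [e0|ne0] := eqVneq (ddist x y) (drad2 x).
    exists 1 => // xl; have nc : ~ crit A F y by exact: ncF xl (conj dy e0).
    by apply: filterS (near_noncrit sF nc).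
  exists (`|ddist x y - drad2 x| / 2); first by rewrite divr_gt0 // normr_gt0 subr_eq0.
  move=> _; have cn : `|ddist x z - drad2 x| @[z --> y] --> `|ddist x y - drad2 x|.
    by apply: cvg_norm; apply: cvgB; [exact: ddist_cvg|exact: cvg_cst].
  have : \forall z \near y, `|ddist x y - drad2 x| / 2 < `|ddist x z - drad2 x|.
    apply: (cvgr_gt _ cn); have : 0 < `|ddist x y - drad2 x| by rewrite normr_gt0 subr_eq0.
    lra.
  by apply: filterS => z h _; rewrite leNgt h.
have near_all (s : seq M) y : {subset s <= l} -> exists2 e, 0 < e &
    \forall z \near y, forall x, x \in s -> dom (didx x) z ->
      `|ddist x z - drad2 x| <= e -> ~ crit A F z.
  elim: s => [_|x s IH xsl]; first by exists 1 => //; apply: filterE.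
  have [|e e0 he] := IH; first by move=> z zs; apply: xsl; rewrite inE zs orbT.
  have [e' e'0 he'] := near_ok y x.
  exists (Num.min e e'); first by rewrite lt_min e0.
  have {}he' := he' (xsl x (mem_head _ _)).
  apply: filterS2 he he' => z hz hz' x'; rewrite inE => /predU1P[->|x's] dz h.
    by apply: hz' => //; apply: le_trans h _; rewrite ge_min lexx orbT.
  by apply: hz dz _ => //; apply: le_trans h _; rewrite ge_min lexx.
have [k2 k20 hk2] : exists2 e, 0 < e & forall y x, x \in l -> dom (didx x) y ->
      `|ddist x y - drad2 x| <= e -> ~ crit A F y.
  apply: (@compact_uniform R M (fun y e => forall x, x \in l -> dom (didx x) y ->
      `|ddist x y - drad2 x| <= e -> ~ crit A F y) cM).
    by move=> y e e' e'0 e'e h x xl dy he'; apply: (h x xl dy); exact: le_trans he' e'e.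
  by move=> y; exact: near_all.
exists l, F, (Num.min k1 k2); split => //.
- by rewrite lt_min k10.
- move=> y; have [x [xl dy h]] := hk1 y; exists x; split => //.
  apply: le_trans h _; rewrite lerD2l lerN2 ge_min lexx //.
- move=> y x xl dy h; apply: (hk2 y x xl dy); apply: le_trans h _.
  by rewrite ge_min lexx orbT.
Unshelve. all: by end_near. Qed.

End Geometry.

(** * Weights of the discs and the blended tensors *)

Section Blending.
Variables (R : realType) (M : topologicalType) (A : smooth_atlas R 2 M).
Hypotheses (hM : hausdorff_space M) (cM : compact [set: M]).
Variables (l : seq M) (F : M -> R) (kap : R).
Hypotheses (sF : smooth_fun A F) (kap0 : 0 < kap).
Hypothesis cover : forall y, exists x,
  [/\ x \in l, dom (didx A x) y & ddist A x y <= drad2 A x - kap].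
Hypothesis noncrit : forall y x, x \in l -> dom (didx A x) y ->
  `|ddist A x y - drad2 A x| <= kap -> ~ crit A F y.
Implicit Types (i j : cidx A) (q : 'rV[R]_2) (x y z : M).

Local Notation didx := (didx A).
Local Notation ddist := (ddist A).
Local Notation drad2 := (drad2 A).

(** Half-width of the shell in terms of the squared distance: at most [kap], so that [F] is
    noncritical there, and at most [drad2 x], so that the shell stays in the doubled disc. *)
Let kd x : R := Num.min kap (drad2 x).
Let kd_gt0 x : 0 < kd x. Proof. by rewrite lt_min kap0 drad2_gt0. Qed.
Let kd_kap x : kd x <= kap. Proof. by rewrite ge_min lexx. Qed.
Let kd_rad x : kd x <= drad2 x. Proof. by rewrite ge_min lexx orbT. Qed.
Let slope x : R := 3 / (2 * kd x).
Let slope_gt0 x : 0 < slope x. Proof. by rewrite divr_gt0 // mulr_gt0. Qed.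

(** The affine map sends [drad2 x - kd x] to 1 and [drad2 x + kd x] to 4, the two ends of the
    variation of [cutoff]. *)
Definition theta x : M -> R := ext (disc_at A x)
  (fun q => cutoff (slope x * d_dist (disc_at A x) q + (5 / 2 - slope x * drad2 x))).

Let slopeE x (s : R) : slope x * s + (5 / 2 - slope x * drad2 x) =
  5 / 2 + slope x * (s - drad2 x).
Proof. ring. Qed.

Let slope_kd x : slope x * kd x = 3 / 2.
Proof. by rewrite /slope; field; rewrite gt_eqF. Qed.

Lemma theta_smooth x : smooth_fun A (theta x).
Proof.
have oT := @openT 'rV[R]_2.
apply: smooth_fun_ext_disc => //.
  apply: (@smooth_compR _ _ setT setT _ (@cutoff R) oT (@openT R) (fun _ _ => I) _ (@smooth_cutoff R)).
  exact: (@smooth_compR _ _ setT setT _ _ oT (@openT R) (fun _ _ => I)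
    (@smooth_nsq R setT (d_ctr (disc_at A x)) oT) (smooth_affine _ _)).
move=> q /negP; rewrite /d_ball /= -ltNge => hq; apply: cutoff0; rewrite slopeE.
have : slope x * kd x <= slope x * (d_dist (disc_at A x) q - drad2 x).
  rewrite ler_pM2l //; have := kd_rad x; have := drad2_gt0 A x; rewrite /drad2; lra.
rewrite slope_kd; lra.
Qed.

Lemma theta_ge0 x y : 0 <= theta x y.
Proof. by rewrite /theta /ext; case: asboolP => // _; exact: cutoff_ge0. Qed.

Lemma theta_le1 x y : theta x y <= 1.
Proof. by rewrite /theta /ext; case: asboolP => // _; exact: cutoff_le1. Qed.

Lemma theta_dom x y : theta x y != 0 -> dom (didx x) y.
Proof. by rewrite /theta /ext; case: asboolP => //; rewrite eqxx. Qed.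

Lemma theta1 x y : dom (didx x) y -> ddist x y <= drad2 x - kd x -> theta x y = 1.
Proof.
move=> dy h; rewrite /theta ext_dom // cutoff1 // slopeE.
have : slope x * (ddist x y - drad2 x) <= slope x * (- kd x) by rewrite ler_pM2l //; lra.
by rewrite mulrN slope_kd -/(ddist x y); lra.
Qed.

Lemma theta0 x y : (dom (didx x) y -> drad2 x + kd x <= ddist x y) -> theta x y = 0.
Proof.
rewrite /theta /ext; case: asboolP => // dy /(_ dy) h; rewrite cutoff0 // slopeE.
have : slope x * kd x <= slope x * (ddist x y - drad2 x) by rewrite ler_pM2l //; lra.
by rewrite slope_kd -/(ddist x y); lra.
Qed.

(** Near a point outside the chart of the disc the weight vanishes, so the behaviour of [f] there is
    irrelevant. *)
Lemma smooth_cut x i (f : 'rV[R]_2 -> R) : smooth_on (ovl i (didx x)) f ->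
  smooth_on (img i) (fun q => theta x (pnt i q) * f q).
Proof.
move=> sf; apply: smooth_on_local => q iq.
have [dq|ndq] := pselect (dom (didx x) (pnt i q)).
  exists (ovl i (didx x)), (fun q => theta x (pnt i q) * f q).
  have oo := @ovl_open R 2 M A i (didx x).
  split => //; apply: smoothM => //.
  by apply: smooth_onW (@theta_smooth x i) => p [].
have := near_outside hM ndq.
rewrite /prop_near1 nbhsE /= => -[N [oN Nq] hN].
exists (img i `&` pnt i @^-1` N), (fun _ => 0); split => //.
- exact: open_img_pre.
- exact: smooth_cst.
- move=> p [ip Np]; rewrite theta0 ?mul0r // => dp.
  have := hN _ Np dp; have := kd_rad x; have := drad2_gt0 A x; lra.
Qed.

(** A critical point lies in no shell, and outside the shell of a disc its weight is locally
    constant. *)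
Lemma theta_alt x y : x \in l -> crit A F y ->
  (\forall z \near y, theta x z = 1) \/ (\forall z \near y, theta x z = 0).
Proof.
move=> xl cF; have [dy|ndy] := pselect (dom (didx x) y); last first.
  right; apply: filterS (near_outside hM ndy) => z hz; apply: theta0 => dz.
  by have := hz dz; have := kd_rad x; have := drad2_gt0 A x; lra.
have hk : kap < `|ddist x y - drad2 x|.
  by rewrite ltNge; apply/negP => h; exact: (noncrit xl dy h).
have hkd : kd x < `|ddist x y - drad2 x| by apply: le_lt_trans hk.
have [h|h] := leP 0 (ddist x y - drad2 x).
  right; rewrite ger0_norm // in hkd.
  have n1 : \forall z \near y, drad2 x + kd x < ddist x z.
    by apply: (cvgr_gt _ (ddist_cvg dy)); lra.
  by apply: filterS n1 => z /ltW hz; apply: theta0.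
left; rewrite ltr0_norm // in hkd.
have n1 : \forall z \near y, ddist x z < drad2 x - kd x.
  by apply: (cvgr_lt _ (ddist_cvg dy)); lra.
by apply: filterS2 n1 (near_dom dy) => z /ltW hz dz; apply: theta1.
Qed.

Lemma theta_cover y : exists2 x, x \in l & theta x y = 1.
Proof.
have [x [xl dy h]] := cover y; exists x => //; apply: theta1 => //.
by have := kd_kap x; lra.
Qed.

Local Notation blendA T y := (blend (fun x => theta x y) T l).

(** The first element of the list whose weight is 1 near [y] decides: those before it have weight 0
    near [y], and it discards those after it. *)
Lemma blend_flat (s : seq M) y :
  (forall x, x \in s -> (\forall z \near y, theta x z = 1) \/ (\forall z \near y, theta x z = 0)) ->
  (exists2 x, x \in s & theta x y = 1) ->
  exists2 x, x \in s & \forall z \near y, theta x z = 1 /\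
    forall T : M -> 'M[R]_2, blend (fun x => theta x z) T s = T x.
Proof.
elim: s => [_ [x]//|x s IH alt [x' x's e]].
have [h1|h0] := alt x (mem_head _ _).
  exists x; rewrite ?mem_head //; apply: filterS h1 => z hz; split => // T /=.
  by rewrite hz subrr scale0r addr0 scale1r.
have x's' : x' \in s.
  move: x's; rewrite inE => /predU1P[ex|//]; move: e; rewrite ex (nbhs_singleton h0).
  by move=> /eqP; rewrite eq_sym oner_eq0.
have [x2 x2s h2] := IH (fun z zs => alt z (mem_behead (s := x :: s) zs)) (ex_intro2 _ _ x' x's' e).
exists x2; first by rewrite inE x2s orbT.
apply: filterS2 h0 h2 => z hz [hz2 hT]; split => // T /=.
by rewrite hz scale0r add0r subr0 scale1r hT.
Qed.

(** Each term is the contravariant tensor equal to the identity in the chart of the disc [x]: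
    covectors are carried there and measured by the Euclidean square norm. *)
Definition cometric i q : 'M[R]_2 :=
  blendA (fun x => (tj (didx x) i (pnt i q))^T *m tj (didx x) i (pnt i q)) (pnt i q).

Definition area2 : 'M[R]_2 := delta_mx ord0 ord_max - delta_mx ord_max ord0.

(** Each term is the coordinate area form of the chart of the disc [x]. The disc charts have no
    common orientation, so the blend may vanish or change sign in a shell. *)
Definition magnetic i q : 'M[R]_2 :=
  blendA (fun x => tj i (didx x) (pnt i q) *m area2 *m (tj i (didx x) (pnt i q))^T) (pnt i q).

Lemma area2T : area2^T = - area2.
Proof. by rewrite /area2 linearB /= !trmx_delta opprB. Qed.

Lemma magneticT i q : (magnetic i q)^T = - magnetic i q.
Proof.
rewrite /magnetic; elim: l => [|x s IH] /=; first by rewrite trmx0 oppr0.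
rewrite linearD /= !linearZ /= IH !trmx_mul trmxK area2T mulNmx mulmxN mulmxA.
by rewrite !scalerN opprD.
Qed.

Lemma cometricT i q : (cometric i q)^T = cometric i q.
Proof.
rewrite /cometric; elim: l => [|x s IH] /=; first by rewrite trmx0.
by rewrite linearD /= !linearZ /= IH !trmx_mul trmxK.
Qed.

Lemma tj_entry_smooth_l i j a b :
  smooth_on (ovl i j) (fun q => tj i j (pnt i q) a b).
Proof.
have oo := @ovl_open R 2 M A i j.
have sD := smooth_coord ord0 b oo (smooth_D (delta_mx ord0 a) (@trans_smooth R 2 M A i j)).
apply: (eq_smooth oo) sD => q [iq jq].
by rewrite (jac_entry a b (dom_pnt iq) jq) (pntK iq).
Qed.

Lemma tj_entry_smooth_r i j a b :
  smooth_on (ovl i j) (fun q => tj j i (pnt i q) a b).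
Proof.
have oo := @ovl_open R 2 M A i j; have oo' := @ovl_open R 2 M A j i.
have sub q : ovl i j q -> ovl j i (trans i j q).
  move=> [iq jq]; rewrite /trans /=; apply: ovl_crd => //; exact: dom_pnt.
have sC := smooth_comp_rV oo oo' sub (@trans_smooth R 2 M A i j) (@tj_entry_smooth_l j i a b).
by apply: (eq_smooth oo) sC => q [iq jq]; rewrite /trans /= crdK.
Qed.

Lemma blend_smooth i (T : M -> 'rV[R]_2 -> 'M[R]_2) a b :
  (forall x, smooth_on (ovl i (didx x)) (fun q => T x q a b)) ->
  smooth_on (img i) (fun q => (blendA (fun x => T x q) (pnt i q)) a b).
Proof.
move=> sT; have oi := @img_open R 2 M A i; elim: (l) => [|x s IH] /=.
  under eq_fun do rewrite mxE; exact: smooth_cst.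
under eq_fun do rewrite mxE [X in X + _]mxE [X in _ + X]mxE.
apply: smoothD => //; first exact: smooth_cut.
apply: smoothM => //; apply: smoothD => //; first exact: smooth_cst.
by apply: smoothN => //; exact: (@theta_smooth x i).
Qed.

Lemma cometric_smooth i a b : smooth_on (img i) (fun q => cometric i q a b).
Proof.
apply: blend_smooth => x; have oo := @ovl_open R 2 M A i (didx x).
under eq_fun do rewrite mxE; apply: smooth_sum => // c.
under eq_fun do rewrite [X in X * _]mxE.
by apply: smoothM => //; exact: tj_entry_smooth_r.
Qed.

Lemma magnetic_smooth i a b : smooth_on (img i) (fun q => magnetic i q a b).
Proof.
apply: blend_smooth => x; have oo := @ovl_open R 2 M A i (didx x).
under eq_fun do rewrite mxE; apply: smooth_sum => // c.
under eq_fun do rewrite [X in _ * X]mxE [X in X * _]mxE.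
apply: smoothM => //; last exact: tj_entry_smooth_l.
by apply: smooth_sum => // c'; apply: smoothM => //; [exact: tj_entry_smooth_l|exact: smooth_cst].
Qed.

Lemma cometric_law i j x : dom i x -> dom j x ->
  cometric i (crd i x) = (tj j i x)^T *m cometric j (crd j x) *m tj j i x.
Proof.
move=> ix jx; rewrite /cometric !crdK //.
apply: (@blend_morph R M 2 2 (fun X => (tj j i x)^T *m X *m tj j i x)).
  by move=> c X Y; rewrite mulmxDr mulmxDl -scalemxAr -scalemxAl.
move=> z _ /theta_dom dz.
by rewrite -(jac_comp dz jx ix) trmx_mul !mulmxA.
Qed.

Lemma magnetic_law i j x : dom i x -> dom j x ->
  magnetic i (crd i x) = tj i j x *m magnetic j (crd j x) *m (tj i j x)^T.
Proof.
move=> ix jx; rewrite /magnetic !crdK //.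
apply: (@blend_morph R M 2 2 (fun X => tj i j x *m X *m (tj i j x)^T)).
  by move=> c X Y; rewrite mulmxDr mulmxDl -scalemxAr -scalemxAl.
move=> z _ /theta_dom dz.
by rewrite -(jac_comp ix jx dz) trmx_mul !mulmxA.
Qed.

Definition qform (S : 'M[R]_2) (p : 'rV[R]_2) : R := (p *m S *m p^T) ord0 ord0.

(** A zero weight passes on to the tail of the list, and a nonzero one already contributes a
    positive term. Since some element has weight 1, the zero at the end of the list is never
    reached. *)
Lemma cometric_pos i q p : img i q -> p != 0 -> 0 < qform (cometric i q) p.
Proof.
move=> iq p0; rewrite /cometric; set y := pnt i q.
have iy : dom i y by exact: dom_pnt.
pose T x := (tj (didx x) i y)^T *m tj (didx x) i y.
have Tpos x : dom (didx x) y -> 0 < qform (T x) p.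
  move=> dx; rewrite /qform /T mulmxA -mulmxA -[X in _ *m X]trmxK trmx_mul trmxK nsq_mul.
  rewrite lt_neqAle nsq_ge0 andbT eq_sym; apply: contra p0 => /eqP e.
  have := norm_nsq (p *m (tj (didx x) i y)^T); rewrite e => h.
  have /eqP : `|p *m (tj (didx x) i y)^T| = 0.
    by apply/eqP; rewrite -sqrf_eq0 eq_le h sqr_ge0.
  rewrite normr_eq0 => /eqP e0; apply/eqP.
  have := jacK iy dx; move=> /(congr1 trmx); rewrite trmx1 trmx_mul => e1.
  by rewrite -[p]mulmx1 -e1 mulmxA e0 mul0mx.
have qD (X Y : 'M[R]_2) c c' : qform (c *: X + c' *: Y) p = c * qform X p + c' * qform Y p.
  rewrite /qform mulmxDr mulmxDl mxE; congr (_ + _); by rewrite -scalemxAr -scalemxAl mxE.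
have [x xl ex] := theta_cover y.
have main (s : seq M) : 0 <= qform (blend (fun x => theta x y) T s) p /\
    (x \in s -> 0 < qform (blend (fun x => theta x y) T s) p).
  elim: s => [|z s [IH1 IH2]] /=; first by rewrite /qform mulmx0 mul0mx mxE.
  rewrite qD; have t0 := theta_ge0 z y; have t1 := theta_le1 z y.
  have hz : 0 <= theta z y * qform (T z) p.
    have [->|tz] := eqVneq (theta z y) 0; first by rewrite mul0r.
    by rewrite mulr_ge0 //; apply/ltW/Tpos; exact: theta_dom.
  have hs : 0 <= (1 - theta z y) * qform (blend (fun x => theta x y) T s) p.
    by rewrite mulr_ge0 // subr_ge0.
  split; first exact: addr_ge0.
  have [tz|tz] := eqVneq (theta z y) 0.
    rewrite tz mul0r add0r subr0 mul1r inE => /predU1P[exz|//].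
    by move: ex; rewrite exz tz => /eqP; rewrite eq_sym oner_eq0.
  move=> _; apply: ltr_pwDl hs; rewrite mulr_gt0 //; last exact/Tpos/theta_dom.
  by rewrite lt_neqAle eq_sym tz.
by have [_] := main l; apply.
Qed.

(** Near a critical point both blends reduce to the same term, which is standard in the chart of its
    disc. *)
Lemma locally_flat y : crit A F y -> exists i (N : set M), [/\ dom i y, open N, N y &
  forall z, N z -> [/\ dom i z, cometric i (crd i z) = 1%:M & magnetic i (crd i z) = area2]].
Proof.
move=> cF; have [x xl hx] := blend_flat (fun x xl => theta_alt xl cF) (theta_cover y).
move: hx; rewrite /prop_near1 nbhsE /= => -[N [oN Ny] hN].
have dz z : N z -> dom (didx x) z.
  by move=> /hN[e _]; apply: theta_dom; rewrite e oner_eq0.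
exists (didx x), N; split => //; first exact: dz.
move=> z Nz; have dxz := dz z Nz; have [_ hT] := hN z Nz; split => //.
  by rewrite /cometric crdK // hT jacii // mulmx1 trmx1.
by rewrite /magnetic crdK // hT jacii // mul1mx trmx1 mulmx1.
Qed.

End Blending.

(** * The data used by the dynamics *)

Section Setup.
Variables (R : realType) (M : topologicalType) (A : smooth_atlas R 2 M).
Implicit Types (i j : cidx A) (q p : 'rV[R]_2) (x y z : M).

(* [stS] is a metric on the fibres of T*M: a field of symmetric contravariant
   tensors. *)
Record setup := Setup {
  stS : cidx A -> 'rV[R]_2 -> 'M[R]_2 ;
  sts : tensor2 A ;
  stF : M -> R ;
  ste : R ;
  stS_smooth : forall i a b, smooth_on (img i) (fun q => stS i q a b) ;
  stS_law : forall i j x, dom i x -> dom j x ->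
    stS i (crd i x) = (tj j i x)^T *m stS j (crd j x) *m tj j i x ;
  stS_sym : forall i q, (stS i q)^T = stS i q ;
  stS_pos : forall i q p, img i q -> p != 0 -> 0 < qform (stS i q) p ;
  sts_tensor : is_tensor2 sts ;
  sts_anti : forall i q, (sts i q)^T = - sts i q ;
  stF_smooth : smooth_fun A stF ;
  stF_ge1 : forall x, 1 <= stF x ;
  ste_gt0 : 0 < ste ;
  st_flat : forall x,
    ste < qform (stS (chart_at A x) (crd (chart_at A x) x))
                (dM stF (chart_at A x) (crd (chart_at A x) x)) \/
    exists i, dom i x /\ forall q, `|q - crd i x| < ste ->
      [/\ img i q, stS i q = 1%:M & sts i q = area2 R] }.

Lemma qformE (S : 'M[R]_2) p :
  qform S p = \sum_b (\sum_a p ord0 a * S a b) * p ord0 b.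
Proof. by rewrite /qform mxE; apply: eq_bigr => b _; rewrite mxE [p^T _ _]mxE. Qed.

Lemma qform_law (S : cidx A -> 'rV[R]_2 -> 'M[R]_2) (h : M -> R) i j x :
  smooth_fun A h -> dom i x -> dom j x ->
  S i (crd i x) = (tj j i x)^T *m S j (crd j x) *m tj j i x ->
  qform (S i (crd i x)) (dM h i (crd i x)) = qform (S j (crd j x)) (dM h j (crd j x)).
Proof.
move=> sh ix jx e; rewrite /qform e (dM_jac sh ix jx) trmx_mul trmxK.
set d := dM h j _; set J := tj i j x; set K := tj j i x.
have e1 : K *m J = 1%:M by exact: jacK.
have e2 : J^T *m K^T = 1%:M by rewrite -trmx_mul e1 trmx1.
rewrite !mulmxA -(mulmxA _ J^T K^T) e2 mulmx1 -!mulmxA (mulmxA K J) e1 mul1mx.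
by rewrite !mulmxA.
Qed.

Lemma qform_dM_cont (S : cidx A -> 'rV[R]_2 -> 'M[R]_2) (h : M -> R) i x :
  smooth_fun A h -> (forall a b, smooth_on (img i) (fun q => S i q a b)) -> dom i x ->
  qform (S i (crd i z)) (dM h i (crd i z)) @[z --> x] -->
  qform (S i (crd i x)) (dM h i (crd i x)).
Proof.
move=> sh sS ix.
have oi := @img_open R 2 M A i.
have sq : smooth_on (img i) (fun q => qform (S i q) (dM h i q)).
  under eq_fun do rewrite qformE.
  have sd a : smooth_on (img i) (fun q => dM h i q ord0 a).
    under eq_fun do rewrite mxE; exact: smooth_D.
  apply: smooth_sum => // b; apply: smoothM => //; apply: smooth_sum => // a.
  exact: smoothM.
have := @continuous_comp _ _ _ (crd i) (fun q => qform (S i q) (dM h i q)) x (crd_cont ix) _.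
by apply; exact: (smooth_cont sq (img_crd ix)).
Qed.

Lemma dM_shift (h : M -> R) (c : R) i q : smooth_fun A h -> img i q ->
  dM (fun x => h x + c) i q = dM h i q.
Proof.
move=> sh iq; apply/rowP => a; rewrite !mxE.
rewrite (partialD a sh (@smooth_fun_cst R 2 M A c) iq).
by rewrite -[RHS]addr0; congr (_ + _); exact: derive_cst.
Qed.

(** Each side of the alternative [st_flat], once true at a point for some constant, holds nearby for
    a smaller one. One number can therefore bound the squared norm of [dF] and the radius of the
    flat ball. *)
Lemma setup_exists : hausdorff_space M -> compact [set: M] -> setup.
Proof.
move=> hM cM.
have /cid[l /cid[F0 /cid[kap [sF0 kap0 cover noncrit]]]] := @geometry_frame R M A hM cM.
(* A lower bound of [F0], written so that decreasing [b] weakens it. *)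
have /cid2[b b0 hb] : exists2 b, 0 < b & forall x, - b^-1 <= F0 x.
  apply: (@compact_uniform R M (fun x b => - b^-1 <= F0 x) cM).
    by move=> x e e' e'0 e'e; apply: le_trans; rewrite lerN2 lef_pV2 ?posrE // (lt_le_trans e'0).
  move=> x; exists (`|F0 x| + 1)^-1; first by rewrite invr_gt0 ltr_wpDl.
  rewrite invrK; have c0 := @smooth_fun_cont R 2 M A F0 sF0 x.
  have := cvgr_ge (F0 x) c0; apply.
  have := ler_norm (- F0 x); rewrite normrN; lra.
pose F x := F0 x + (b^-1 + 1).
have sF : smooth_fun A F by apply: smooth_funD => //; exact: smooth_fun_cst.
have dF i q : img i q -> dM F i q = dM F0 i q by move=> iq; exact: dM_shift.
pose S := @cometric R M A l kap; pose s := @magnetic R M A l kap.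
have Slaw := @cometric_law R M A l kap.
have /cid2[e e0 he] : exists2 e, 0 < e & forall x,
    e < qform (S (chart_at A x) (crd (chart_at A x) x))
              (dM F (chart_at A x) (crd (chart_at A x) x)) \/
    exists i, dom i x /\ forall q, `|q - crd i x| < e ->
      [/\ img i q, S i q = 1%:M & s i q = area2 R].
  apply: (@compact_uniform R M (fun x e =>
    e < qform (S (chart_at A x) (crd (chart_at A x) x))
              (dM F (chart_at A x) (crd (chart_at A x) x)) \/
    exists i, dom i x /\ forall q, `|q - crd i x| < e ->
      [/\ img i q, S i q = 1%:M & s i q = area2 R]) cM).
    move=> x e e' e'0 e'e [h|[i [ix h]]]; first by left; exact: le_lt_trans h.
    by right; exists i; split => // q hq; apply: h; exact: lt_le_trans hq e'e.
  move=> x; have [cF|ncF] := pselect (crit A F0 x).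
    have [i [N [ix oN Nx hN]]] := @locally_flat R M A hM l F0 kap kap0 cover noncrit x cF.
    have oU : open (img i `&` pnt i @^-1` N) by exact: open_img_pre.
    have Ux : (img i `&` pnt i @^-1` N) (crd i x).
      by split; [exact: img_crd|rewrite /= crdK].
    have [r r0 hr] := nbhs_cball (open_nbhs_nbhs (conj oU Ux)).
    exists (r / 2); first by rewrite divr_gt0.
    have cn : (crd i z - crd i x) @[z --> x] --> (crd i x - crd i x).
      by apply: cvgB; [exact: crd_cont|exact: cvg_cst].
    have n1 : \forall z \near x, `|crd i z - crd i x| < r / 2.
      by apply: (cvgr_lt _ (cvg_norm cn)); rewrite subrr normr0 divr_gt0.
    apply: filterS2 n1 (near_dom ix) => z hz iz; right; exists i; split => // q hq.
    have [iq Nq] : (img i `&` pnt i @^-1` N) q.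
      apply: hr; rewrite /cball /= -(subrK (crd i z) q) -addrA.
      apply: le_trans (ler_normD _ _) _; lra.
    by have [_ h1 h2] := hN _ Nq; rewrite (pntK iq) in h1 h2; split.
  pose i := chart_at A x; have ix : dom i x := @dom_at R 2 M A x.
  have iq := img_crd ix.
  pose m := qform (S i (crd i x)) (dM F i (crd i x)).
  have m0 : 0 < m.
    apply: (@cometric_pos R M A l kap kap0 cover) => //; rewrite dF //.
    by apply/eqP => e1; exact: ncF.
  exists (m / 2); first by rewrite divr_gt0.
  have cq := qform_dM_cont sF (@cometric_smooth R M A hM l kap kap0 i) ix.
  have n1 : \forall z \near x, m / 2 < qform (S i (crd i z)) (dM F i (crd i z)).
    by apply: (cvgr_gt _ cq); rewrite -/S -/m; lra.
  apply: filterS2 n1 (near_dom ix) => z hz iz; left.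
  have cz := @dom_at R 2 M A z.
  by rewrite (@qform_law S F _ i z sF cz iz (Slaw _ _ _ cz iz)).
apply: (@Setup S s F e) => //.
- by move=> i a c; exact: cometric_smooth.
- by move=> i q; exact: cometricT.
- by move=> i q p; exact: (@cometric_pos R M A l kap kap0 cover).
- split; first by move=> i a c; exact: magnetic_smooth.
  by move=> i j x ix jx; rewrite -tjE; exact: magnetic_law.
- by move=> i q; exact: magneticT.
- by move=> x; rewrite /F; have := hb x; lra.
Qed.

End Setup.

(** * The C^1 norm of a 2-form on a surface *)

Section TwoByTwo.
Variable R : realType.
Implicit Types (B S : 'M[R]_2) (p : 'rV[R]_2).

Lemma ord2P (k : 'I_2) : k = ord0 \/ k = ord_max.
Proof. by case: k => [[|[|//]] hk]; [left|right]; exact/val_inj. Qed.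

Lemma matrix2P B B' : B ord0 ord0 = B' ord0 ord0 -> B ord0 ord_max = B' ord0 ord_max ->
  B ord_max ord0 = B' ord_max ord0 -> B ord_max ord_max = B' ord_max ord_max -> B = B'.
Proof.
by move=> *; apply/matrixP => a b; have [->|->] := ord2P a; have [->|->] := ord2P b.
Qed.

Lemma det2 B : \det B = B ord0 ord0 * B ord_max ord_max - B ord0 ord_max * B ord_max ord0.
Proof.
rewrite (expand_det_row _ ord0) sum2 /cofactor !det_mx11 !mxE /=.
have -> : lift ord0 ord0 = ord_max :> 'I_2 by exact/val_inj.
have -> : lift ord_max ord0 = ord0 :> 'I_2 by exact/val_inj.
by rewrite /= expr0 expr1 mul1r mulN1r mulrN.
Qed.

Lemma area2E : [/\ area2 R ord0 ord0 = 0, area2 R ord0 ord_max = 1,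
  area2 R ord_max ord0 = -1 & area2 R ord_max ord_max = 0].
Proof. by rewrite /area2; split; rewrite !mxE /= ?subr0 ?sub0r. Qed.

Lemma anti2 B : B^T = - B -> B = B ord0 ord_max *: area2 R.
Proof.
have [j00 j01 j10 j11] := area2E.
move=> /matrixP e; have e00 := e ord0 ord0; have e10 := e ord0 ord_max.
have e11 := e ord_max ord_max; rewrite !mxE in e00 e10 e11.
by apply: matrix2P; rewrite [RHS]mxE ?j00 ?j01 ?j10 ?j11; lra.
Qed.

Lemma area2_conj B : B *m area2 R *m B^T = \det B *: area2 R.
Proof.
have [j00 j01 j10 j11] := area2E.
apply: matrix2P; rewrite !(mxE, sum2) ?j00 ?j01 ?j10 ?j11 det2; ring.
Qed.

Lemma qform_transform S (J K : 'M[R]_2) d : K *m J = 1%:M ->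
  qform (K^T *m S *m K) (d *m J^T) = qform S d.
Proof.
move=> e1; rewrite /qform trmx_mul trmxK.
have e2 : J^T *m K^T = 1%:M by rewrite -trmx_mul e1 trmx1.
rewrite !mulmxA -(mulmxA _ J^T K^T) e2 mulmx1 -!mulmxA (mulmxA K J) e1 mul1mx.
by rewrite !mulmxA.
Qed.

Lemma qformZ S c p : qform S (c *: p) = c ^+ 2 * qform S p.
Proof. by rewrite /qform linearZ /= -!scalemxAl -scalemxAr !mxE expr2 mulrA. Qed.

Lemma invmx2 B : \det B != 0 ->
  [/\ invmx B ord0 ord0 = B ord_max ord_max / \det B,
      invmx B ord0 ord_max = - B ord0 ord_max / \det B,
      invmx B ord_max ord0 = - B ord_max ord0 / \det B &
      invmx B ord_max ord_max = B ord0 ord0 / \det B].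
Proof.
move=> d0; have uB : B \in unitmx by rewrite unitmxE unitfE.
pose C : 'M[R]_2 := (\det B)^-1 *: \matrix_(a, b)
  (if a == b then (if a == ord0 then B ord_max ord_max else B ord0 ord0) else - B a b).
have CB : C *m B = 1%:M.
  have := d0; rewrite det2 => d1.
  by apply: matrix2P; rewrite !(mxE, sum2) /= det2; field.
have -> : invmx B = C by rewrite -[C]mulmx1 -(mulmxV uB) mulmxA CB mul1mx.
by split; rewrite !mxE /= mulrC.
Qed.

End TwoByTwo.

Section FormNorms.
Variables (R : realType) (M : topologicalType) (A : smooth_atlas R 2 M).
Variables (g s : tensor2 A).
Hypotheses (hg : riemannian_metric g) (st : is_tensor2 s).
Hypothesis sT : forall i q, (s i q)^T = - s i q.
Implicit Types (i j : cidx A) (q p : 'rV[R]_2) (x y : M).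

Definition dens (s : tensor2 A) i q : R := s i q ord0 ord_max.
Definition detg i q : R := \det (g i q).

Lemma detg_neq0 i q : img i q -> detg i q != 0.
Proof.
move=> iq; apply/det0P => -[v v0 vg].
by have := (hg.2 i q iq).2 v v0; rewrite vg mul0mx mxE ltxx.
Qed.

Lemma dens_smooth i : smooth_on (img i) (dens s i).
Proof. exact: st.1. Qed.

Lemma detg_smooth i : smooth_on (img i) (detg i).
Proof.
have oi := @img_open R 2 M A i; have sg := hg.1.1 i.
apply: (eq_smooth oi) (smoothD oi (smoothM oi (sg ord0 ord0) (sg ord_max ord_max))
  (smoothN oi (smoothM oi (sg ord0 ord_max) (sg ord_max ord0)))) => q _.
by rewrite /detg det2.
Qed.

(* The area form of [g] is parallel, so [nabla s] is the area form times the
   differential of [s_01 / sqrt (det g)]. *)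
Definition covd (s : tensor2 A) i q : 'rV[R]_2 :=
  \row_k (partial k (dens s i) q - dens s i q * partial k (detg i) q / (2 * detg i q)).

(** The factor 2 comes from summing over all pairs of indices, as for a tensor of rank 2. *)
Lemma norm2E i q : img i q -> norm2 g s i q = Num.sqrt (2 * dens s i q ^+ 2 / detg i q).
Proof.
move=> iq; have [i00 i01 i10 i11] := invmx2 (detg_neq0 iq).
have [j00 j01 j10 j11] := area2E R.
have d0 := detg_neq0 iq; rewrite /detg det2 in d0.
rewrite /norm2 /ginv; congr Num.sqrt.
have -> : s i q = dens s i q *: area2 R by exact/anti2/sT.
rewrite !sum2 ?i00 ?i01 ?i10 ?i11.
rewrite ![(_ *: area2 R) _ _]mxE ?j00 ?j01 ?j10 ?j11 /detg det2.
by rewrite /dens; field.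
Qed.

(** On a surface [s] is a multiple of [area2], on which the connection acts through the trace of the
    Christoffel symbols. *)
Lemma nabla2E i q k : img i q -> nabla2 g s i k q = covd s i q ord0 k *: area2 R.
Proof.
move=> iq; have [i00 i01 i10 i11] := invmx2 (detg_neq0 iq).
have [j00 j01 j10 j11] := area2E R.
have d0 := detg_neq0 iq; rewrite /detg det2 in d0.
have oi := @img_open R 2 M A i; have sg := hg.1.1 i.
have gT p : img i p -> g i p ord_max ord0 = g i p ord0 ord_max.
  by move=> ip; have [/matrixP /(_ ord0 ord_max)] := hg.2 i p ip; rewrite mxE.
have sE p a b : s i p a b = dens s i p * area2 R a b.
  by rewrite {1}(anti2 (sT i p)) mxE.
have ds a b : partial k (fun p => s i p a b) q = area2 R a b * partial k (dens s i) q.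
  rewrite /partial; under [X in 'D__ X _]eq_fun do rewrite sE mulrC.
  by apply: (@deriveZ _ _ _ (dens s i)); apply/diff_derivable/(smooth_diff (@dens_smooth i)).
have dg m : partial m (fun p => g i p ord_max ord0) q = partial m (fun p => g i p ord0 ord_max) q.
  apply: (@eq_derive_on _ _ _ (img i)) => // p; rewrite inE; exact: gT.
have dG : partial k (detg i) q =
    g i q ord0 ord0 * partial k (fun p => g i p ord_max ord_max) q +
    g i q ord_max ord_max * partial k (fun p => g i p ord0 ord0) q -
    2 * g i q ord0 ord_max * partial k (fun p => g i p ord0 ord_max) q.
  have df a b : differentiable (fun p => g i p a b) q by exact: smooth_diff (sg a b) iq.
  have dv a b : derivable (fun p => g i p a b) q (delta_mx ord0 k) by exact: diff_derivable.
  rewrite /partial; have -> : 'D_(delta_mx ord0 k) (detg i) q = 'D_(delta_mx ord0 k)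
     ((fun p => g i p ord0 ord0) * (fun p => g i p ord_max ord_max) -
      (fun p => g i p ord0 ord_max) * (fun p => g i p ord0 ord_max)) q.
    apply: (@eq_derive_on _ _ _ (img i)) => // p; rewrite inE => ip.
    by rewrite /detg det2 !fctE (gT _ ip).
  rewrite deriveB ?deriveM //; [|exact: derivableM|exact: derivableM].
  rewrite -![_ *: _]/(_ * _); ring.
(* The trace of the connection is the logarithmic derivative of [sqrt (det g)]. *)
have key : christoffel g i ord0 k ord0 q + christoffel g i ord_max k ord_max q =
    partial k (detg i) q / (2 * detg i q).
  rewrite /christoffel !sum2 /ginv ?i00 ?i01 ?i10 ?i11 dG /detg det2.
  move: d0; rewrite (gT q iq); move: (g i q ord0 ord0) (g i q ord0 ord_max) (g i q ord_max ord_max).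
  move=> a b c d0.
  have [ek|ek] := ord2P k; rewrite ek !dg.
    move: (partial ord0 _ q) (partial ord0 _ q) (partial ord0 _ q) (partial ord_max _ q) (partial ord_max _ q).
    by move=> *; field.
  move: (partial ord_max _ q) (partial ord_max _ q) (partial ord_max _ q) (partial ord0 _ q) (partial ord0 _ q).
  by move=> *; field.
have cE : covd s i q ord0 k = partial k (dens s i) q -
    dens s i q * (christoffel g i ord0 k ord0 q + christoffel g i ord_max k ord_max q).
  by rewrite key [LHS]mxE mulrA.
have ent a b : nabla2 g s i k q a b = area2 R a b * partial k (dens s i) q
    - (christoffel g i ord0 k a q * (dens s i q * area2 R ord0 b)
       + christoffel g i ord_max k a q * (dens s i q * area2 R ord_max b))
    - (christoffel g i ord0 k b q * (dens s i q * area2 R a ord0)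
       + christoffel g i ord_max k b q * (dens s i q * area2 R a ord_max)).
  by rewrite /nabla2 [LHS]mxE !sum2 ds !sE.
move: ent cE; move: (christoffel g i) => Gam ent cE.
apply: matrix2P; rewrite ent [RHS]mxE cE ?j00 ?j01 ?j10 ?j11; clear; ring.
Qed.

Lemma norm_nabla2E i q : img i q -> norm_nabla2 g s i q =
  Num.sqrt (2 / detg i q * qform (ginv g i q) (covd s i q)).
Proof.
move=> iq; have [i00 i01 i10 i11] := invmx2 (detg_neq0 iq).
have [j00 j01 j10 j11] := area2E R.
have d0 := detg_neq0 iq; rewrite /detg det2 in d0.
have ent k a b : nabla2 g s i k q a b = covd s i q ord0 k * area2 R a b.
  by rewrite nabla2E // [LHS]mxE.
rewrite /norm_nabla2; congr Num.sqrt.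
under eq_bigr => k _ do under eq_bigr => a _ do under eq_bigr => b _ do
  under eq_bigr => k' _ do under eq_bigr => a' _ do under eq_bigr => b' _ do
  rewrite !ent.
rewrite qformE !sum2.
move: (covd s i q ord0 ord0) (covd s i q ord0 ord_max) => D0 D1.
rewrite /ginv ?i00 ?i01 ?i10 ?i11 ?j00 ?j01 ?j10 ?j11 /detg det2.
move: d0; move: (g i q ord0 ord0) (g i q ord0 ord_max) (g i q ord_max ord0) (g i q ord_max ord_max).
by clear=> a b c d d0; field.
Qed.

End FormNorms.

Section FormInvariance.
Variables (R : realType) (M : topologicalType) (A : smooth_atlas R 2 M).
Variables (g s : tensor2 A).
Hypotheses (hg : riemannian_metric g) (st : is_tensor2 s).
Hypothesis sT : forall i q, (s i q)^T = - s i q.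
Implicit Types (i j : cidx A) (q p : 'rV[R]_2) (x y : M).

Lemma partial_comp i j x (h : 'rV[R]_2 -> R) k : dom i x -> dom j x ->
  differentiable h (crd j x) ->
  partial k (h \o trans i j) (crd i x) =
  \sum_b tj i j x k b * partial b h (crd j x).
Proof.
move=> ix jx; rewrite -(trans_crd j ix) => dh.
rewrite /partial (derive_comp _ (trans_diff ix jx) dh) -(row_jac k ix jx).
rewrite [X in 'd _ _ X]row_sum_delta linear_sum; apply: eq_bigr => b _.
rewrite linearZ /= [row _ _ _ _]mxE -[LHS]/(_ * _); congr (_ * _).
by rewrite -(deriveE _ dh).
Qed.

Lemma ginv_law i j x : dom i x -> dom j x ->
  ginv g i (crd i x) = (tj j i x)^T *m ginv g j (crd j x) *m tj j i x.
Proof.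
move=> ix jx.
have ui : g i (crd i x) \in unitmx.
  by rewrite unitmxE unitfE; exact: (detg_neq0 hg (img_crd ix)).
have uj : g j (crd j x) \in unitmx.
  by rewrite unitmxE unitfE; exact: (detg_neq0 hg (img_crd jx)).
have e := hg.1.2 i j x ix jx; rewrite -!tjE in e.
set X := RHS; suff Xg : X *m g i (crd i x) = 1%:M.
  by rewrite -[X]mulmx1 -(mulmxV ui) mulmxA Xg mul1mx.
rewrite /X e !mulmxA -(mulmxA _ (tj j i x) (tj i j x)) (jacK jx ix) mulmx1.
by rewrite -(mulmxA _ _ (g j _)) /ginv (mulVmx uj) mulmx1 -trmx_mul (jacK ix jx) trmx1.
Qed.

Lemma dens_law i j x : dom i x -> dom j x ->
  dens s i (crd i x) = \det (tj i j x) * dens s j (crd j x).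
Proof.
move=> ix jx; have [j00 j01 j10 j11] := area2E R.
have := st.2 i j x ix jx; rewrite -tjE (anti2 (sT j (crd j x))).
rewrite -scalemxAr -scalemxAl area2_conj => e.
by rewrite /dens {}e [LHS]mxE [X in _ * X]mxE j01 mulr1 mulrC.
Qed.

Lemma detg_law i j x : dom i x -> dom j x ->
  detg g i (crd i x) = \det (tj i j x) * (\det (tj i j x) * detg g j (crd j x)).
Proof.
move=> ix jx; rewrite /detg (hg.1.2 i j x ix jx) -tjE !det_mulmx det_tr; ring.
Qed.

(** [dens] is multiplied by the Jacobian determinant and [detg] by its square, so the derivatives of
    the determinant in the two terms of [covd] cancel. *)
Lemma covd_law i j x : dom i x -> dom j x ->
  covd g s i (crd i x) = \det (tj i j x) *: (covd g s j (crd j x) *m (tj i j x)^T).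
Proof.
move=> ix jx; set q := crd i x.
have oo := @ovl_open R 2 M A i j; have ovq := ovl_crd ix jx.
pose del (p : 'rV[R]_2) := \det (tj i j (pnt i p)).
have sdel : smooth_on (ovl i j) del.
  have sm a b := @tj_entry_smooth_l R M A i j a b.
  apply: (eq_smooth oo) (smoothD oo (smoothM oo (sm ord0 ord0) (sm ord_max ord_max))
    (smoothN oo (smoothM oo (sm ord0 ord_max) (sm ord_max ord0)))) => p _.
  by rewrite /del det2.
have del0 : \det (tj i j x) != 0.
  by have := jac_unit ix jx; rewrite unitmxE unitfE.
have delq : del q = \det (tj i j x) by rewrite /del /q crdK.
have ddel : differentiable del q := smooth_diff sdel ovq.
have jq := img_crd jx.
have dd : differentiable (dens s j) (crd j x) := smooth_diff (@dens_smooth R M A s st j) jq.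
have dG : differentiable (detg g j) (crd j x) := smooth_diff (@detg_smooth R M A g hg j) jq.
have dT := trans_diff ix jx.
apply/rowP => k.
have eT : trans i j q = crd j x by exact: trans_crd.
have dd' : differentiable (dens s j) (trans i j q) by rewrite eT.
have dG' : differentiable (detg g j) (trans i j q) by rewrite eT.
have ddT := differentiable_comp dT dd'.
have dGT := differentiable_comp dT dG'.
have v0 : derivable del q (delta_mx ord0 k) := diff_derivable ddel.
have v1 : derivable (dens s j \o trans i j) q (delta_mx ord0 k) := diff_derivable ddT.
have v2 : derivable (detg g j \o trans i j) q (delta_mx ord0 k) := diff_derivable dGT.
have pd : partial k (dens s i) q =
   \det (tj i j x) * partial k (dens s j \o trans i j) q + dens s j (crd j x) * partial k del q.
  rewrite /partial.
  have -> : 'D_(delta_mx ord0 k) (dens s i) q = 'D_(delta_mx ord0 k) (del * (dens s j \o trans i j)) q.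
    apply: (@eq_derive_on _ _ _ (ovl i j)) => // p; rewrite inE => -[ip jp].
    rewrite fctE /del /= /trans /= -(dens_law _ jp) ?pntK //; exact: dom_pnt.
  by rewrite (deriveM v0 v1) -![_ *: _]/(_ * _) delq /= eT.
have pG : partial k (detg g i) q =
   \det (tj i j x) * (\det (tj i j x) * partial k (detg g j \o trans i j) q)
   + 2 * detg g j (crd j x) * \det (tj i j x) * partial k del q.
  rewrite /partial.
  have -> : 'D_(delta_mx ord0 k) (detg g i) q =
     'D_(delta_mx ord0 k) (del * (del * (detg g j \o trans i j))) q.
    apply: (@eq_derive_on _ _ _ (ovl i j)) => // p; rewrite inE => -[ip jp].
    rewrite !fctE /del /= /trans /= -(detg_law _ jp) ?pntK //; exact: dom_pnt.
  rewrite (deriveM v0 (derivableM v0 v2)) (deriveM v0 v2).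
  rewrite !fctE -![_ *: _]/(_ * _) delq /= eT; ring.
have G0 := detg_neq0 hg jq.
rewrite [LHS]mxE pd pG (dens_law ix jx) (detg_law ix jx).
rewrite (partial_comp k ix jx dd) (partial_comp k ix jx dG).
rewrite [RHS]mxE [X in _ = _ * X]mxE !sum2 ![covd _ _ _ _ _ _]mxE ![(tj _ _ _)^T _ _]mxE.
move: del0 G0; move: (\det _) (detg g j _) (dens s j _) => dl G d dl0 G0.
move: (tj i j x k ord0) (tj i j x k ord_max) (partial k del q).
move: (partial ord0 (dens s j) _) (partial ord0 (detg g j) _).
move: (partial ord_max (dens s j) _) (partial ord_max (detg g j) _).
by move=> *; field; rewrite dl0 G0.
Qed.

Definition nsq_form i q : R := 2 * dens s i q ^+ 2 / detg g i q.
Definition nsq_nabla i q : R := 2 / detg g i q * qform (ginv g i q) (covd g s i q).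

Lemma nsq_form_inv i j x : dom i x -> dom j x -> nsq_form i (crd i x) = nsq_form j (crd j x).
Proof.
move=> ix jx; rewrite /nsq_form (dens_law ix jx) (detg_law ix jx).
have del0 : \det (tj i j x) != 0.
  by have := jac_unit ix jx; rewrite unitmxE unitfE.
have G0 := detg_neq0 hg (img_crd jx); by field; rewrite del0 G0.
Qed.

Lemma nsq_nabla_inv i j x : dom i x -> dom j x -> nsq_nabla i (crd i x) = nsq_nabla j (crd j x).
Proof.
move=> ix jx; rewrite /nsq_nabla (detg_law ix jx) (covd_law ix jx) qformZ.
rewrite (ginv_law ix jx) qform_transform; last exact: jacK.
have del0 : \det (tj i j x) != 0.
  by have := jac_unit ix jx; rewrite unitmxE unitfE.
have G0 := detg_neq0 hg (img_crd jx); by field; rewrite del0 G0.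
Qed.

Lemma nsq_form_smooth i : smooth_on (img i) (nsq_form i).
Proof.
have oi := @img_open R 2 M A i; have sd := @dens_smooth R M A s st i.
apply: smoothM => //.
  by apply: smooth_scale => //; under eq_fun do rewrite expr2; exact: smoothM.
apply: smoothV => //; [by move=> q; exact: detg_neq0|exact: detg_smooth].
Qed.

Lemma ginv_smooth i a b : smooth_on (img i) (fun q => ginv g i q a b).
Proof.
have oi := @img_open R 2 M A i; have sG := @detg_smooth R M A g hg i; have sg := hg.1.1 i.
have sGV : smooth_on (img i) (fun q => (detg g i q)^-1).
  by apply: smoothV => // q; exact: detg_neq0.
have inv q : img i q -> [/\ ginv g i q ord0 ord0 = g i q ord_max ord_max / detg g i q,
    ginv g i q ord0 ord_max = - g i q ord0 ord_max / detg g i q,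
    ginv g i q ord_max ord0 = - g i q ord_max ord0 / detg g i q &
    ginv g i q ord_max ord_max = g i q ord0 ord0 / detg g i q].
  by move=> iq; apply: invmx2; exact: (detg_neq0 hg iq).
have [->|->] := ord2P a; have [->|->] := ord2P b.
- apply: (eq_smooth oi) (smoothM oi (sg ord_max ord_max) sGV) => q /inv[-> _ _ _] //.
- apply: (eq_smooth oi) (smoothM oi (smoothN oi (sg ord0 ord_max)) sGV) => q /inv[_ -> _ _] //.
- apply: (eq_smooth oi) (smoothM oi (smoothN oi (sg ord_max ord0)) sGV) => q /inv[_ _ -> _] //.
- apply: (eq_smooth oi) (smoothM oi (sg ord0 ord0) sGV) => q /inv[_ _ _ ->] //.
Qed.

Lemma nsq_nabla_smooth i : smooth_on (img i) (nsq_nabla i).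
Proof.
have oi := @img_open R 2 M A i; have sd := @dens_smooth R M A s st i.
have sG := @detg_smooth R M A g hg i; have sg := hg.1.1 i.
have sGV : smooth_on (img i) (fun q => (detg g i q)^-1).
  by apply: smoothV => // q; exact: detg_neq0.
have sgi a b := @ginv_smooth i a b.
have sc a : smooth_on (img i) (fun q => covd g s i q ord0 a).
  under eq_fun do rewrite mxE; apply: smoothD => //; first exact: smooth_D.
  apply: smoothN => //; apply: smoothM => //.
    by apply: smoothM => //; exact: smooth_D.
  under eq_fun do rewrite invfM; apply: smooth_scale => //.
rewrite /nsq_nabla; under eq_fun do rewrite qformE.
apply: smoothM => //; first exact: smooth_scale.
apply: smooth_sum => // b; apply: smoothM => //; apply: smooth_sum => // a.
exact: smoothM.
Qed.

(** The suprema in the norm run over all charts, on whose images continuous functions may be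
    unbounded. As the pointwise norms do not depend on the chart, one chart near each point is
    enough. *)
Lemma form_norms_bounded : compact [set: M] -> exists2 K, 0 < K & forall i q, img i q ->
  nsq_form i q <= K /\ nsq_nabla i q <= K.
Proof.
move=> cM.
have [e e0 he] : exists2 e, 0 < e & forall x, exists i,
    [/\ dom i x, nsq_form i (crd i x) <= e^-1 & nsq_nabla i (crd i x) <= e^-1].
  apply: (@compact_uniform R M (fun x e => exists i,
    [/\ dom i x, nsq_form i (crd i x) <= e^-1 & nsq_nabla i (crd i x) <= e^-1]) cM).
    move=> x e e' e'0 e'e [i [ix h1 h2]]; exists i.
    have le : e^-1 <= e'^-1 by rewrite lef_pV2 ?posrE // (lt_le_trans e'0).
    by split => //; exact: le_trans le.
  move=> x; pose i := chart_at A x; have ix : dom i x := @dom_at R 2 M A x.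
  pose B := `|nsq_form i (crd i x)| + `|nsq_nabla i (crd i x)| + 1.
  have B0 : 0 < B by rewrite ltr_wpDl // addr_ge0.
  exists B^-1; first by rewrite invr_gt0.
  have cc (f : 'rV[R]_2 -> R) : smooth_on (img i) f -> f (crd i z) @[z --> x] --> f (crd i x).
    move=> sf; have := @continuous_comp _ _ _ (crd i) f x (crd_cont ix) _.
    by apply; exact: (smooth_cont sf (img_crd ix)).
  have n1 : \forall z \near x, nsq_form i (crd i z) < B.
    apply: (cvgr_lt _ (cc _ (@nsq_form_smooth i))).
    have := ler_norm (nsq_form i (crd i x)); have := normr_ge0 (nsq_nabla i (crd i x)).
    rewrite /B; lra.
  have n2 : \forall z \near x, nsq_nabla i (crd i z) < B.
    apply: (cvgr_lt _ (cc _ (@nsq_nabla_smooth i))).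
    have := ler_norm (nsq_nabla i (crd i x)); have := normr_ge0 (nsq_form i (crd i x)).
    rewrite /B; lra.
  apply: filterS3 n1 n2 (near_dom ix) => z h1 h2 iz; exists i.
  by rewrite invrK; split => //; exact: ltW.
exists e^-1; first by rewrite invr_gt0.
move=> i q iq; have ix := dom_pnt iq; have [j [jx h1 h2]] := he (pnt i q).
by rewrite -(pntK iq) (nsq_form_inv ix jx) (nsq_nabla_inv ix jx).
Qed.

End FormInvariance.

Section SmallForm.
Variables (R : realType) (M : topologicalType) (A : smooth_atlas R 2 M).

(** Both parts of the norm scale with [c]. Closedness is automatic on a surface: two of the three
    indices coincide, and the terms vanish or cancel by antisymmetry. *)
Lemma small_form (g s : tensor2 A) (eps : R) : compact [set: M] ->
  riemannian_metric g -> is_tensor2 s -> (forall i q, (s i q)^T = - s i q) -> 0 < eps ->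
  exists2 c : R, 0 < c & [/\ two_form (fun i q => c *: s i q),
    closed_form (fun i q => c *: s i q) & (C1norm g (fun i q => c *: s i q) < eps%:E)%E].
Proof.
move=> cM hg st sT eps0.
have [K K0 hK] := form_norms_bounded hg st sT cM.
pose L := Num.sqrt K; have L0 : 0 < L by rewrite sqrtr_gt0.
(* Each of the two suprema is then at most [c * L = eps / 4]. *)
pose c := eps / (4 * L); have c0 : 0 < c by rewrite divr_gt0 // mulr_gt0.
pose sc : tensor2 A := fun i q => c *: s i q.
have scT i q : (sc i q)^T = - sc i q by rewrite /sc linearZ /= sT scalerN.
have sct : is_tensor2 sc.
  split=> [i a b|i j x ix jx].
    have oi := @img_open R 2 M A i.
    apply: (eq_smooth oi) (smooth_scale c oi (st.1 i a b)) => q _.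
    by rewrite /sc mxE.
  by rewrite /sc (st.2 i j x ix jx) -scalemxAr -scalemxAl.
have densc i q : dens sc i q = c * dens s i q by rewrite /dens /sc mxE.
have covdc i q : img i q -> covd g sc i q = c *: covd g s i q.
  move=> iq; apply/rowP => k; rewrite !mxE !densc.
  have -> : partial k (dens sc i) q = c * partial k (dens s i) q.
    rewrite /partial (_ : dens sc i = c *: dens s i); last by apply/funext => p; rewrite densc.
    by apply: deriveZ; apply/diff_derivable/(smooth_diff (@dens_smooth R M A s st i) iq).
  by rewrite mulrBr; congr (_ - _); rewrite !mulrA.
have bnd (v : R) : v <= K -> Num.sqrt (c ^+ 2 * v) <= c * L.
  move=> vK; rewrite sqrtrM ?sqr_ge0 // sqrtr_sqr gtr0_norm // ler_pM2l //.
  by rewrite ler_wsqrtr.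
exists c => //; split.
- by split => // i q _; exact: scT.
- move=> i q iq a b d.
  have e (u v : 'I_2) : (fun q => sc i q u v) = - (fun q => sc i q v u).
    by apply/funext => p; have /matrixP /(_ v u) := scT i p; rewrite [LHS]mxE [RHS]mxE.
  have pN k u v : partial k (fun q => sc i q u v) q = - partial k (fun q => sc i q v u) q.
    rewrite /partial e deriveN //.
    by apply: diff_derivable; exact: (smooth_diff (sct.1 i v u) iq).
  have p0 k u : partial k (fun q => sc i q u u) q = 0.
    rewrite /partial (_ : (fun q => sc i q u u) = cst 0) ?derive_cst //.
    by apply/funext => p; have /matrixP /(_ u u) := scT i p; rewrite [LHS]mxE [RHS]mxE /cst; lra.
  have [->|->] := ord2P a; have [->|->] := ord2P b; have [->|->] := ord2P d;
    rewrite !p0 ?(pN _ ord_max ord0); lra.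
- have h1 : (ereal_sup [set y | exists i q, img i q /\ y = (norm2 g sc i q)%:E] <= (c * L)%:E)%E.
    apply: ge_ereal_sup => _ [i [q [iq ->]]]; rewrite lee_fin norm2E // densc.
    rewrite (_ : 2 * _ / _ = c ^+ 2 * nsq_form g s i q); last by rewrite /nsq_form; ring.
    by apply: bnd; have [] := hK i q iq.
  have h2 : (ereal_sup [set y | exists i q, img i q /\ y = (norm_nabla2 g sc i q)%:E] <= (c * L)%:E)%E.
    apply: ge_ereal_sup => _ [i [q [iq ->]]]; rewrite lee_fin norm_nabla2E // covdc // qformZ.
    rewrite (_ : 2 / _ * _ = c ^+ 2 * nsq_nabla g s i q); last by rewrite /nsq_nabla; ring.
    by apply: bnd; have [] := hK i q iq.
  apply: le_lt_trans (leeD h1 h2) _; rewrite -EFinD lte_fin.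
  have -> : c * L + c * L = eps / 2 by rewrite /c; field; rewrite gt_eqF.
  lra.
Qed.

End SmallForm.

(** * Constants uniform over chart balls *)

Section UniformConstants.
Variables (R : realType) (M : topologicalType) (A : smooth_atlas R 2 M).
Hypothesis cM : compact [set: M].
Implicit Types (i j : cidx A) (q p : 'rV[R]_2) (x y : M).

(** The chart obtained at a point is that of a neighbour, not its preferred one, which need not vary
    continuously. A ball of radius [r / 2] around a point within [r / 2] of the centre stays in the
    ball of radius [r]. *)
Lemma uniform_chart (P : cidx A -> 'rV[R]_2 -> R -> Prop) :
  (forall i q e e', 0 < e' -> e' <= e -> P i q e -> P i q e') ->
  (forall x, exists i, dom i x /\ exists2 e, 0 < e & \forall q \near crd i x, P i q e) ->
  exists2 e, 0 < e & forall x, exists i, dom i x /\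
    forall q, `|q - crd i x| < e -> img i q /\ P i q e.
Proof.
move=> mono loc.
apply: (@compact_uniform R M (fun x e => exists i, dom i x /\
    forall q, `|q - crd i x| < e -> img i q /\ P i q e) cM).
  move=> x e e' e'0 e'e [i [ix h]]; exists i; split => // q hq.
  have [iq Pq] := h q (lt_le_trans hq e'e); split => //; exact: mono Pq.
move=> x; have [i [ix [e e0 he]]] := loc x.
have [r r0 hr] := nbhs_cball (filterI (near_img (img_crd ix)) he).
exists (Num.min e (r / 2)); first by rewrite lt_min e0 divr_gt0.
have cn : (crd i z - crd i x) @[z --> x] --> (crd i x - crd i x).
  by apply: cvgB; [exact: crd_cont|exact: cvg_cst].
have n1 : \forall z \near x, `|crd i z - crd i x| < r / 2.
  by apply: (cvgr_lt _ (cvg_norm cn)); rewrite subrr normr0 divr_gt0.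
apply: filterS2 n1 (near_dom ix) => z hz iz; exists i; split => // q hq.
have [iq Pq] : img i q /\ P i q e.
  have qr : `|q - crd i z| < r / 2 by apply: lt_le_trans hq _; rewrite ge_min lexx orbT.
  apply: hr; rewrite /cball /= -(subrK (crd i z) q) -addrA.
  apply: le_trans (ler_normD _ _) _; lra.
split => //; apply: mono Pq; last by rewrite ge_min lexx.
by rewrite lt_min e0 divr_gt0.
Qed.

Lemma near_bound_fin (I : finType) (f : I -> 'rV[R]_2 -> R) q :
  (forall k, {for q, continuous (f k)}) ->
  exists2 B, 0 < B & \forall q' \near q, forall k, `|f k q'| <= B.
Proof.
move=> cf; pose B := \sum_k (`|f k q| + 1) + 1.
have s0 : 0 <= \sum_k (`|f k q| + 1) by apply: sumr_ge0 => k _; rewrite addr_ge0.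
exists B; first by rewrite ltr_wpDl.
apply: (@filter_forall _ I (fun k q' => `|f k q'| <= B) (nbhs q) _) => k.
have : \forall q' \near q, `|f k q'| < B.
  apply: (cvgr_lt _ (cvg_norm (cf k))); rewrite /B (bigD1 k) //=.
  have : 0 <= \sum_(i | i != k) (`|f i q| + 1) by apply: sumr_ge0 => i _; rewrite addr_ge0.
  lra.
by apply: filterS => q' /ltW.
Qed.

(** Determinant over trace: a lower bound for the least eigenvalue of a positive matrix that depends
    smoothly on the entries. *)
Definition lam (S : 'M[R]_2) : R := \det S / (S ord0 ord0 + S ord_max ord_max).

Lemma qform2 (S : 'M[R]_2) p : S^T = S -> qform S p =
  S ord0 ord0 * p ord0 ord0 ^+ 2 + 2 * S ord0 ord_max * p ord0 ord0 * p ord0 ord_max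
  + S ord_max ord_max * p ord0 ord_max ^+ 2.
Proof.
move=> /matrixP /(_ ord0 ord_max); rewrite mxE => e.
rewrite qformE !sum2 e; ring.
Qed.

Lemma pos_def2 (S : 'M[R]_2) : S^T = S -> (forall p, p != 0 -> 0 < qform S p) ->
  [/\ 0 < S ord0 ord0, 0 < S ord_max ord_max & 0 < \det S].
Proof.
move=> sS pS.
have d0 : 0 < S ord0 ord0.
  have n0 : (delta_mx ord0 ord0 : 'rV[R]_2) != 0.
    by apply/eqP => /rowP /(_ ord0); rewrite !mxE /= => /eqP; rewrite oner_eq0.
  have := pS _ n0; rewrite qform2 // !mxE /=; lra.
have d1 : 0 < S ord_max ord_max.
  have n0 : (delta_mx ord0 ord_max : 'rV[R]_2) != 0.
    by apply/eqP => /rowP /(_ ord_max); rewrite !mxE /= => /eqP; rewrite oner_eq0.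
  have := pS _ n0; rewrite qform2 // !mxE /=; lra.
split => //; have e := sS; move/matrixP : e => /(_ ord0 ord_max); rewrite mxE => e.
(* On this vector the form takes the value [S_00 * det S]. *)
pose v : 'rV[R]_2 := \row_k (if k == ord0 then - S ord0 ord_max else S ord0 ord0).
have v0 : v != 0.
  by apply/eqP => /rowP /(_ ord_max); rewrite !mxE /= => h; rewrite h ltxx in d0.
have := pS v v0; rewrite qform2 // !mxE /= det2 e.
have -> : S ord0 ord0 * (- S ord0 ord_max) ^+ 2 +
   2 * S ord0 ord_max * - S ord0 ord_max * S ord0 ord0 +
   S ord_max ord_max * S ord0 ord0 ^+ 2 =
   S ord0 ord0 * (S ord0 ord0 * S ord_max ord_max - S ord0 ord_max * S ord0 ord_max) by ring.
by rewrite pmulr_rgt0.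
Qed.

(** By Cayley-Hamilton, the trace times [qform S p] minus the determinant times [nsq p] is the
    squared norm of [p *m S]. *)
Lemma lam_le (S : 'M[R]_2) p : S^T = S -> (forall p, p != 0 -> 0 < qform S p) ->
  lam S * nsq p <= qform S p.
Proof.
move=> sS pS; have [a0 c0 _] := pos_def2 sS pS; rewrite qform2 //.
have := sS; move=> /matrixP /(_ ord0 ord_max); rewrite mxE => e.
rewrite /lam /nsq det2 e.
move: a0 c0; move: (S ord0 ord0) (S ord0 ord_max) (S ord_max ord_max) (p ord0 ord0) (p ord0 ord_max).
move=> a b c u v a0 c0; have s0 : 0 < a + c by exact: addr_gt0.
rewrite mulrAC ler_pdivrMr // -subr_ge0.
have -> : (a * u ^+ 2 + 2 * b * u * v + c * v ^+ 2) * (a + c) -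
  (a * c - b * b) * (u ^+ 2 + v ^+ 2) = (a * u + b * v) ^+ 2 + (b * u + c * v) ^+ 2 by ring.
by rewrite addr_ge0 ?sqr_ge0.
Qed.

Lemma qform_le (S : 'M[R]_2) (B : R) p : (forall a b, `|S a b| <= B) ->
  qform S p <= 4 * B * nsq p.
Proof.
move=> hB; rewrite qformE !sum2.
have e (a b : 'I_2) : p ord0 a * S a b * p ord0 b <= B * nsq p.
  have ha (k : 'I_2) : `|p ord0 k| ^+ 2 <= nsq p.
    rewrite real_normK ?num_real // /nsq.
    by have [->|->] := ord2P k; rewrite ?lerDl ?lerDr ?sqr_ge0.
  have ab : `|p ord0 a| * `|p ord0 b| <= nsq p.
    have := ha a; have := ha b; have := sqr_ge0 (`|p ord0 a| - `|p ord0 b|); rewrite !expr2; nra.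
  apply: le_trans (ler_norm _) _; rewrite !normrM mulrAC mulrC.
  by apply: ler_pM => //; rewrite mulr_ge0.
have := e ord0 ord0; have := e ord0 ord_max; have := e ord_max ord0; have := e ord_max ord_max.
by rewrite !mulrDl; lra.
Qed.

Variables (st : setup A) (g : tensor2 A).
Hypothesis hg : riemannian_metric g.

(** One number serves all estimates: it bounds the fibre metric from below, and its inverse bounds
    everything else from above, so that the whole weakens as [e] decreases. *)
Definition bounds i q (e : R) : Prop :=
  [/\ forall p, e * nsq p <= qform (stS st i q) p,
      forall a b, `|stS st i q a b| <= e^-1,
      forall k a b, `|partial k (fun q => stS st i q a b) q| <= e^-1,
      `|stF st (pnt i q)| <= e^-1 /\ forall k, `|partial k (stF st \o pnt i) q| <= e^-1 &
      (forall a b, `|sts st i q a b| <= e^-1) /\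
      (forall p, qform (ginv g i q) p <= e^-1 * nsq p)].

Lemma bounds_exist : exists2 e, 0 < e & forall x, exists i, dom i x /\
    forall q, `|q - crd i x| < e -> img i q /\ bounds i q e.
Proof.
apply: uniform_chart.
  move=> i q e e' e'0 e'e [h1 h2 h3 [h4 h5] [h6 h7]].
  have le : e^-1 <= e'^-1 by rewrite lef_pV2 ?posrE // (lt_le_trans e'0).
  split.
  - by move=> p; apply: le_trans (h1 p); rewrite ler_wpM2r // nsq_ge0.
  - by move=> a b; exact: le_trans le.
  - by move=> k a b; exact: le_trans le.
  - by split => [|k]; exact: le_trans le.
  - split => [a b|p]; first exact: le_trans le.
    by apply: le_trans (h7 p) _; rewrite ler_wpM2r // nsq_ge0.
move=> x; pose i := chart_at A x; have ix : dom i x := @dom_at R 2 M A x.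
exists i; split => //; have iq := img_crd ix; set q0 := crd i x in iq *.
have oi := @img_open R 2 M A i.
have sS := @stS_smooth R M A st i; have sF := @stF_smooth R M A st i.
have [B1 B10 n1] := @near_bound_fin ('I_2 * 'I_2)%type
  (fun ab q => stS st i q ab.1 ab.2) q0 (fun ab => smooth_cont (sS ab.1 ab.2) iq).
have [B2 B20 n2] := @near_bound_fin ('I_2 * ('I_2 * 'I_2))%type
  (fun kab => partial kab.1 (fun q => stS st i q kab.2.1 kab.2.2)) q0
  (fun kab => smooth_cont (smooth_D _ (sS kab.2.1 kab.2.2)) iq).
have [B3 B30 n3] := @near_bound_fin unit (fun _ => stF st \o pnt i) q0 (fun _ => smooth_cont sF iq).
have [B4 B40 n4] := @near_bound_fin 'I_2 (fun k => partial k (stF st \o pnt i)) q0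
  (fun k => smooth_cont (smooth_D _ sF) iq).
have [B5 B50 n5] := @near_bound_fin ('I_2 * 'I_2)%type
  (fun ab q => sts st i q ab.1 ab.2) q0 (fun ab => smooth_cont ((sts_tensor st).1 i ab.1 ab.2) iq).
have [B6 B60 n6] := @near_bound_fin ('I_2 * 'I_2)%type
  (fun ab q => ginv g i q ab.1 ab.2) q0 (fun ab => smooth_cont (@ginv_smooth R M A g hg i ab.1 ab.2) iq).
have symS q := stS_sym st i q.
have slam : smooth_on (img i) (fun q => (lam (stS st i q))^-1).
  have sdet : smooth_on (img i) (fun q => \det (stS st i q)).
    apply: (eq_smooth oi) (smoothD oi (smoothM oi (sS ord0 ord0) (sS ord_max ord_max))
      (smoothN oi (smoothM oi (sS ord0 ord_max) (sS ord_max ord0)))) => q _.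
    by rewrite det2.
  have pos q : img i q -> [/\ 0 < stS st i q ord0 ord0, 0 < stS st i q ord_max ord_max & 0 < \det (stS st i q)].
    by move=> iq'; apply: pos_def2 => // p; exact: stS_pos.
  apply: smoothV => //.
    move=> q /pos[a0 c0 d0]; rewrite gt_eqF // divr_gt0 // addr_gt0 //.
  apply: smoothM => //; apply: smoothV => //; last exact: smoothD.
  by move=> q /pos[a0 c0 d0]; rewrite gt_eqF // addr_gt0.
have [B7 B70 n7] := @near_bound_fin unit (fun _ q => (lam (stS st i q))^-1) q0
  (fun _ => smooth_cont slam iq).
pose B := B1 + B2 + B3 + B4 + B5 + 4 * B6 + B7.
have [B0 [le1 le2 le3 le4] [le5 le6 le7]] : [/\ 0 < B, [/\ B1 <= B, B2 <= B, B3 <= B & B4 <= B] &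
    [/\ B5 <= B, 4 * B6 <= B & B7 <= B]].
  by rewrite /B; clear -B10 B20 B30 B40 B50 B60 B70; split; [|split|split]; lra.
exists B^-1; first by rewrite invr_gt0.
near=> q.
have h1 : forall ab : 'I_2 * 'I_2, `|stS st i q ab.1 ab.2| <= B1 by near: q; exact: n1.
have h2 : forall kab : 'I_2 * ('I_2 * 'I_2),
  `|partial kab.1 (fun q => stS st i q kab.2.1 kab.2.2) q| <= B2 by near: q; exact: n2.
have h3 : forall u : unit, `|(stF st \o pnt i) q| <= B3 by near: q; exact: n3.
have h4 : forall k : 'I_2, `|partial k (stF st \o pnt i) q| <= B4 by near: q; exact: n4.
have h5 : forall ab : 'I_2 * 'I_2, `|sts st i q ab.1 ab.2| <= B5 by near: q; exact: n5.
have h6 : forall ab : 'I_2 * 'I_2, `|ginv g i q ab.1 ab.2| <= B6 by near: q; exact: n6.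
have h7 : forall u : unit, `|(lam (stS st i q))^-1| <= B7 by near: q; exact: n7.
have iq' : img i q by near: q; exact: near_img.
rewrite /bounds invrK; split.
- move=> p; have pS p' : p' != 0 -> 0 < qform (stS st i q) p' by exact: stS_pos.
  apply: le_trans (lam_le p (symS q) pS); rewrite ler_wpM2r ?nsq_ge0 //.
  have [a0 c0 d0] := pos_def2 (symS q) pS.
  have l0 : 0 < lam (stS st i q) by rewrite divr_gt0 // addr_gt0.
  have := h7 tt; rewrite gtr0_norm ?invr_gt0 // => h.
  rewrite -[leRHS]invrK lef_pV2 ?posrE ?invr_gt0 //; exact: le_trans h le7.
- by move=> a b; exact: le_trans (h1 (a, b)) le1.
- by move=> k a b; exact: le_trans (h2 (k, (a, b))) le2.
- split => [|k]; first exact: le_trans (h3 tt) le3.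
  exact: le_trans (h4 k) le4.
- split => [a b|p]; first exact: le_trans (h5 (a, b)) le5.
  have h6' a b : `|ginv g i q a b| <= B6 := h6 (a, b).
  by apply: le_trans (qform_le p h6') _; rewrite ler_wpM2r ?nsq_ge0.
Unshelve. all: by end_near. Qed.

End UniformConstants.

(** * The Hamiltonian and its orbits *)

Section Bundle.
Variables (R : realType) (M : topologicalType) (A : smooth_atlas R 2 M).
Variable st : setup A.
Implicit Types (i j : cidx A) (q p : 'rV[R]_2) (x y : M) (w : cotangent A).

Definition Qf w : R := qform (stS st (chart_at A (base w)) (crd (chart_at A (base w)) (base w))) (fibre w).

Lemma bcrdE i w : bcrd i w =
  (crd i (base w), fibre w *m (tj i (chart_at A (base w)) (base w))^T).
Proof. by rewrite /bcrd tjE. Qed.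

Lemma bpntE i z : bpnt i z =
  Cotangent A (pnt i z.1) (z.2 *m (tj (chart_at A (pnt i z.1)) i (pnt i z.1))^T).
Proof. by rewrite /bpnt tjE. Qed.

Lemma Qf_bpnt i (z : 'rV[R]_2 * 'rV[R]_2) : img i z.1 ->
  Qf (bpnt i z) = qform (stS st i z.1) z.2.
Proof.
move=> iz; rewrite bpntE /Qf /=; set x := pnt i z.1; set c := chart_at A x.
have ix : dom i x by exact: dom_pnt.
have cx : dom c x := @dom_at R 2 M A x.
rewrite (stS_law st cx ix) qform_transform; last exact: jacK.
by rewrite /x pntK.
Qed.

Lemma bcrd_bpnt i (z : 'rV[R]_2 * 'rV[R]_2) : img i z.1 -> bcrd i (bpnt i z) = z.
Proof.
move=> iz; rewrite bpntE bcrdE /=; have ix := dom_pnt iz.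
have cx := @dom_at R 2 M A (pnt i z.1).
by rewrite pntK // -mulmxA -trmx_mul (jacK ix cx) trmx1 mulmx1; case: z {iz ix cx}.
Qed.

Lemma bpnt_bcrd i w : dom i (base w) -> bpnt i (bcrd i w) = w.
Proof.
move=> iw; rewrite bcrdE bpntE /= (crdK iw).
have cw := @dom_at R 2 M A (base w).
by rewrite -mulmxA -trmx_mul (jacK cw iw) trmx1 mulmx1; case: w {iw cw}.
Qed.

Lemma base_bpnt i z : base (bpnt i z) = pnt i z.1. Proof. by rewrite bpntE. Qed.
Lemma bcrd1 i w : (bcrd i w).1 = crd i (base w). Proof. by []. Qed.

Lemma Qf_bcrd i w : dom i (base w) -> Qf w = qform (stS st i (crd i (base w))) (bcrd i w).2.
Proof. by move=> iw; rewrite -{1}(bpnt_bcrd iw) Qf_bpnt //; exact: img_crd. Qed.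

Lemma Qf_ge0 w : 0 <= Qf w.
Proof.
have cw := @dom_at R 2 M A (base w); rewrite /Qf.
have [->|p0] := eqVneq (fibre w) 0; first by rewrite /qform !mul0mx mxE.
by apply/ltW/stS_pos => //; exact: img_crd.
Qed.

Lemma base_cont : continuous (@base R 2 M A).
Proof.
move=> w W; rewrite nbhsE /= => -[N [oN Nw] NW].
suff : open [set v : cotangent A | N (base v)].
  move=> oB; have : nbhs w [set v : cotangent A | N (base v)].
    by apply: open_nbhs_nbhs.
  by apply: filterS => v; exact: NW.
move=> v Nv i iv; have iq := img_crd iv.
have cp : (pnt i z.1) @[z --> bcrd i v] --> pnt i (bcrd i v).1.
  apply: (@continuous_comp _ _ _ fst (pnt i) (bcrd i v)); first exact: cvg_fst.
  exact: pnt_cont.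
have := cp N; rewrite bcrd1 crdK // => H.
have := H (open_nbhs_nbhs (conj oN Nv)); rewrite /nbhs /=.
by apply: filterS => z.
Qed.

Lemma smooth_fst (U : set ('rV[R]_2 * 'rV[R]_2)) : smooth_on U fst.
Proof.
have := @smooth_comp_linear R _ _ _ (fst : {linear ('rV[R]_2 * 'rV[R]_2)%type -> 'rV[R]_2}) setT
  (fun q => q) _ (@openT _) (@smooth_id R _ setT).
move=> H; apply: (smooth_onW (@subsetT _ _)); apply: H => z; exact: cvg_fst.
Qed.

Lemma smooth_snd (U : set ('rV[R]_2 * 'rV[R]_2)) : smooth_on U snd.
Proof.
have := @smooth_comp_linear R _ _ _ (snd : {linear ('rV[R]_2 * 'rV[R]_2)%type -> 'rV[R]_2}) setT
  (fun q => q) _ (@openT _) (@smooth_id R _ setT).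
move=> H; apply: (smooth_onW (@subsetT _ _)); apply: H => z; exact: cvg_snd.
Qed.

Definition bimg i : set ('rV[R]_2 * 'rV[R]_2) := [set z | img i z.1].

Lemma bimg_open i : open (bimg i).
Proof.
rewrite (_ : bimg i = fst @^-1` img i) //; apply: open_comp; last exact: img_open.
by move=> z _; exact: cvg_fst.
Qed.

Lemma smooth_base i (f : 'rV[R]_2 -> R) : smooth_on (img i) f ->
  smooth_on (bimg i) (fun z => f z.1).
Proof.
move=> sf; exact: (@smooth_comp_rV R _ 2 _ _ _ f (@bimg_open i) (@img_open R 2 M A i)
  (fun z iz => iz) (@smooth_fst _) sf).
Qed.

Definition Qi i (z : 'rV[R]_2 * 'rV[R]_2) : R := qform (stS st i z.1) z.2.

Lemma smooth_Qi i : smooth_on (bimg i) (Qi i).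
Proof.
have ob := @bimg_open i; rewrite /Qi; under eq_fun do rewrite qformE.
have sp a : smooth_on (bimg i) (fun z => z.2 ord0 a).
  by apply: smooth_entry => //; exact: smooth_snd.
apply: smooth_sum => // b; apply: smoothM => //; apply: smooth_sum => // a.
by apply: smoothM => //; apply: (@smooth_base i (fun q => stS st i q a b)); exact: stS_smooth.
Qed.

Lemma Qf_cont : continuous Qf.
Proof.
move=> w W; have cw := @dom_at R 2 M A (base w); set i := chart_at A (base w) in cw.
rewrite nbhsE /= => -[N [oN Nw] NW].
suff : open [set v : cotangent A | dom i (base v) /\ N (Qf v)].
  move=> oB; have : nbhs w [set v : cotangent A | dom i (base v) /\ N (Qf v)].
    by apply: open_nbhs_nbhs.
  by apply: filterS => v [_]; exact: NW.
move=> v [iv Nv] j jv; have jq := img_crd jv.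
have cQ : {for bcrd j v, continuous (Qi j)} := @smooth_cont _ _ _ _ _ (bcrd j v) (@smooth_Qi j) jq.
have : \forall z \near bcrd j v, N (Qi j z).
  by apply: cQ; rewrite /Qi bcrd1 -(Qf_bcrd jv); exact: open_nbhs_nbhs.
have nj : \forall z \near bcrd j v, (img j `&` pnt j @^-1` dom i) z.1.
  have oo := @ovl_open R 2 M A j i.
  have cf : {for bcrd j v, continuous (fst : 'rV[R]_2 * 'rV[R]_2 -> 'rV[R]_2)} by exact: cvg_fst.
  by apply: cf; apply: open_nbhs_nbhs; split => //; exact: ovl_crd.
apply: filterS2 nj => z [jz iz] Nz; split; first exact: iz.
by rewrite /= Qf_bpnt.
Qed.

End Bundle.

Section Hamiltonian.
Variables (R : realType) (M : topologicalType) (A : smooth_atlas R 2 M).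
Hypothesis cM : compact [set: M].
Variables (st : setup A) (g : tensor2 A) (e : R).
Hypotheses (hg : riemannian_metric g) (e0 : 0 < e).
Hypothesis he : forall x, exists i, dom i x /\
    forall q, `|q - crd i x| < e -> img i q /\ bounds st g i q e.
Variables (k eta : R) (ck : clock k eta) (dl rh : R).
Hypotheses (k0 : 0 < k) (dl0 : 0 < dl) (dlrh : dl <= rh).
Implicit Types (i j : cidx A) (q p : 'rV[R]_2) (x : M) (w : cotangent A) (t : R).

Let rh0 : 0 < rh. Proof. exact: lt_le_trans dlrh. Qed.

Definition Ham t w : R := k * clkA ck t * cutoff (dl^-1 * Qf st w + 0) +
  clkb ck t * (stF st (base w) * cutoff (rh^-1 * Qf st w + 0)).

Lemma Ham_per t w : Ham (t + 1) w = Ham t w.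
Proof. by rewrite /Ham clkA_per clkb_per. Qed.

Lemma Ham_far t w : 4 * rh <= Qf st w -> Ham t w = 0.
Proof.
move=> h; rewrite /Ham !cutoff0 ?mulr0 ?addr0 //.
  by rewrite mulrC ler_pdivlMr.
by rewrite mulrC ler_pdivlMr //; apply: le_trans h; rewrite ler_pM2l.
Qed.

(** On the zero section both cutoffs are 1. By [clkAb] the wall contributes [k], or else the push
    contributes [k * F >= k]; the other term is nonnegative. *)
Lemma Ham_zero_section t w : fibre w = 0 -> k <= Ham t w.
Proof.
move=> w0; have Q0 : Qf st w = 0 by rewrite /Qf w0 /qform !mul0mx mxE.
rewrite /Ham Q0 !mulr0 !addr0 !cutoff1 ?ler01 // !mulr1.
have F1 := stF_ge1 st (base w); have A0 := clkA_ge0 ck t; have b0 := clkb_ge0 ck t.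
have [->|->] := clkAb ck t.
  by rewrite mulr1 lerDl mulr_ge0 // (le_trans ler01).
have h1 : k * 1 <= k * stF st (base w) by rewrite ler_pM2l.
have h2 : 0 <= k * clkA ck t by rewrite mulr_ge0 // ltW.
by rewrite mulr1 in h1; apply: le_trans h1 _; rewrite lerDr.
Qed.

Lemma Ham_smooth i : smooth_on [set y : (R * phase R 2)%type | img i y.2.1]
  (fun y => Ham y.1 (bpnt i y.2) : R).
Proof.
set U := [set y : (R * phase R 2)%type | img i y.2.1].
have c1 : continuous (fst : (R * phase R 2)%type -> R) by move=> z; exact: cvg_fst.
have c2 : continuous (snd : (R * phase R 2)%type -> phase R 2) by move=> z; exact: cvg_snd.
have oU : open U.
  rewrite (_ : U = (snd : (R * phase R 2)%type -> phase R 2) @^-1` (@bimg R M A i)) //.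
  by apply: open_comp; [move=> z _; exact: c2|exact: bimg_open].
have stime (f : R -> R) : smooth_on setT f -> smooth_on U (fun y => f y.1).
  move=> sf; apply: (smooth_onW (@subsetT _ _)).
  exact: (@smooth_comp_linear R _ _ _ (fst : {linear (R * phase R 2)%type -> R}) setT f c1 (@openT _) sf).
have sspace (f : phase R 2 -> R) : smooth_on (@bimg R M A i) f -> smooth_on U (fun y => f y.2).
  move=> sf.
  exact: (@smooth_comp_linear R _ _ _ (snd : {linear (R * phase R 2)%type -> phase R 2})
    (@bimg R M A i) f c2 (@bimg_open R M A i) sf).
have scut (d : R) : smooth_on U (fun y => cutoff (d * Qi st i y.2 + 0)).
  have sd : smooth_on U (fun y => d * Qi st i y.2 + 0).
    apply: smoothD => //; last exact: smooth_cst.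
    by apply: smooth_scale => //; apply: sspace; exact: smooth_Qi.
  exact: (@smooth_compR R _ U setT _ (@cutoff R) oU (@openT R) (fun _ _ => I) sd (@smooth_cutoff R)).
have sF : smooth_on U (fun y => (stF st \o pnt i) y.2.1).
  by apply: (sspace (fun z => (stF st \o pnt i) z.1)); apply: smooth_base; exact: stF_smooth.
have sA := stime _ (clkA_smooth ck); have sb := stime _ (clkb_smooth ck).
apply: (eq_smooth oU) (smoothD oU (smoothM oU (smooth_scale k oU sA) (scut dl^-1))
  (smoothM oU sb (smoothM oU sF (scut rh^-1)))) => y iy.
by rewrite /Ham Qf_bpnt.
Qed.

Lemma bpnt_cont i (z : phase R 2) : img i z.1 -> {for z, continuous (@bpnt R 2 M A i)}.
Proof.
move=> iz W; rewrite nbhsE /= => -[N [oN Nz] NW].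
have iN : dom i (base (bpnt i z)) by rewrite base_bpnt; exact: dom_pnt.
have := oN (bpnt i z) Nz i iN; rewrite bcrd_bpnt // => h.
by apply: filterS h => y Ny; exact: NW.
Qed.

(** The two fibre metrics are compared through the Euclidean norm of a chart, at the cost of a
    factor [e^-1] each time. *)
Lemma conorm_le w : conorm g w <= Num.sqrt (Qf st w / e ^+ 2).
Proof.
have [i [iw hb]] := he (base w).
have [|_ [h1 _ _ _ [_ h2]]] := hb (crd i (base w)); first by rewrite subrr normr0.
rewrite /conorm -/(qform _ _) ler_sqrt; last by rewrite divr_ge0 ?Qf_ge0 // sqr_ge0.
have cw := @dom_at R 2 M A (base w).
have -> : qform (ginv g (chart_at A (base w)) (crd (chart_at A (base w)) (base w))) (fibre w)
   = qform (ginv g i (crd i (base w))) (bcrd i w).2.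
  rewrite bcrdE /= (ginv_law hg iw cw) qform_transform //; exact: jacK.
apply: le_trans (h2 _) _; rewrite (Qf_bcrd st iw).
rewrite expr2 invfM mulrA [leRHS]mulrC ler_pM2l ?invr_gt0 //.
by rewrite ler_pdivlMr // mulrC.
Qed.

(** The sublevel is closed and covered by finitely many compact boxes of bundle charts. In such a
    chart [|p|^2 <= 4 * rh / e], and either [|p| <= 1] or [|p| <= |p|^2], whence the size [P] of the
    boxes. *)
Lemma compact_sublevel : compact [set w | Qf st w <= 4 * rh].
Proof.
pose P := 4 * rh / e + 1; have P1 : 1 <= P by rewrite lerDr divr_ge0 // ?mulr_ge0 // ltW.
pose ix x := projT1 (cid (he x)).
have ixP x : dom (ix x) x /\ forall q, `|q - crd (ix x) x| < e -> img (ix x) q /\ bounds st g (ix x) q e.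
  exact: projT2 (cid (he x)).
pose K x : set (cotangent A) :=
  @bpnt R 2 M A (ix x) @` (cball (crd (ix x) x) (e / 2) `*` cball 0 P).
have e2 : e / 2 < e by rewrite ltr_pdivrMr // ltr_pMr // ltr1n.
have cK x : compact (K x).
  apply: continuous_compact; last by apply: compact_setX; exact: compact_cball.
  apply/subspace_continuousP => z [z1 _]; apply: cvg_within_filter; apply: bpnt_cont.
  by have [_ h] := ixP x; have [|//] := h z.1; apply: le_lt_trans z1 e2.
have nb x : nbhs x (fun y => dom (ix x) y /\ `|crd (ix x) y - crd (ix x) x| < e / 2).
  have [xx _] := ixP x.
  have cn : (crd (ix x) z - crd (ix x) x) @[z --> x] --> (crd (ix x) x - crd (ix x) x).
    by apply: cvgB; [exact: crd_cont|exact: cvg_cst].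
  apply: filterI; first exact: near_dom.
  by apply: (cvgr_lt _ (cvg_norm cn)); rewrite subrr normr0 divr_gt0.
have [l hl] := compact_seq_cover cM nb.
have cU := @bigsetU_compact _ M K l xpredT (fun x _ => cK x).
apply: (subclosed_compact _ cU).
  rewrite (_ : [set w | _] = Qf st @^-1` [set y | y <= 4 * rh]) //.
  by apply: closed_comp; [move=> w _; exact: Qf_cont|exact: closed_le].
move=> w /= Qw; have [x xl [dx hx]] := hl (base w).
rewrite -bigcup_seq; exists x => //; exists (bcrd (ix x) w); last exact: bpnt_bcrd.
split; first exact: ltW.
have [_ hb] := ixP x; have [|_ [h1 _ _ _ _]] := hb (crd (ix x) (base w)).
  exact: lt_trans hx e2.
rewrite /cball /= subr0.
have h2 : `|(bcrd (ix x) w).2| ^+ 2 <= 4 * rh / e.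
  apply: le_trans (norm_nsq _) _; rewrite ler_pdivlMr // mulrC.
  by apply: le_trans (h1 _) _; rewrite -(Qf_bcrd st dx).
have [hP|/ltW hP] := leP (`|(bcrd (ix x) w).2|) 1; first exact: le_trans hP P1.
apply: (@le_trans _ _ (`|(bcrd (ix x) w).2| ^+ 2)); first by rewrite expr2 ler_peMl.
by apply: le_trans h2 _; rewrite lerDl.
Qed.

Lemma Ham_hamiltonian (r : R) : 0 < r -> 4 * rh / e ^+ 2 < r ^+ 2 ->
  hamiltonian (disk_bundle g r) Ham.
Proof.
move=> r0 hr; split; [exact: Ham_per|exact: Ham_smooth|].
exists [set w | Qf st w <= 4 * rh]; split; first exact: compact_sublevel.
  move=> w /= Qw; rewrite /disk_bundle /=; apply: le_lt_trans (conorm_le w) _.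
  have -> : r = Num.sqrt (r ^+ 2) by rewrite sqrtr_sqr gtr0_norm.
  rewrite ltr_sqrt ?exprn_gt0 //; apply: le_lt_trans hr.
  by rewrite ler_pM2r // invr_gt0 exprn_gt0.
by move=> t w /negP; rewrite -ltNge => /ltW; exact: Ham_far.
Qed.

End Hamiltonian.

(** * Equations of motion *)

Section PhaseDerivatives.
Variable R : realType.
Implicit Types (V W : normedModType R) (t : R).

Lemma is_derive_linear V W (L : {linear V -> W}) (f : R -> V) t X :
  continuous L -> is_derive t (1 : R) f X -> is_derive t (1 : R) (L \o f) (L X).
Proof.
move=> cL [df eX].
have dff : differentiable f t by apply/derivable1_diffP.
have dL : differentiable L (f t) by exact: linear_differentiable.
apply: DeriveDef; first by apply/derivable1_diffP; exact: differentiable_comp.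
by rewrite (derive_comp _ dff dL) eX diff_lin.
Qed.

Lemma is_derive_entry n (f : R -> 'rV[R]_n) t X k :
  is_derive t (1 : R) f X -> is_derive t (1 : R) (fun u => f u ord0 k) (X ord0 k).
Proof.
apply: (@is_derive_linear _ _ (@mx_coord R 1 n ord0 k)).
by move=> x; exact: coord_continuous.
Qed.

Lemma is_derive_fst (f : R -> phase R 2) t X :
  is_derive t (1 : R) f X -> is_derive t (1 : R) (fun u => (f u).1) X.1.
Proof.
apply: (@is_derive_linear _ _ (fst : {linear (phase R 2) -> 'rV[R]_2})).
by move=> x; exact: cvg_fst.
Qed.

Lemma is_derive_snd (f : R -> phase R 2) t X :
  is_derive t (1 : R) f X -> is_derive t (1 : R) (fun u => (f u).2) X.2.
Proof.
apply: (@is_derive_linear _ _ (snd : {linear (phase R 2) -> 'rV[R]_2})).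
by move=> x; exact: cvg_snd.
Qed.

Lemma is_derive_base (f : 'rV[R]_2 -> R) (z v : phase R 2) :
  differentiable f z.1 -> is_derive z v (fun y : phase R 2 => f y.1) ('D_(v.1) f z.1).
Proof.
move=> df; pose L : {linear (phase R 2) -> 'rV[R]_2} := fst.
have cL : continuous L by move=> x; exact: cvg_fst.
have dL : differentiable L z by exact: linear_differentiable.
apply: DeriveDef; first by apply: diff_derivable; exact: (differentiable_comp dL df).
rewrite (@derive_comp _ _ _ _ L f z v dL df) (deriveE _ dL) (deriveE _ df).
by rewrite diff_lin.
Qed.

Lemma is_derive_fibre (z v : phase R 2) k :
  is_derive z v (fun y : phase R 2 => y.2 ord0 k) (v.2 ord0 k).
Proof.
pose L : {linear (phase R 2) -> 'rV[R]_2} := snd.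
have cL : continuous L by move=> x; exact: cvg_snd.
pose C : {linear 'rV[R]_2 -> R} := @mx_coord R 1 2 ord0 k.
have cC : continuous C by move=> x; exact: coord_continuous.
have dL : differentiable L z by exact: linear_differentiable.
have dC : differentiable C (L z) by exact: linear_differentiable.
apply: DeriveDef; first by apply: diff_derivable; exact: (differentiable_comp dL dC).
rewrite (@derive_comp _ _ _ _ L C z v dL dC) (deriveE _ dL).
by rewrite diff_lin // diff_lin.
Qed.

Lemma is_derive_liouville (z u v : phase R 2) :
  is_derive z u (fun y => liouville y v) ((u.2 *m v.1^T) ord0 ord0).
Proof.
have e (y : phase R 2) : liouville y v = y.2 ord0 ord0 * v.1 ord0 ord0 + y.2 ord0 ord_max * v.1 ord0 ord_max.
  by rewrite /liouville mxE sum2 ![v.1^T _ _]mxE.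
have -> : (fun y => liouville y v) = (fun y : phase R 2 => y.2 ord0 ord0) * cst (v.1 ord0 ord0) +
   (fun y : phase R 2 => y.2 ord0 ord_max) * cst (v.1 ord0 ord_max).
  by apply/funext => y; rewrite e.
have d0 := is_derive_fibre z u ord0; have d1 := is_derive_fibre z u ord_max.
have c0 := is_derive_cst (v.1 ord0 ord0) z u; have c1 := is_derive_cst (v.1 ord0 ord_max) z u.
apply: (is_derive_eq (is_deriveD (is_deriveM d0 c0) (is_deriveM d1 c1))).
rewrite mxE sum2 ![v.1^T _ _]mxE /cst -![_ *: _]/(_ * _); ring.
Qed.

Lemma twisted_formE (M : topologicalType) (A : smooth_atlas R 2 M) (s : tensor2 A) i
    (z u v : phase R 2) :
  twisted_form s i z u v = (u.2 *m v.1^T) ord0 ord0 - (v.2 *m u.1^T) ord0 ord0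
    + (u.1 *m s i z.1 *m v.1^T) ord0 ord0.
Proof.
rewrite /twisted_form /ext_deriv.
by have [_ ->] := is_derive_liouville z u v; have [_ ->] := is_derive_liouville z v u.
Qed.

End PhaseDerivatives.

Section OrbitEquations.
Variables (R : realType) (M : topologicalType) (A : smooth_atlas R 2 M).
Variables (st : setup A) (k eta : R) (ck : clock k eta) (dl rh : R).
Implicit Types (i j : cidx A) (q p : 'rV[R]_2) (x : M) (w : cotangent A) (t : R).

Local Notation H := (Ham st ck dl rh).
Local Notation d_chi := ('D_(1 : R) (@cutoff R)).

(** The differential of the Hamiltonian is [hrad] times [dQ] plus [hpush] times [dF]; this splitting
    organises all the estimates. *)
Definition hrad t w : R := k * clkA ck t * (dl^-1 * d_chi (dl^-1 * Qf st w + 0)) +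
  clkb ck t * (stF st (base w) * (rh^-1 * d_chi (rh^-1 * Qf st w + 0))).

Definition hpush t w : R := clkb ck t * cutoff (rh^-1 * Qf st w + 0).

Definition dQ i (z : phase R 2) (a : 'I_2) : R :=
  \sum_b \sum_c z.2 ord0 b * z.2 ord0 c * partial a (fun q => stS st i q b c) z.1.

Lemma is_derive_Qi i (z v : phase R 2) : img i z.1 ->
  is_derive z v (Qi st i)
   ((\sum_b \sum_c z.2 ord0 b * z.2 ord0 c * 'D_(v.1) (fun q => stS st i q b c) z.1)
    + 2 * (z.2 *m stS st i z.1 *m v.2^T) ord0 ord0).
Proof.
move=> iz; pose P a := (fun y : phase R 2 => y.2 ord0 a).
pose S a b := (fun y : phase R 2 => stS st i y.1 a b).
have symS y : stS st i y ord_max ord0 = stS st i y ord0 ord_max.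
  by have /matrixP /(_ ord0 ord_max) := stS_sym st i y; rewrite mxE.
have -> : Qi st i = S ord0 ord0 * (P ord0 * P ord0) +
   (S ord0 ord_max * (P ord0 * P ord_max) + S ord0 ord_max * (P ord0 * P ord_max))
   + S ord_max ord_max * (P ord_max * P ord_max).
  by apply/funext => y; rewrite /Qi qform2 ?stS_sym // !fctE /S /P; ring.
have dP a : is_derive z v (P a) (v.2 ord0 a) by exact: is_derive_fibre.
have dS a b : is_derive z v (S a b) ('D_(v.1) (fun q => stS st i q a b) z.1).
  apply: (@is_derive_base _ (fun q => stS st i q a b)).
  exact: (smooth_diff (@stS_smooth R M A st i a b) iz).
have dPP a b := is_deriveM (dP a) (dP b).
have dSP a b c d := is_deriveM (dS a b) (dPP c d).
apply: (is_derive_eq (is_deriveD (is_deriveD (dSP ord0 ord0 ord0 ord0)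
  (is_deriveD (dSP ord0 ord_max ord0 ord_max) (dSP ord0 ord_max ord0 ord_max)))
  (dSP ord_max ord_max ord_max ord_max))).
rewrite mxE !sum2 !mxE !sum2 (symS z.1).
have -> : (fun q => stS st i q ord_max ord0) = (fun q => stS st i q ord0 ord_max).
  by apply/funext => y; exact: symS.
rewrite !fctE -![_ *: _]/(_ * _) /S /P; ring.
Qed.

Lemma is_derive_cutoff_comp (V : normedModType R) (f : V -> R) z v (d c : R) :
  is_derive z v f d -> differentiable f z ->
  is_derive z v (fun y => cutoff (c * f y + 0)) (c * d_chi (c * f z + 0) * d).
Proof.
move=> [_ ed] df; pose h := c *: f.
have dh : differentiable h z by exact: differentiableZ.
have dc : differentiable (@cutoff R) (h z).
  exact: (@smooth_diff R R R setT _ (h z) (@smooth_cutoff R) I).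
have -> : (fun y => cutoff (c * f y + 0)) = @cutoff R \o h.
  by apply/funext => y; rewrite /h /= fctE addr0.
apply: DeriveDef; first by apply: diff_derivable; exact: differentiable_comp.
rewrite (derive_comp _ dh dc) deriveZ; last exact: diff_derivable.
rewrite ed -[X in 'd _ _ X]mulr1 [LHS]linearZ /= -(deriveE _ dc) addr0.
by rewrite /h fctE -![_ *: _]/(_ * _); ring.
Qed.

Lemma is_derive_Ham i t (z v : phase R 2) : img i z.1 ->
  is_derive z v (fun y : phase R 2 => H t (bpnt i y))
   (hrad t (bpnt i z) * 'D_v (Qi st i) z + hpush t (bpnt i z) * 'D_(v.1) (stF st \o pnt i) z.1)
  /\ differentiable (fun y : phase R 2 => H t (bpnt i y)) z.
Proof.
move=> iz; have ob := @bimg_open R M A i.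
pose F : phase R 2 -> R := fun y => (stF st \o pnt i) y.1.
pose C d : phase R 2 -> R := fun y => cutoff (d * Qi st i y + 0).
have sQ := @smooth_Qi R M A st i.
have sF : smooth_on (bimg i) F by apply: smooth_base; exact: stF_smooth.
have sC d : smooth_on (bimg i) (C d).
  have sd : smooth_on (bimg i) (fun y => d * Qi st i y + 0).
    by apply: smoothD => //; [exact: smooth_scale|exact: smooth_cst].
  exact: (@smooth_compR R _ _ setT _ (@cutoff R) ob (@openT R) (fun _ _ => I) sd (@smooth_cutoff R)).
pose a1 := k * clkA ck t; pose b1 := clkb ck t.
have eH y : bimg i y -> a1 * C dl^-1 y + b1 * (F y * C rh^-1 y) = H t (bpnt i y).
  by move=> iy; rewrite /Ham Qf_bpnt.
have sH : smooth_on (bimg i) (fun y => H t (bpnt i y)).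
  apply: (eq_smooth ob) (smoothD ob (smooth_scale a1 ob (sC dl^-1))
    (smooth_scale b1 ob (smoothM ob sF (sC rh^-1)))) => y; exact: eH.
split; last exact: (smooth_diff sH).
pose f1 : phase R 2 -> R := (a1 *: C dl^-1) + (b1 *: (F * C rh^-1)).
pose g1 : phase R 2 -> R := fun y => H t (bpnt i y).
have nz : \forall y \near z, f1 y = g1 y.
  by apply: filterS (open_nbhs_nbhs (conj ob iz)) => y iy; rewrite /g1 -eH.
have dQv : is_derive z v (Qi st i) ('D_v (Qi st i) z).
  apply: DeriveDef => //; apply: diff_derivable; exact: (smooth_diff sQ).
have dfQ : differentiable (Qi st i) z := smooth_diff sQ iz.
have dCd d := is_derive_cutoff_comp d dQv dfQ.
have dFv : is_derive z v F ('D_(v.1) (stF st \o pnt i) z.1).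
  apply: is_derive_base; exact: (smooth_diff (@stF_smooth R M A st i) iz).
have d1 := is_deriveD (is_deriveZ a1 (dCd dl^-1)) (is_deriveZ b1 (is_deriveM dFv (dCd rh^-1))).
have := @near_eq_is_derive R (phase R 2) R f1 g1 z v _ nz d1.
move=> /is_derive_eq; apply.
rewrite /hrad /hpush Qf_bpnt // base_bpnt /a1 /b1 /F /C -/(Qi st i z) -![_ *: _]/(_ * _) /=.
move: (d_chi _) (d_chi _) (cutoff _) ('D_v _ _) ('D_(v.1) _ _) (stF _ _) (clkA _ _) (clkb _ _).
by clear=> *; ring.
Qed.

(** Testing the equation of [X_H] on vertical vectors isolates the velocity of the base point, and
    on horizontal ones that of the covector. The form [s] enters only through the latter. *)
Lemma orbit_eq (N : set (cotangent A)) (s : tensor2 A) (gam : R -> cotangent A) t i :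
  hamiltonian_orbit N (twisted_form s) H gam -> dom i (base (gam t)) ->
  let z := bcrd i (gam t) in
  exists X : phase R 2, [/\ is_derive t (1 : R) (fun u => bcrd i (gam u) : phase R 2) X,
    forall a, X.1 ord0 a = 2 * hrad t (gam t) * (z.2 *m stS st i z.1) ord0 a &
    forall a, X.2 ord0 a = - (hrad t (gam t) * dQ i z a
      + hpush t (gam t) * partial a (stF st \o pnt i) z.1) - (X.1 *m s i z.1) ord0 a].
Proof.
move=> [_ _ ho] iw z; have iz : img i z.1 by exact: img_crd.
have [X dX eX] := ho t i iw; exists X; split => // a.
  pose v : phase R 2 := (0, delta_mx ord0 a).
  have [dH dfH] := is_derive_Ham t v iz; have [_ eH] := dH.
  have := eX v; rewrite -(deriveE _ dfH) eH twisted_formE /= derive0 mulr0 addr0.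
  have [_ ->] := is_derive_Qi v iz; rewrite /= bpnt_bcrd //.
  under eq_bigr do under eq_bigr do rewrite derive0 mulr0.
  rewrite !sum2 !addr0 add0r trmx0 !mulmx0 [X in X - _ + _]mxE [X in _ + X = _]mxE sub0r addr0.
  move=> /oppr_inj; rewrite -rowE ![row _ _ _ _]mxE.
  have -> : X.1^T a ord0 = X.1 ord0 a by rewrite mxE.
  move=> ->; rewrite mulrA [2 * _]mulrC; congr (_ * _).
  by rewrite trmx_delta -colE mxE.
pose v : phase R 2 := (delta_mx ord0 a, 0).
have [dH dfH] := is_derive_Ham t v iz; have [_ eH] := dH.
have := eX v; rewrite -(deriveE _ dfH) eH twisted_formE /=.
have [_ ->] := is_derive_Qi v iz; rewrite /= bpnt_bcrd //.
rewrite trmx0 mulmx0 mul0mx [in X in 2 * X]mxE [in X in _ - X]mxE mulr0 addr0 subr0.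
rewrite trmx_delta -!colE ![col _ _ _ _]mxE.
rewrite -/(dQ i z a) -/(partial a (stF st \o pnt i) z.1) => e.
by rewrite -e addrK.
Qed.

End OrbitEquations.

Section OrbitTools.
Variables (R : realType) (M : topologicalType) (A : smooth_atlas R 2 M).
Variables (st : setup A) (g : tensor2 A) (e : R).
Hypothesis e0 : 0 < e.
Hypothesis he : forall x, exists i, dom i x /\
    forall q, `|q - crd i x| < e -> img i q /\ bounds st g i q e.
Variables (k eta : R) (ck : clock k eta) (dl rh c : R).
Hypothesis rh0 : 0 < rh.
Implicit Types (i j : cidx A) (q p : 'rV[R]_2) (x : M) (w : cotangent A) (t : R).

Definition scaled_form : tensor2 A := fun i q => c *: sts st i q.

Local Notation H := (Ham st ck dl rh).
Variables (N : set (cotangent A)) (gam : R -> cotangent A).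
Hypothesis orb : hamiltonian_orbit N (twisted_form scaled_form) H gam.

(** Product of [4 * e^-1], from the entries of the fibre metric, and [2 * e^-2], from the two
    partial derivatives of [F]. *)
Definition grad_bound : R := 8 / e ^+ 3.

Lemma grad_bound_ge0 : 0 <= grad_bound.
Proof. by rewrite divr_ge0 // exprn_ge0 // ltW. Qed.

Definition dF i q := dM (stF st) i q.

Lemma grad_le i x : dom i x -> qform (stS st i (crd i x)) (dF i (crd i x)) <= grad_bound.
Proof.
move=> ix; have [j [jx hb]] := he x.
have [|_ [_ h1 _ [_ h2] _]] := hb (crd j x); first by rewrite subrr normr0.
rewrite /dF (qform_law (stF_smooth st) ix jx (stS_law st ix jx)).
have le1 : nsq (dM (stF st) j (crd j x)) <= 2 * (e^-1) ^+ 2.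
  have hk b : dM (stF st) j (crd j x) ord0 b ^+ 2 <= (e^-1) ^+ 2.
    have hp := h2 b; rewrite [dM _ _ _ _ _]mxE.
    rewrite -(real_normK (num_real (partial b (stF st \o pnt j) (crd j x) : R))).
    by rewrite lerXn2r ?nnegrE ?invr_ge0 // ltW.
  by rewrite /nsq; have := hk ord0; have := hk ord_max; lra.
apply: le_trans (qform_le _ h1) _.
have -> : grad_bound = 4 * e^-1 * (2 * e^-1 ^+ 2).
  by rewrite /grad_bound; field; rewrite gt_eqF.
by apply: ler_wpM2l le1; rewrite mulr_ge0 // invr_ge0 ltW.
Qed.

Lemma qform_line (S : 'M[R]_2) p v (b : R) : S^T = S ->
  qform S (p + b *: v) =
  qform S p + b * (2 * (p *m S *m v^T) ord0 ord0) + b ^+ 2 * qform S v.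
Proof.
move=> sS; have := sS => /matrixP /(_ ord0 ord_max); rewrite mxE => sE.
by rewrite !qform2 // !mxE !sum2 !mxE !sum2 sE; ring.
Qed.

(** Nonnegativity of the form at [p + v] and [p - v]. *)
Lemma qform_cs (S : 'M[R]_2) p v : S^T = S -> (forall p, 0 <= qform S p) ->
  `|2 * (p *m S *m v^T) ord0 ord0| <= qform S p + qform S v.
Proof.
move=> sS pS.
have := pS (p + 1 *: v); have := pS (p + (-1) *: v).
rewrite !qform_line // ler_norml => h1 h2; apply/andP; split; lra.
Qed.

Lemma stS_ge0 i q p : img i q -> 0 <= qform (stS st i q) p.
Proof.
move=> iq; have [->|p0] := eqVneq p 0; first by rewrite /qform !mul0mx mxE.
exact/ltW/stS_pos.
Qed.

Lemma base_gam_cont : continuous (fun t => base (gam t)).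
Proof.
by case: orb => cg _ _ t; apply: continuous_comp; [exact: cg|exact: base_cont].
Qed.

Lemma Qf_gam_cont : continuous (fun t => Qf st (gam t)).
Proof.
by case: orb => cg _ _ t; apply: continuous_comp; [exact: cg|exact: Qf_cont].
Qed.

Lemma near_dom_gam i t : dom i (base (gam t)) -> \forall u \near t, dom i (base (gam u)).
Proof.
by move=> iw; apply: base_gam_cont; exact: near_dom.
Qed.

Lemma x_derive i t a : dom i (base (gam t)) ->
  is_derive t (1 : R) (fun u => crd i (base (gam u)) ord0 a)
    (2 * hrad st ck dl rh t (gam t) * ((bcrd i (gam t)).2 *m stS st i (crd i (base (gam t)))) ord0 a).
Proof.
move=> iw; have [X [dX e1 _]] := orbit_eq orb iw.
rewrite -e1.
exact: (is_derive_entry a (is_derive_fst dX)).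
Qed.

Definition velocity i t a : R :=
  2 * hrad st ck dl rh t (gam t) * ((bcrd i (gam t)).2 *m stS st i (crd i (base (gam t)))) ord0 a.

Lemma p_derive i t a : dom i (base (gam t)) ->
  is_derive t (1 : R) (fun u => (bcrd i (gam u)).2 ord0 a)
    (- (hrad st ck dl rh t (gam t) * dQ st i (bcrd i (gam t)) a
      + hpush st ck rh t (gam t) * dF i (crd i (base (gam t))) ord0 a)
     - \sum_b velocity i t b * scaled_form i (crd i (base (gam t))) b a).
Proof.
move=> iw; have [X [dX e1 e2]] := orbit_eq orb iw.
have := is_derive_entry a (is_derive_snd dX); rewrite e2.
rewrite /dF [dM _ _ _ _ _]mxE [(X.1 *m _) _ _]mxE /velocity.
by under eq_bigr do rewrite e1.
Qed.

(** The part of the field due to [dQ] preserves [Q], and the magnetic term does no work because the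
    form is antisymmetric. Only the push changes [Q]. *)
Lemma Qf_derive i t : dom i (base (gam t)) ->
  is_derive t (1 : R) (fun u => Qf st (gam u))
   (- (hpush st ck rh t (gam t) *
     (2 * ((bcrd i (gam t)).2 *m stS st i (crd i (base (gam t))) *m (dF i (crd i (base (gam t))))^T) ord0 ord0))).
Proof.
move=> iw; have iz := img_crd iw; have [X [dX e1 e2]] := orbit_eq orb iw.
set z := bcrd i (gam t) in e1 e2.
have near_eq : \forall u \near t, (Qi st i \o (fun u => bcrd i (gam u) : phase R 2)) u = Qf st (gam u).
  by apply: filterS (near_dom_gam iw) => u iu; rewrite (Qf_bcrd st iu).
apply: (@near_eq_is_derive R R R (Qi st i \o (fun u => bcrd i (gam u) : phase R 2)) _ t (1 : R) _ near_eq).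
have [dXd eX] := dX.
have db : differentiable (fun u => bcrd i (gam u) : phase R 2) t by apply/derivable1_diffP.
have dQi : differentiable (Qi st i) (bcrd i (gam t) : phase R 2) :=
  @smooth_diff _ _ _ _ _ (bcrd i (gam t)) (@smooth_Qi R M A st i) iz.
apply: DeriveDef; first by apply/derivable1_diffP; exact: (differentiable_comp db dQi).
rewrite (@derive_comp _ _ _ _ (fun u => bcrd i (gam u) : phase R 2) (Qi st i) t (1 : R) db dQi).
rewrite eX -(deriveE _ dQi).
have [_ ->] := @is_derive_Qi R M A st i (bcrd i (gam t)) X iz.
have dS b d : 'D_(X.1) (fun q => stS st i q b d) z.1 =
    X.1 ord0 ord0 * partial ord0 (fun q => stS st i q b d) z.1 +
    X.1 ord0 ord_max * partial ord_max (fun q => stS st i q b d) z.1.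
  have df : differentiable (fun q => stS st i q b d) z.1.
    exact: (smooth_diff (@stS_smooth R M A st i b d) iz).
  rewrite /partial !(deriveE _ df) [in LHS](row_sum_delta X.1) linear_sum sum2.
  by rewrite !linearZ.
rewrite -/z !sum2 !dS.
have S10 : stS st i z.1 ord_max ord0 = stS st i z.1 ord0 ord_max.
  by have /matrixP /(_ ord0 ord_max) := stS_sym st i z.1; rewrite mxE.
have [s00 s01 s10 s11] : [/\ scaled_form i z.1 ord0 ord0 = 0,
    scaled_form i z.1 ord0 ord_max = scaled_form i z.1 ord0 ord_max,
    scaled_form i z.1 ord_max ord0 = - scaled_form i z.1 ord0 ord_max &
    scaled_form i z.1 ord_max ord_max = 0].
  have h (a b : 'I_2) : scaled_form i z.1 a b = - scaled_form i z.1 b a.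
    have /matrixP /(_ b a) := sts_anti st i z.1; rewrite [LHS]mxE [RHS]mxE => h.
    by rewrite /scaled_form [LHS]mxE [X in _ = - X]mxE h mulrN.
  by have h0 := h ord0 ord0; have h1 := h ord_max ord_max; have h2 := h ord_max ord0; split => //; lra.
have XS : (z.2 *m stS st i z.1 *m X.2^T) ord0 ord0 =
   (z.2 *m stS st i z.1) ord0 ord0 * X.2 ord0 ord0 + (z.2 *m stS st i z.1) ord0 ord_max * X.2 ord0 ord_max.
  by rewrite mxE sum2 ![X.2^T _ _]mxE.
have FS : (z.2 *m stS st i z.1 *m (dF i z.1)^T) ord0 ord0 =
   (z.2 *m stS st i z.1) ord0 ord0 * partial ord0 (stF st \o pnt i) z.1 +
   (z.2 *m stS st i z.1) ord0 ord_max * partial ord_max (stF st \o pnt i) z.1.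
  by rewrite mxE sum2 ![(dF _ _)^T _ _]mxE /dF ![dM _ _ _ _ _]mxE.
rewrite -[crd i (base (gam t))]/(z.1) FS XS !e2 /dQ !sum2.
rewrite ![(X.1 *m _) _ _]mxE !sum2 s00 s10 s11 !e1.
move: (z.2 *m stS st i z.1) => PS.
move: (partial ord0 (fun q => stS st i q ord0 ord0) z.1) (partial ord0 (fun q => stS st i q ord0 ord_max) z.1)
  (partial ord0 (fun q => stS st i q ord_max ord0) z.1) (partial ord0 (fun q => stS st i q ord_max ord_max) z.1).
move: (partial ord_max (fun q => stS st i q ord0 ord0) z.1) (partial ord_max (fun q => stS st i q ord0 ord_max) z.1)
  (partial ord_max (fun q => stS st i q ord_max ord0) z.1) (partial ord_max (fun q => stS st i q ord_max ord_max) z.1).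
move: (partial ord0 (stF st \o pnt i) z.1) (partial ord_max (stF st \o pnt i) z.1) (scaled_form i z.1 ord0 ord_max).
move: (hrad _ _ _ _ _ _) (hpush _ _ _ _ _) (z.2 ord0 ord0) (z.2 ord0 ord_max) (PS ord0 ord0) (PS ord0 ord_max).
by clear=> *; ring.
Qed.

Lemma hpush_ge0 t w : 0 <= hpush st ck rh t w.
Proof. by rewrite mulr_ge0 ?clkb_ge0 ?cutoff_ge0. Qed.

Lemma hpush_le t w : hpush st ck rh t w <= clkb ck t.
Proof. by rewrite /hpush ler_piMr ?clkb_ge0 // cutoff_le1. Qed.

(* Far from the zero section nothing moves, so only the values [Q <= 4 * rh]
   contribute to the drift of [Q]. *)
Lemma Qf_derive_le t d : is_derive t (1 : R) (fun u => Qf st (gam u)) d ->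
  `|d| <= clkb ck t * (4 * rh + grad_bound).
Proof.
move=> [_ ed]; set w := gam t; pose i := chart_at A (base w).
have iw : dom i (base w) by exact: dom_at.
have [_ eQ] := Qf_derive iw; rewrite -ed eQ -/w normrN normrM (ger0_norm (hpush_ge0 _ _)).
have iz := img_crd iw.
have b0 := clkb_ge0 ck t.
have [Q4|Q4] := leP (Qf st w) (4 * rh); last first.
  have h4 : 4 <= rh^-1 * Qf st w + 0.
    by rewrite addr0 [rh^-1 * _]mulrC ler_pdivlMr // ltW.
  rewrite /hpush (cutoff0 h4) mulr0 mul0r mulr_ge0 // addr_ge0 ?grad_bound_ge0 //.
  by rewrite mulr_ge0 // ltW.
have cs := @qform_cs (stS st i (crd i (base w))) (bcrd i w).2 (dF i (crd i (base w)))
  (stS_sym st _ _) (fun p => stS_ge0 p iz).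
apply: ler_pM => //; first exact: hpush_ge0.
  exact: hpush_le.
apply: le_trans cs _; rewrite -(Qf_bcrd st iw).
exact: lerD Q4 (grad_le iw).
Qed.

Lemma Qf_drift a t : a <= t ->
  `|Qf st (gam t) - Qf st (gam a)| <= (4 * rh + grad_bound) * (clkB ck t - clkB ck a).
Proof.
move=> at_; rewrite mulrBr.
pose df u := - (hpush st ck rh u (gam u) *
     (2 * ((bcrd (chart_at A (base (gam u))) (gam u)).2 *m
        stS st (chart_at A (base (gam u))) (crd (chart_at A (base (gam u))) (base (gam u))) *m
        (dF (chart_at A (base (gam u))) (crd (chart_at A (base (gam u))) (base (gam u))))^T) ord0 ord0)).
have hd u : is_derive u (1 : R) (fun u => Qf st (gam u)) (df u).
  by apply: Qf_derive; exact: dom_at.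
have hB u : is_derive u (1 : R) (fun u => (4 * rh + grad_bound) * clkB ck u) ((4 * rh + grad_bound) * clkb ck u).
  exact: (@is_deriveZ R R R (clkB ck) (4 * rh + grad_bound) u 1 _ (clkB_derive ck u)).
apply: (derive_norm_le at_ (fun u _ => hd u) (fun u _ => hB u)) => u _.
by rewrite mulrC; exact: Qf_derive_le.
Qed.

End OrbitTools.

(** * Confinement of the orbits *)

Section ChartConfinement.
Variables (R : realType) (M : topologicalType) (A : smooth_atlas R 2 M).
Hypothesis hM : hausdorff_space M.
Implicit Types (i j : cidx A) (q p : 'rV[R]_2) (x : M) (t : R) (c : R -> M).

Definition in_ball i q (rho : R) x := dom i x /\ `|crd i x - q| < rho.

(** A bootstrap from the open ball to the closed ball of half the radius. The latter is taken as an
    image under [pnt i]: it is compact, hence closed in [M], whereas [crd i] is arbitrary outside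
    its domain. *)
Lemma chart_bootstrap c i (q0 : 'rV[R]_2) (rho a b : R) : continuous c -> 0 < rho ->
  (forall q : 'rV[R]_2, `|q - q0| < rho -> img i q) -> in_ball i q0 rho (c a) ->
  (forall t, a <= t <= b -> (forall s, a <= s <= t -> in_ball i q0 rho (c s)) ->
     `|crd i (c t) - q0| <= rho / 2) ->
  forall t, a <= t <= b -> in_ball i q0 rho (c t).
Proof.
move=> cc rho0 him ha hest.
have himc (q : 'rV[R]_2) : cball q0 (rho / 2) q -> `|q - q0| < rho.
  by rewrite /cball /= => h; apply: le_lt_trans h _; rewrite gtr_pMr // invf_lt1 // ltr1n.
apply: (@bootstrap R M c (in_ball i q0 rho) (pnt i @` cball q0 (rho / 2)) a b) => //.
- by move=> t _; exact: cc.
- have -> : in_ball i q0 rho = dom i `&` crd i @^-1` ball q0 rho.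
    apply/seteqP; split=> x [ix h]; split => //; move: h; rewrite /= -ball_normE /= distrC //.
  exact/open_dom_pre/ball_open.
- apply: compact_closed => //; apply: continuous_compact; last exact: compact_cball.
  apply: continuous_in_subspaceT => q /set_mem qc.
  by apply: pnt_cont; apply: him; exact: himc.
- move=> _ [q qc <-]; have iq := him q (himc q qc); split; first exact: dom_pnt.
  by rewrite pntK //; exact: himc.
- move=> t tab ht; exists (crd i (c t)); first exact: hest.
  by apply: crdK; case: (ht t) => //; case/andP: tab => at_ _; rewrite at_ lexx.
Qed.

Definition confined c := exists i q0 a (rho : R), [/\ 0 < rho,
  forall q : 'rV[R]_2, `|q - q0| < rho -> img i q &
  forall t, a <= t <= a + 1 -> in_ball i q0 rho (c t)].

End ChartConfinement.

Section FarOrbits.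
Variables (R : realType) (M : topologicalType) (A : smooth_atlas R 2 M).
Hypothesis hM : hausdorff_space M.
Variables (st : setup A) (g : tensor2 A) (e : R).
Hypothesis e0 : 0 < e.
Hypothesis he : forall x, exists i, dom i x /\
    forall q, `|q - crd i x| < e -> img i q /\ bounds st g i q e.
Variables (k eta : R) (ck : clock k eta) (dl rh c : R).
Hypotheses (dl0 : 0 < dl) (rh0 : 0 < rh) (dlrh : 8 * dl <= rh).
Implicit Types (i j : cidx A) (q p : 'rV[R]_2) (x : M) (w : cotangent A) (t : R).

Local Notation H := (Ham st ck dl rh).
Variables (N : set (cotangent A)) (gam : R -> cotangent A).
Hypothesis orb : hamiltonian_orbit N (twisted_form (scaled_form st c)) H gam.
Variable C : R.
Hypothesis hC : forall x : R, `|'D_(1 : R) (@cutoff R) x| <= C.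

Lemma clkB_le s t : s <= t -> clkB ck s <= clkB ck t.
Proof.
move=> st'; rewrite -subr_ge0 -[leLHS](subrr (cst (0 : R) t)).
apply: (@derive_le R (cst 0) (clkB ck) (cst 0) (clkb ck) s t st') => u _.
- exact: clkB_derive.
- exact: clkb_ge0.
Qed.

Lemma clkB_bound a t : a <= t <= a + 1 -> clkB ck t - clkB ck a <= eta.
Proof.
move=> /andP[_ ta]; apply: le_trans (clkB_period ck a).
by rewrite lerD2r; exact: clkB_le.
Qed.

(** Product of the bounds in [2 * F * chi' / rh * |p S|]: [F <= 1 / e], [|chi'| <= C], and
    [2 * (4 * rh / e + 1) / e] for the entries of [p S]. *)
Definition speed_bound : R := 4 * (4 * rh / e + 1) * C / (e ^+ 2 * rh).

Lemma entries_le i q p a : bounds st g i q e -> `|p| <= 4 * rh / e + 1 ->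
  `|(p *m stS st i q) ord0 a| <= 2 * (4 * rh / e + 1) * e^-1.
Proof.
move=> [_ hS _ _ _] hp; rewrite mxE sum2; apply: le_trans (ler_normD _ _) _; rewrite !normrM.
have h b : `|p ord0 b| * `|stS st i q b a| <= (4 * rh / e + 1) * e^-1.
  by apply: ler_pM => //; apply: le_trans hp; exact: entry_le_norm.
by have := h ord0; have := h ord_max; lra.
Qed.

Lemma fibre_bound i t : dom i (base (gam t)) -> bounds st g i (crd i (base (gam t))) e ->
  Qf st (gam t) <= 4 * rh -> `|(bcrd i (gam t)).2| <= 4 * rh / e + 1.
Proof.
move=> iw [hq _ _ _ _] Q4; set p := (bcrd i (gam t)).2.
have h1 : `|p| ^+ 2 <= 4 * rh / e.
  apply: le_trans (norm_nsq p) _; rewrite ler_pdivlMr // mulrC.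
  by apply: le_trans (hq p) _; rewrite -(Qf_bcrd st iw).
(* This gives [|p| <= |p|^2 + 1] and avoids a square root. *)
have h2 : 0 <= (`|p| - 1) ^+ 2 by rewrite sqr_ge0.
have h3 : 0 <= `|p| by [].
move: h1 h2 h3; move: (4 * rh / e) `|p| => P n.
rewrite sqrrB1 => h1 h2 h3; lra.
Qed.

Lemma velocity_le i t a : dom i (base (gam t)) -> bounds st g i (crd i (base (gam t))) e ->
  rh / 2 < Qf st (gam t) ->
  `|velocity st ck dl rh gam i t a| <= speed_bound * clkb ck t.
Proof.
move=> iw hb Qrh; have C0 : 0 <= C := le_trans (normr_ge0 _) (hC 0).
have b0 := clkb_ge0 ck t.
have rhe : 0 <= 4 * rh / e by rewrite divr_ge0 ?mulr_ge0 // ltW.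
have K0 : 0 <= speed_bound.
  by rewrite divr_ge0 ?mulr_ge0 ?addr_ge0 ?exprn_ge0 // ltW.
(* [Q > rh / 2 >= 4 * dl]: the wall does not act here. *)
have dl4 : 'D_(1 : R) (@cutoff R) (dl^-1 * Qf st (gam t) + 0) = 0.
  apply: derive_cutoff0; right; rewrite addr0 [dl^-1 * _]mulrC ltr_pdivlMr //.
  by apply: le_lt_trans Qrh; rewrite ler_pdivlMr // mulrAC -natrM.
rewrite /velocity /hrad dl4 !mulr0 add0r.
have [Q4|Q4] := leP (Qf st (gam t)) (4 * rh); last first.
  rewrite derive_cutoff0; first by rewrite !(mulr0, mul0r) normr0 mulr_ge0.
  by right; rewrite addr0 [rh^-1 * _]mulrC ltr_pdivlMr.
have hS := entries_le a hb (fibre_bound iw hb Q4).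
have F0 : 0 <= stF st (base (gam t)) by rewrite (le_trans ler01) ?stF_ge1.
have hF : stF st (base (gam t)) <= e^-1.
  by have [_ _ _ [h _] _] := hb; move: h; rewrite crdK // ger0_norm.
have hd := hC (rh^-1 * Qf st (gam t) + 0).
rewrite !normrM (ger0_norm b0) (ger0_norm F0) ger0_norm // gtr0_norm ?invr_gt0 //.
have h1 : stF st (base (gam t)) * (rh^-1 * `|'D_(1 : R) (@cutoff R) (rh^-1 * Qf st (gam t) + 0)|)
   <= e^-1 * (rh^-1 * C).
  apply: ler_pM => //; first by rewrite mulr_ge0 // invr_ge0 ltW.
  by apply: ler_wpM2l => //; rewrite invr_ge0 ltW.
have -> : speed_bound * clkb ck t = 2 * (clkb ck t * (e^-1 * (rh^-1 * C))) * (2 * (4 * rh / e + 1) * e^-1).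
  by rewrite /speed_bound; field; rewrite !gt_eqF.
apply: ler_pM => //.
  rewrite !mulr_ge0 // invr_ge0 ltW //.
by apply: ler_wpM2l => //; exact: ler_wpM2l.
Qed.

Lemma far_confined t0 : rh <= Qf st (gam t0) -> speed_bound * eta <= e / 2 ->
  eta * (4 * rh + grad_bound e) <= rh / 4 -> confined A (fun t => base (gam t)).
Proof.
move=> Q0 K1 K2; have [i [iw hb]] := he (base (gam t0)).
have C0 : 0 <= C := le_trans (normr_ge0 _) (hC 0).
have K0 : 0 <= speed_bound.
  by rewrite divr_ge0 ?mulr_ge0 ?addr_ge0 ?exprn_ge0 ?divr_ge0 ?mulr_ge0 // ltW.
pose c0 u := base (gam u); have cc : continuous c0 := base_gam_cont orb.
(* Over one period the push lowers [Q] by at most [rh / 4]. *)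
have Qbig t : t0 <= t <= t0 + 1 -> rh / 2 < Qf st (gam t).
  move=> tt; have /andP[t0t _] := tt.
  have := Qf_drift e0 he rh0 orb t0t; rewrite ler_norml => /andP[h _].
  have h2 : (4 * rh + grad_bound e) * (clkB ck t - clkB ck t0) <= rh / 4.
    apply: le_trans K2; rewrite mulrC; apply: ler_wpM2r; last exact: clkB_bound.
    by rewrite addr_ge0 ?grad_bound_ge0 // mulr_ge0 // ltW.
  have arith (X u v r' : R) : 0 < r' -> - X <= u - v -> X <= r' / 4 -> r' <= v -> r' / 2 < u.
    by move=> *; lra.
  exact: arith rh0 h h2 Q0.
exists i, (crd i (c0 t0)), t0, e; split => //; first by move=> q /hb[].
apply: chart_bootstrap => //; first by move=> q /hb[].
  by split => //; rewrite subrr normr0.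
move=> t tt ht; have /andP[t0t tt1] := tt.
have inb s : t0 <= s <= t -> dom i (c0 s) /\ bounds st g i (crd i (c0 s)) e.
  by move=> /ht[is_ /hb[]].
apply: norm_le_entries; first by rewrite divr_ge0 // ltW.
move=> a; rewrite !mxE; apply: le_trans K1.
have h : `|crd i (c0 t) ord0 a - crd i (c0 t0) ord0 a| <= speed_bound * clkB ck t - speed_bound * clkB ck t0.
  apply: (@derive_norm_le R (fun u => crd i (c0 u) ord0 a) (fun u => speed_bound * clkB ck u)
    (fun u => velocity st ck dl rh gam i u a) (fun u => speed_bound * clkb ck u) t0 t t0t).
  - by move=> s /inb[is_ _]; exact: (x_derive orb).
  - move=> s _.
    exact: (@is_deriveZ R R R (clkB ck) speed_bound s 1 _ (clkB_derive ck s)).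
  - move=> s ss; have [is_ bs] := inb s ss; apply: velocity_le => //; apply: Qbig.
    by case/andP: ss => -> st' /=; exact: le_trans tt1.
apply: le_trans h _; rewrite -mulrBr; apply: ler_wpM2l => //; exact: clkB_bound.
Qed.

End FarOrbits.

Lemma shift_line (R : pzRingType) (V : lmodType R) (u v w xi : V) (x y z : R) :
  u + x *: xi = v + y *: xi -> v = w - (y - z) *: xi -> u = w - (x - z) *: xi.
Proof.
move=> /(canRL (addrK _)) -> ->; rewrite -!addrA; congr (w + _).
by rewrite !scalerBl !opprB addrA subrK.
Qed.

Section FreeMotion.
Variables (R : realType) (M : topologicalType) (A : smooth_atlas R 2 M).
Hypothesis hM : hausdorff_space M.
Variables (st : setup A).
Variables (k eta : R) (ck : clock k eta) (dl rh c : R).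
Hypotheses (dl0 : 0 < dl) (rh0 : 0 < rh).
Implicit Types (i j : cidx A) (q p : 'rV[R]_2) (x : M) (w : cotangent A) (t : R).

Local Notation H := (Ham st ck dl rh).
Variables (N : set (cotangent A)) (gam : R -> cotangent A).
Hypothesis orb : hamiltonian_orbit N (twisted_form (scaled_form st c)) H gam.
Hypothesis Qrh : forall t, Qf st (gam t) < rh.

Lemma hpushE t : hpush st ck rh t (gam t) = clkb ck t.
Proof.
by rewrite /hpush cutoff1 ?mulr1 // addr0 mulrC ler_pdivrMr // mul1r ltW.
Qed.

(** Where [Q < rh] the cutoff of the push is flat, so only the wall contributes to [hrad]. *)
Lemma hrad0 t : clkA ck t = 0 \/ 4 * dl < Qf st (gam t) -> hrad st ck dl rh t (gam t) = 0.
Proof.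
move=> h; rewrite /hrad [X in _ + _ * (_ * (_ * X))]derive_cutoff0; last first.
  by left; rewrite addr0 mulrC ltr_pdivrMr // mul1r.
rewrite !mulr0 addr0; case: h => [->|h]; first by rewrite mulr0 mul0r.
by rewrite derive_cutoff0 ?mulr0 //; right; rewrite addr0 [dl^-1 * _]mulrC ltr_pdivlMr.
Qed.

(** With [hrad = 0] the base point is at rest and the covector moves with velocity [- clkb] times
    the fixed covector [xi]; as [clkB] is a primitive of [clkb], the sum [p + clkB *: xi] is
    conserved. *)
Lemma frozen_segment i (a b : R) : a <= b ->
  (forall t, a <= t <= b -> dom i (base (gam t)) /\ hrad st ck dl rh t (gam t) = 0) ->
  let xi := dF st i (crd i (base (gam a))) in
  crd i (base (gam b)) = crd i (base (gam a)) /\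
  (bcrd i (gam b)).2 + clkB ck b *: xi = (bcrd i (gam a)).2 + clkB ck a *: xi.
Proof.
move=> ab hh xi.
have crd_a u : a <= u <= b -> crd i (base (gam u)) = crd i (base (gam a)).
  move=> /andP[au ub]; apply/rowP => d.
  apply: (@derive0_eq R (fun u => crd i (base (gam u)) ord0 d) a u au) => s /andP[as_ su].
  have [|is_ h0] := hh s; first by rewrite as_ (le_trans su).
  by apply: (is_derive_eq (x_derive orb d is_)); rewrite h0 mulr0 mul0r.
split; first by apply: crd_a; rewrite ab lexx.
apply/rowP => d.
have ent (u v : 'rV[R]_2) (s : R) : (u + s *: v) ord0 d = u ord0 d + s * v ord0 d.
  by rewrite mxE [in X in _ + X]mxE.
rewrite !ent.
apply: (@derive0_eq R (fun u => (bcrd i (gam u)).2 ord0 d + clkB ck u * xi ord0 d) a b ab) => s sab.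
have [is_ h0] := hh s sab.
have dB := @is_deriveZ R R R (clkB ck) (xi ord0 d) s 1 _ (clkB_derive ck s).
have -> : (fun u => (bcrd i (gam u)).2 ord0 d + clkB ck u * xi ord0 d) =
  (fun u => (bcrd i (gam u)).2 ord0 d) + xi ord0 d *: clkB ck.
  by apply/funext => u; rewrite !fctE -![_ *: _]/(_ * _) [clkB _ _ * _]mulrC.
apply: (is_derive_eq (is_deriveD (p_derive orb d is_) dB)).
have v0 b' : velocity st ck dl rh gam i s b' = 0 by rewrite /velocity h0 mulr0 mul0r.
rewrite big1; last by move=> b' _; rewrite v0 mul0r.
rewrite h0 mul0r add0r subr0 hpushE (crd_a s sab) -![_ *: _]/(_ * _) -/xi.
by rewrite mulrC addNr.
Qed.

Variables (i : cidx A) (t0 kap L : R).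
Hypothesis kap1 : kap = 1 \/ kap = -1.
Hypothesis (i0 : dom i (base (gam t0))).

Let q0 := crd i (base (gam t0)).
Let xi := dF st i q0.
Let line s := (bcrd i (gam t0)).2 - (clkB ck (t0 + kap * s) - clkB ck t0) *: xi.

(** The wall is either off, or out of reach of the predicted covector. In the second case the gap
    between [5 * dl] and [4 * dl] keeps the true orbit off the wall a little longer, which is the
    open step of the continuous induction. Both time directions are treated at once through
    [kap]. *)
Lemma free_motion :
  (forall s : R, 0 <= s <= L -> clkA ck (t0 + kap * s) = 0) \/
  (forall s : R, 0 <= s <= L -> 5 * dl <= qform (stS st i q0) (line s)) ->
  forall s : R, 0 <= s <= L -> base (gam (t0 + kap * s)) = base (gam t0) /\
    (bcrd i (gam (t0 + kap * s))).2 = line s.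
Proof.
move=> free; pose tm s := t0 + kap * s.
have tmc : continuous tm.
  by move=> s; apply: cvgD; [exact: cvg_cst|apply: cvgM; [exact: cvg_cst|exact: cvg_id]].
pose P s := base (gam (tm s)) = base (gam t0) /\ (bcrd i (gam (tm s))).2 = line s.
apply: (@continuous_induction R P 0 L).
- by rewrite /P /line /tm mulr0 addr0 subrr scale0r subr0.
- move=> t /andP[t_ge t_lt] hP.
  have [Pb Pp] : P t by apply: hP; rewrite t_ge lexx.
  have it : dom i (base (gam (tm t))) by rewrite Pb.
  have nfree : \forall s \near t, (0 <= s <= L) ->
      clkA ck (tm s) = 0 \/ 4 * dl < Qf st (gam (tm s)).
    case: free => free; first by near=> s => s0L; left; exact: free.
    have Qt : 4 * dl < Qf st (gam (tm t)).
      rewrite (Qf_bcrd st it) Pp Pb; apply: lt_le_trans (free t _); last by rewrite t_ge ltW.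
      by rewrite ltr_pM2r // ltr_nat.
    have cQ : {for t, continuous (fun s => Qf st (gam (tm s)))}.
      by apply: (@continuous_comp _ _ _ tm (fun u => Qf st (gam u))); [exact: tmc|exact: (Qf_gam_cont orb)].
    have : \forall s \near t, 4 * dl < Qf st (gam (tm s)).
      exact: (cQ _ (lt_nbhsr Qt)).
    by apply: filterS => s h _; right.
  have ndom : \forall s \near t, dom i (base (gam (tm s))).
    exact: (tmc t _ (near_dom_gam orb it)).
  have : \forall s \near t, ((0 <= s <= L) ->
      clkA ck (tm s) = 0 \/ 4 * dl < Qf st (gam (tm s))) /\ dom i (base (gam (tm s))).
    by apply: filterS2 nfree ndom => s.
  move=> /nbhs_ballP[e /= e0 eh].
  exists e => // s /andP[ts se] sL.
  have hh u : t <= u <= s -> dom i (base (gam (tm u))) /\ hrad st ck dl rh (tm u) (gam (tm u)) = 0.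
    move=> /andP[tu us]; have [|h1 h2] := eh u.
      rewrite -ball_normE /= ltr_norml; apply/andP; split; lra.
    by split => //; apply: hrad0; apply: h1; rewrite (le_trans t_ge tu) (le_trans us sL).
  have tq : crd i (base (gam (tm t))) = q0 by rewrite Pb.
  suff [e1 e2] : crd i (base (gam (tm s))) = crd i (base (gam (tm t))) /\
     (bcrd i (gam (tm s))).2 + clkB ck (tm s) *: xi = (bcrd i (gam (tm t))).2 + clkB ck (tm t) *: xi.
    have [is_ _] : dom i (base (gam (tm s))) /\ hrad st ck dl rh (tm s) (gam (tm s)) = 0.
      by apply: hh; rewrite lexx ltW.
    split; first by rewrite -(crdK is_) e1 Pb crdK.
    exact: (shift_line e2 Pp).
  case: kap1 => kE.
    have ab : tm t <= tm s by rewrite /tm kE lerD2l !mul1r ltW.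
    have [|r1 r2] := @frozen_segment i (tm t) (tm s) ab.
      move=> u /andP[u1 u2]; have uE : u = tm (u - t0) by rewrite /tm kE mul1r addrC subrK.
      rewrite uE; apply: hh; move: u1 u2; rewrite /tm kE => u1 u2; apply/andP; split; lra.
    rewrite tq in r2; split; [exact: r1|exact: r2].
  have ab : tm s <= tm t by rewrite /tm kE lerD2l !mulN1r lerN2 ltW.
  have [|r1 r2] := @frozen_segment i (tm s) (tm t) ab.
    move=> u /andP[u1 u2]; have uE : u = tm (t0 - u) by rewrite /tm kE mulN1r opprB addrC subrK.
    rewrite uE; apply: hh; move: u1 u2; rewrite /tm kE => u1 u2; apply/andP; split; lra.
  rewrite -r1 tq in r2; split; [exact: (esym r1)|exact: (esym r2)].
(* In the limit step the base point is identified before anything else, points being closed in [M];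
   the components of the covector in chart [i] are meaningful only after that. *)
move=> t /andP[t_gt t_le] hP.
have cb : continuous (fun s => base (gam (tm s))).
  move=> s; apply: (@continuous_comp _ _ _ tm (fun u => base (gam u))); [exact: tmc|exact: (base_gam_cont orb)].
have Pb : base (gam (tm t)) = base (gam t0).
  apply: (@closed_left_limit R M (fun s => base (gam (tm s))) [set base (gam t0)] 0 t) => //.
    exact: accessible_closed_set1 (hausdorff_accessible hM) _.
    exact: cb.
  by move=> s hs; have [h _] := hP s hs; exact: h.
have it : dom i (base (gam (tm t))) by rewrite Pb.
split => //; apply/rowP => d.
pose f u := (bcrd i (gam u)).2 ord0 d + clkB ck u * xi ord0 d - (clkB ck t0 * xi ord0 d + (bcrd i (gam t0)).2 ord0 d).
have lineE s : (line s) ord0 d = (bcrd i (gam t0)).2 ord0 d - (clkB ck (tm s) - clkB ck t0) * xi ord0 d.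
  have ent (u v : 'rV[R]_2) (r : R) : (u - r *: v) ord0 d = u ord0 d - r * v ord0 d.
    by rewrite mxE [in X in _ + X]mxE [in X in - X]mxE.
  exact: ent.
have alg (x y B B0 X : R) : x + B * X - (B0 * X + y) = 0 <-> x = y - (B - B0) * X.
  by split=> h; [apply/eqP; rewrite -subr_eq0 -h; apply/eqP|rewrite h]; ring.
have : f (tm t) = 0.
  apply: (@closed_left_limit R R (f \o tm) [set 0] 0 t) => //.
  - have cf : {for tm t, continuous f}.
      have derc (h : R -> R) u d' : is_derive u (1 : R) h d' -> {for u, continuous h}.
        by move=> [dh _]; apply: differentiable_continuous; apply/derivable1_diffP.
      have c1 := derc _ _ _ (p_derive orb d it).
      have c2 := derc _ _ _ (clkB_derive ck (tm t)).
      by apply: cvgB; [apply: cvgD => //; apply: cvgM => //|]; exact: cvg_cst.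
    exact: (@continuous_comp _ _ _ tm f t (tmc t) cf).
  move=> s hs; have [_ e2] := hP s hs; change (f (tm s) = 0).
  have e3 : (bcrd i (gam (tm s))).2 ord0 d = line s ord0 d by rewrite e2.
  by apply/alg; rewrite -lineE.
by move=> /alg h; rewrite lineE.
Unshelve. all: by end_near. Qed.

End FreeMotion.

Section NearOrbits.
Variables (R : realType) (M : topologicalType) (A : smooth_atlas R 2 M).
Hypothesis hM : hausdorff_space M.
Variables (st : setup A) (g : tensor2 A) (e : R).
Hypothesis e0 : 0 < e.
Hypothesis he : forall x, exists i, dom i x /\
    forall q, `|q - crd i x| < e -> img i q /\ bounds st g i q e.
Variables (k eta : R) (ck : clock k eta) (dl rh c : R).
Hypotheses (k0 : 0 < k) (dl0 : 0 < dl) (rh0 : 0 < rh) (c0 : 0 < c).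
Implicit Types (i j : cidx A) (q p : 'rV[R]_2) (x : M) (w : cotangent A) (t : R).

Local Notation H := (Ham st ck dl rh).
Variables (N : set (cotangent A)) (gam : R -> cotangent A).
Hypothesis orb : hamiltonian_orbit N (twisted_form (scaled_form st c)) H gam.
Hypothesis Qrh : forall t, Qf st (gam t) < rh.

(** The rate is [k] up to distance [clkt] from 0, and nonnegative beyond. *)
Lemma clkB_out kap s : kap = 1 \/ kap = -1 -> clkt ck <= s ->
  k * clkt ck <= kap * (clkB ck (kap * s) - clkB ck 0).
Proof.
move=> kap1 ts; have t0 := clkt_gt0 ck.
have dk u : is_derive u (1 : R) (fun u : R => k * u) k.
  have := @is_deriveZ R R R id k u (1 : R) _ (is_derive_id u (1 : R)).
  by rewrite -[k *: 1]/(k * 1) mulr1.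
case: kap1 => ->.
  rewrite !mul1r; have h : k * clkt ck - k * 0 <= clkB ck (clkt ck) - clkB ck 0.
    apply: (derive_le (ltW t0) (fun u _ => dk u) (fun u _ => clkB_derive ck u)) => u /andP[u0 ut].
    by rewrite clkbk // ger0_norm.
  rewrite mulr0 subr0 in h; apply: le_trans h _; rewrite lerD2r; exact: clkB_le.
rewrite !mulN1r opprB.
have t0' : - clkt ck <= 0 by rewrite oppr_le0 ltW.
have h : k * 0 - k * (- clkt ck) <= clkB ck 0 - clkB ck (- clkt ck).
  apply: (derive_le t0' (fun u _ => dk u) (fun u _ => clkB_derive ck u)) => u /andP[ut u0].
  by rewrite clkbk // ler0_norm // lerNl.
rewrite mulr0 mulrN opprK add0r in h; apply: le_trans h _; rewrite lerD2l lerN2.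
by apply: clkB_le; rewrite lerN2.
Qed.

(* [Q] is a convex function on the line followed by the covector, so in one of the
   two time directions it keeps growing and never comes back below [4 * dl]. *)
Lemma pushed_out i : dom i (base (gam 0)) ->
  5 * dl <= (k * clkt ck) ^+ 2 *
    qform (stS st i (crd i (base (gam 0)))) (dF st i (crd i (base (gam 0)))) ->
  exists a, forall t, a <= t <= a + 1 -> base (gam t) = base (gam 0).
Proof.
set x0 := base (gam 0) => ix; set xi := dF st i (crd i x0); set S := stS st i (crd i x0) => hxi.
set p0 := (bcrd i (gam 0)).2; pose w := (p0 *m S *m xi^T) ord0 ord0.
have iq := img_crd ix.
(* The time direction in which the linear term of [Q] along the line is nonnegative. *)
have [kap kap1 kw] : exists2 kap : R, kap = 1 \/ kap = -1 & kap * w <= 0.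
  have [w0|/ltW w0] := leP w 0; first by exists 1; [left|rewrite mul1r].
  by exists (-1); [right|rewrite mulN1r oppr_le0].
have kk : kap * kap = 1 by case: kap1 => ->; ring.
have tau0 := clkt_gt0 ck; set tau := clkt ck in tau0 hxi.
have Qp0 : 0 <= qform S p0 by exact: stS_ge0.
have Qxi : 0 <= qform S xi by exact: stS_ge0.
have far s : tau <= s -> 5 * dl <= qform S (p0 - (clkB ck (kap * s) - clkB ck 0) *: xi).
  move=> ts; have h := clkB_out kap1 ts.
  set D := clkB ck (kap * s) - clkB ck 0 in h *.
  have DE : D = kap * (kap * D) by rewrite mulrA kk mul1r.
  set m := kap * D in h DE; rewrite -scaleNr DE qform_line; last exact: stS_sym.
  apply: le_trans hxi _.
  have kt0 : 0 <= k * tau by rewrite mulr_ge0 // ltW.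
  have m0 : 0 <= m := le_trans kt0 h.
  have m2 : (k * tau) ^+ 2 <= m ^+ 2 by rewrite lerXn2r // nnegrE.
  have h1 : (k * tau) ^+ 2 * qform S xi <= m ^+ 2 * qform S xi by exact: ler_wpM2r.
  have h2 : 0 <= - (kap * w) * m by rewrite mulr_ge0 // oppr_ge0.
  have -> : (- (kap * m)) ^+ 2 = m ^+ 2 by rewrite sqrrN exprMn expr2 kk mul1r.
  rewrite -/w; apply: le_trans h1 _; rewrite lerDr.
  have -> : - (kap * m) * (2 * w) = 2 * (- (kap * w) * m) by ring.
  by rewrite addr_ge0 // mulr_ge0.
have [b1 p1] : base (gam (0 + kap * tau)) = x0 /\
    (bcrd i (gam (0 + kap * tau))).2 = p0 - (clkB ck (0 + kap * tau) - clkB ck 0) *: xi.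
  apply: (free_motion (L := tau) hM dl0 rh0 orb Qrh kap1 ix).
    left=> s /andP[s0 st']; rewrite add0r clkA0 //.
    by case: kap1 => ->; rewrite ?mul1r ?mulN1r ?normrN ger0_norm.
  by rewrite lexx ltW.
rewrite add0r in b1 p1.
have i1 : dom i (base (gam (kap * tau))) by rewrite b1.
have rest s : 0 <= s <= 1 -> base (gam (kap * tau + kap * s)) = x0.
  move=> s01; rewrite -b1.
  have [|->//] := free_motion (L := 1) hM dl0 rh0 orb Qrh kap1 i1 _ s01.
  right=> u /andP[u0 _]; rewrite p1 b1 -/xi -/S.
  have -> : p0 - (clkB ck (kap * tau) - clkB ck 0) *: xi -
     (clkB ck (kap * tau + kap * u) - clkB ck (kap * tau)) *: xi =
     p0 - (clkB ck (kap * (tau + u)) - clkB ck 0) *: xi.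
    rewrite mulrDr -addrA -opprD -scalerDl; congr (_ - _ *: _).
    by rewrite addrC addrA subrK.
  by apply: far; rewrite lerDl.
(* A full period of rest: from [tau] on in forward time, up to [- tau] in backward time. *)
exists (if kap == 1 then tau else - tau - 1) => t tt.
case: kap1 => kE; rewrite kE in rest tt.
  rewrite eqxx in tt; have -> : t = 1 * tau + 1 * (t - tau) by rewrite !mul1r addrC subrK.
  by apply: rest; case/andP: tt => t1 t2; apply/andP; split; lra.
have n1 : ((-1 : R) == 1) = false by rewrite lt_eqF // (lt_trans (ltrN10 R)) // ltr01.
rewrite n1 in tt; have -> : t = -1 * tau + -1 * (- t - tau) by rewrite !mulN1r; ring.
by apply: rest; case/andP: tt => t1 t2; apply/andP; split; lra.
Qed.

(** The wall moves [p] and [c x J] oppositely, so the guiding centre drifts by the push alone, by at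
    most [c * ste / 4] in each component. Two covectors of size at most [c * ste / 8] add as much
    again, whence a displacement of at most [ste / 2], half the radius of the flat ball. *)
Lemma flat_confined i : dom i (base (gam 0)) ->
  (forall q, `|q - crd i (base (gam 0))| < ste st ->
      [/\ img i q, stS st i q = 1%:M & sts st i q = area2 R]) ->
  rh <= (c * ste st / 8) ^+ 2 -> (grad_bound e + 1) * eta <= c * ste st / 4 ->
  confined A (fun t => base (gam t)).
Proof.
set x0 := base (gam 0) => ix hflat hrh heta; have s0 := ste_gt0 st.
have G0 := grad_bound_ge0 e0.
pose b u := base (gam u); have cb : continuous b := base_gam_cont orb.
exists i, (crd i x0), 0, (ste st); split => //; first by move=> q /hflat[].
apply: (chart_bootstrap hM cb s0); first by move=> q /hflat[].
  by split => //; rewrite subrr normr0.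
move=> t tt ht; have /andP[t_ge _] := tt.
have flat s : 0 <= s <= t -> [/\ dom i (b s), \forall q \near crd i (b s), stS st i q = 1%:M,
   stS st i (crd i (b s)) = 1%:M & sts st i (crd i (b s)) = area2 R].
  move=> /ht[is_ hs]; have [_ h1 h2] := hflat _ hs; split => //.
  have : \forall q \near crd i (b s), `|q - crd i x0| < ste st.
    have dn : ball (crd i x0) (ste st) (crd i (b s)) by rewrite -ball_normE /= distrC.
    apply: filterS (open_nbhs_nbhs (conj (@ball_open R _ (crd i x0) (ste st)) dn)) => q.
    by rewrite -ball_normE /= distrC.
  by apply: filterS => q /hflat[].
pose mu := c * ste st / 8; have mu0 : 0 < mu by rewrite divr_gt0 // mulr_gt0.
have pmu s a : 0 <= s <= t -> `|(bcrd i (gam s)).2 ord0 a| <= mu.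
  move=> /flat[is_ _ S1 _]; set p := (bcrd i (gam s)).2.
  have : nsq p <= mu ^+ 2.
    apply: le_trans hrh; apply: ltW; apply: le_lt_trans (Qrh s).
    by rewrite (Qf_bcrd st is_) -/p [stS _ _ _]S1 /qform mulmx1 nsq_mul.
  move=> h; rewrite -(@ler_pXn2r R 2) // ?nnegrE ?normr_ge0 ?(ltW mu0) // real_normK ?num_real //.
  apply: le_trans h; have [->|->] := ord2P a; rewrite /nsq ?lerDl ?lerDr sqr_ge0 //.
(* The guiding centre [p + c x J]. *)
pose f a u := (bcrd i (gam u)).2 ord0 a + c * \sum_b' crd i (b u) ord0 b' * area2 R b' a.
have df a s : 0 <= s <= t -> is_derive s (1 : R) (f a) (- (clkb ck s * dF st i (crd i (b s)) ord0 a)).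
  move=> hs; have [is_ nS S1 sJ] := flat s hs.
  have dp := p_derive orb a is_.
  have dx b' := x_derive orb b' is_.
  have -> : f a = (fun u => (bcrd i (gam u)).2 ord0 a) +
     c *: (area2 R ord0 a *: (fun u => crd i (base (gam u)) ord0 ord0)
       + area2 R ord_max a *: (fun u => crd i (base (gam u)) ord0 ord_max)).
    apply/funext => u; rewrite /f sum2 !fctE -![_ *: _]/(_ * _).
    by rewrite [area2 R ord0 a * _]mulrC [area2 R ord_max a * _]mulrC.
  apply: (is_derive_eq (is_deriveD dp (is_deriveZ c (is_deriveD
    (is_deriveZ (area2 R ord0 a) (dx ord0)) (is_deriveZ (area2 R ord_max a) (dx ord_max)))))).
  have dQ0 : dQ st i (bcrd i (gam s)) a = 0.
    rewrite /dQ big1 // => b1 _; rewrite big1 // => b2 _.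
    rewrite /partial (@near_eq_derive _ _ _ (fun q => stS st i q b1 b2) (cst ((1%:M : 'M[R]_2) b1 b2))).
      by rewrite derive_cst mulr0.
    by apply: filterS nS => q ->.
  have sE b' : scaled_form st c i (crd i (base (gam s))) b' a = c * area2 R b' a.
    by rewrite /scaled_form [LHS]mxE [sts _ _ _]sJ.
  rewrite dQ0 mulr0 add0r (hpushE ck rh0 Qrh) sum2 !sE /velocity -![_ *: _]/(_ * _).
  move: (_ * (_ *m _) ord0 ord0) (_ * (_ *m _) ord0 ord_max) => X Y.
  by rewrite /b; move: (clkb ck s * _) => Z; ring.
have fb a : `|f a t - f a 0| <= c * ste st / 4.
  apply: le_trans heta.
  apply: le_trans (_ : (grad_bound e + 1) * (clkB ck t - clkB ck 0) <= _).
    rewrite mulrBr.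
    apply: (@derive_norm_le R (f a) (fun u => (grad_bound e + 1) * clkB ck u) _
      (fun u => (grad_bound e + 1) * clkb ck u) 0 t t_ge (df a)).
    - move=> s _; exact: (@is_deriveZ R R R (clkB ck) (grad_bound e + 1) s 1 _ (clkB_derive ck s)).
    - move=> s hs; have [is_ _ S1 _] := flat s hs.
      rewrite normrN normrM (ger0_norm (clkb_ge0 ck s)) mulrC.
      apply: ler_wpM2r; first exact: clkb_ge0.
      have := grad_le e0 he is_; rewrite S1 /qform mulmx1 nsq_mul.
      set v := dF st i (crd i (b s)) => hv.
      have va : `|v ord0 a| ^+ 2 <= grad_bound e.
        rewrite real_normK ?num_real //; apply: le_trans hv.
        by have [->|->] := ord2P a; rewrite /nsq ?lerDl ?lerDr sqr_ge0.
      have : 0 <= (`|v ord0 a| - 1) ^+ 2 by rewrite sqr_ge0.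
      move: va (normr_ge0 (v ord0 a)); move: `|v ord0 a| (grad_bound e) => n G.
      by rewrite sqrrB1 => h1 h2 h3; lra.
  apply: ler_wpM2l; first by rewrite addr_ge0.
  exact: clkB_bound.
have t0t : 0 <= t <= t by rewrite t_ge lexx.
have z0t : 0 <= (0 : R) <= t by rewrite lexx t_ge.
(* [s] is the nonzero entry of [J] in a column: each component of the guiding centre controls the
   other coordinate of the base point. *)
have key (u v X X0 : R) (s : R) : s = 1 \/ s = -1 -> `|u| <= mu -> `|v| <= mu ->
    `|u + c * (X * s) - (v + c * (X0 * s))| <= c * ste st / 4 -> `|X - X0| <= ste st / 2.
  move=> hs hu hv h; rewrite -(ler_pM2l c0).
  have -> : c * `|X - X0| = `|c * (X - X0) * s|.
    rewrite !normrM (gtr0_norm c0); case: hs => ->; rewrite ?normrN normr1 mulr1 //.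
  have -> : c * (X - X0) * s = (u + c * (X * s) - (v + c * (X0 * s))) - u + v by ring.
  apply: le_trans (ler_normD _ _) _.
  apply: le_trans (lerD (ler_normB _ _) hv) _.
  apply: le_trans (lerD (lerD h hu) (lexx mu)) _.
  by rewrite /mu; lra.
have [J00 J01 J10 J11] := area2E R.
have h0 := fb ord0; have h1 := fb ord_max.
rewrite /f !sum2 J00 J10 !mulr0 !add0r in h0.
rewrite /f !sum2 J01 J11 !mulr0 !addr0 in h1.
apply: norm_le_entries; first by rewrite divr_ge0 // ltW.
move=> a; rewrite !mxE.
have [->|->] := ord2P a.
  exact: (key _ _ _ _ 1 (or_introl erefl) (pmu t ord_max t0t) (pmu 0 ord_max z0t) h1).
exact: (key _ _ _ _ (-1) (or_intror erefl) (pmu t ord0 t0t) (pmu 0 ord0 z0t) h0).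
Qed.

Lemma near_confined : rh <= (c * ste st / 8) ^+ 2 ->
  (grad_bound e + 1) * eta <= c * ste st / 4 -> 5 * dl <= ste st * (k * clkt ck) ^+ 2 ->
  confined A (fun t => base (gam t)).
Proof.
move=> hrh heta hdl; have [hx|[i [ix hflat]]] := st_flat st (base (gam 0)); last exact: flat_confined hflat hrh heta.
have ix := @dom_at R 2 M A (base (gam 0)); set i := chart_at A (base (gam 0)) in ix hx.
have [|a ha] := pushed_out ix.
  apply: le_trans hdl _; rewrite mulrC; apply: ler_wpM2l; first exact: sqr_ge0.
  exact: ltW.
(* The base point rests for a whole period, so any chart ball around it will do. *)
have [rho rho0 hrho] := nbhs_cball (near_img (img_crd ix)).
exists i, (crd i (base (gam 0))), a, rho; split => //.
  by move=> q /ltW; exact: hrho.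
by move=> t /ha ->; split => //; rewrite subrr normr0.
Qed.

End NearOrbits.

(** * Free homotopies *)

Section Homotopy.
Variables (R : realType) (T : topologicalType).
Implicit Types (a b c : R -> T) (F : R * R -> T).

Let strip : set (R * R) := [set y : R * R | 0 <= y.1 <= 1].

Lemma within_pullback (f : R * R -> R * R) F x (W : set T) :
  {within strip, continuous F} -> {for x, continuous f} -> strip (f x) ->
  nbhs (F (f x)) W -> \forall y \near x, strip (f y) -> W (F (f y)).
Proof.
move=> /subspace_continuousP cF cf sx nW.
exact: (cf _ (cF (f x) sx W nW)).
Qed.

(** Concatenation in the parameter [s]. The homotopies are controlled only over [0 <= s <= 1], so
    the pasting is done with continuity within the strip, one condition for each half. *)
Lemma freely_homotopic_trans a b c :
  freely_homotopic a b -> freely_homotopic b c -> freely_homotopic a c.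
Proof.
move=> [F [cF pF F0 F1]] [G [cG pG G0 G1]].
pose f (y : R * R) : R * R := (2 * y.1, y.2).
pose h (y : R * R) : R * R := (2 * y.1 - 1, y.2).
have cdbl : continuous (fun y : R * R => 2 * y.1).
  by move=> y; apply: cvgM; [exact: cvg_cst|exact: cvg_fst].
have cf : continuous f.
  by move=> y; exact: (cvg_pair (cdbl y) cvg_snd).
have ch : continuous h.
  move=> y; have cm : {for y, continuous (fun y : R * R => 2 * y.1 - 1)}.
    by apply: cvgB; [exact: cdbl|exact: cvg_cst].
  exact: (cvg_pair cm cvg_snd).
have cfst : continuous (fst : R * R -> R) by move=> y; exact: cvg_fst.
pose K y := if y.1 <= 2^-1 then F (f y) else G (h y).
have sf y : strip y -> y.1 <= 2^-1 -> strip (f y).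
  by rewrite /strip /f /= => /andP[y0 _] y1; apply/andP; split; lra.
have sh y : strip y -> 2^-1 <= y.1 -> strip (h y).
  by rewrite /strip /h /= => /andP[_ y0] y1; apply/andP; split; lra.
exists K; split.
- apply/subspace_continuousP => x sx W nW.
  have nF : \forall y \near x, strip y -> y.1 <= 2^-1 -> W (F (f y)).
    have [x2|x2] := leP x.1 2^-1; last first.
      have : \forall y \near x, 2^-1 < y.1 by exact: (cfst x _ (lt_nbhsr x2)).
      by apply: filterS => y y2 _; rewrite leNgt y2.
    have Kx : K x = F (f x) by rewrite /K x2.
    have nWx : nbhs (F (f x)) W by rewrite -Kx; exact: nW.
    have := within_pullback cF (cf x) (sf x sx x2) nWx.
    apply: filterS => y hy sy y2.
    exact/hy/sf.
  have nG : \forall y \near x, strip y -> 2^-1 <= y.1 -> W (G (h y)).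
    have [x2|x2] := leP 2^-1 x.1; last first.
      have : \forall y \near x, y.1 < 2^-1 by exact: (cfst x _ (lt_nbhsl x2)).
      by apply: filterS => y y2 _; rewrite leNgt y2.
    (* On the common line [s = 1/2] both halves equal [b]. *)
    have Kx : K x = G (h x).
      rewrite /K; case: ifP => // x2'.
      have xE : x.1 = 2^-1 by apply/eqP; rewrite eq_le x2 x2'.
      have -> : f x = (1, x.2) by rewrite /f xE mulfV.
      have -> : h x = (0, x.2) by rewrite /h xE mulfV // subrr.
      by rewrite F1 G0.
    have nWx : nbhs (G (h x)) W by rewrite -Kx; exact: nW.
    have := within_pullback cG (ch x) (sh x sx x2) nWx.
    apply: filterS => y hy sy y2.
    exact/hy/sh.
  rewrite /nbhs /= /within /=; apply: filterS2 nF nG => y hF hG sy.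
  change (W (K y)); have [y2|y2] := leP y.1 2^-1.
    have -> : K y = F (f y) by rewrite /K y2.
    exact: hF.
  have -> : K y = G (h y) by rewrite /K leNgt y2.
  by apply: hG => //; exact: ltW.
- move=> s t s01; rewrite /K /f /h /=; have [s2|s2] := leP s 2^-1.
    by apply: pF; move: s01 => /andP[s0 _]; apply/andP; split; lra.
  by apply: pG; move: s01 => /andP[_ s1]; apply/andP; split; lra.
- by move=> t; rewrite /K /f /= mulr0 invr_ge0 ler0n F0.
- move=> t; have n2 : (1 <= 2^-1 :> R) = false by apply/negbTE; rewrite -ltNge invf_lt1 // ltr1n.
  rewrite /K /h /= n2.
  have -> : (2 * 1 - 1 : R) = 1 by ring.
  exact: G1.
Qed.

Lemma loop_int c (n : int) t : loop c -> c (t + n%:~R) = c t.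
Proof.
move=> [_ per]; have pn (m : nat) s : c (s + m%:R) = c s.
  by elim: m s => [|m IH] s; rewrite ?addr0 // -natr1 addrA per IH.
case: n => m; first exact: pn.
by rewrite NegzE mulrNz -(pn m.+1 (t - _)) subrK.
Qed.

Lemma loop_interval c (P : T -> Prop) (r : R) : loop c ->
  (forall t, r <= t <= r + 1 -> P (c t)) -> forall t, P (c t).
Proof.
move=> lc h t; rewrite -(loop_int (- Num.floor (t - r)) t lc).
have /andP[h1 h2] := floor_itv (t - r); rewrite intrD1 in h2.
by apply: h; rewrite mulrNz; apply/andP; split; lra.
Qed.

End Homotopy.

Section Contraction.
Variables (R : realType) (M : topologicalType) (A : smooth_atlas R 2 M).

(** By periodicity one period in the chart ball keeps the whole loop there; the ball is convex, and
    the loop is shrunk radially to its centre. *)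
Lemma confined_homotopic (c : R -> M) : loop c -> confined A c ->
  exists x, freely_homotopic c (cst x).
Proof.
move=> lc [i [q0 [a [rho [rho0 him hc]]]]].
have inb t : in_ball i q0 rho (c t) by exact: (loop_interval lc hc).
pose Z (y : R * R) : 'rV[R]_2 := q0 + (1 - y.1) *: (crd i (c y.2) - q0).
exists (pnt i q0), (fun y => pnt i (Z y)); split.
- apply: continuous_in_subspaceT => y /set_mem /andP[s0 s1].
  have [iy hy] := inb y.2.
  have cZ : {for y, continuous Z}.
    have cs : {for y, continuous (fun y : R * R => 1 - y.1)}.
      by apply: cvgB; [exact: cvg_cst|exact: cvg_fst].
    have cy : {for y, continuous (fun y : R * R => crd i (c y.2))}.
      apply: (@continuous_comp _ _ _ (fun y : R * R => c y.2) (crd i) y); last exact: crd_cont.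
      apply: (@continuous_comp _ _ _ (snd : R * R -> R) c y); first exact: cvg_snd.
      by case: lc => lc _; exact: lc.
    exact: (cvgD (cvg_cst q0) (cvgZ cs (cvgB cy (cvg_cst q0)))).
  apply: (@continuous_comp _ _ _ Z (pnt i) y cZ); apply: pnt_cont; apply: him.
  rewrite /Z addrC addKr normrZ; apply: le_lt_trans hy.
  by rewrite ler_piMl // ger0_norm ?subr_ge0 // lerBlDr lerDl.
- by move=> s t _; rewrite /Z /=; case: lc => _ ->.
- move=> t; have [it _] := inb t.
  by rewrite /Z /= subr0 scale1r addrC subrK crdK.
- by move=> t; rewrite /Z /= subrr scale0r addr0.
Qed.

Lemma confined_trivial (alpha : set (R -> M)) (c : R -> M) :
  free_class alpha -> nontrivial_class alpha -> alpha c -> ~ confined A c.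
Proof.
move=> [a [la ->]] hnt [lc ac] /(confined_homotopic lc)[x cx].
apply: (hnt x); split; last exact: freely_homotopic_trans cx.
by split => // t; exact: cvg_cst.
Qed.

End Contraction.

(** Dividing by [K + 1] instead of [K] covers the case [K = 0]. *)
Lemma ler_small_mul (R : realFieldType) (K b eta : R) : 0 <= K -> 0 < b -> 0 < eta ->
  eta <= b / (K + 1) -> K * eta <= b.
Proof.
move=> K0 b0 eta0; rewrite ler_pdivlMr ?ltr_wpDl // => h.
by apply: le_trans h; rewrite mulrDr mulr1 mulrC lerDl ltW.
Qed.

Theorem corollary3 (R : realType) (M : topologicalType)
  (A : smooth_atlas R 2 M) (hM : closed_surface A)
  (g : tensor2 A) (hg : riemannian_metric g)
  (hK : forall (i : cidx A) (q : 'rV[R]_2), img i q -> gauss_curvature g i q = -1)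
  (r : R) (hr : 0 < r)
  (alpha : set (R -> M)) (halpha : free_class alpha)
  (hnt : nontrivial_class alpha)
  (eps : R) (heps : 0 < eps) :
  exists sigma : tensor2 A,
    [/\ two_form sigma, closed_form sigma, (C1norm g sigma < eps%:E)%E &
        cBPS (disk_bundle g r) (twisted_form sigma) (zero_section A) alpha
        = +oo%E].
Proof.
have [hH hC _] := hM; pose st := setup_exists A hH hC.
have [c c0 [s2 sc sn]] := small_form hC hg (sts_tensor st) (fun i q => sts_anti st i q) heps.
exists (scaled_form st c); split => //.
have [e e0 he] := bounds_exist hC st hg.
have [C C0 hCx] := derive_cutoff_bounded R.
have s0 := ste_gt0 st; have G0 := grad_bound_ge0 e0.
pose mu := c * ste st / 8; have mu0 : 0 < mu by rewrite divr_gt0 // mulr_gt0.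
(* The first bound puts the support [Q <= 4 * rh] inside the disk bundle; the second makes covectors
   with [Q < rh] small compared with the magnetic scale. *)
pose rh := Num.min (r ^+ 2 * e ^+ 2 / 8) (mu ^+ 2).
have rh0 : 0 < rh by rewrite lt_min exprn_gt0 // andbT divr_gt0 // mulr_gt0 // exprn_gt0.
have rhr : 4 * rh / e ^+ 2 < r ^+ 2.
  rewrite ltr_pdivrMr ?exprn_gt0 //.
  have h1 : rh <= r ^+ 2 * e ^+ 2 / 8 by rewrite ge_min lexx.
  have h2 : 0 < r ^+ 2 * e ^+ 2 by rewrite mulr_gt0 // exprn_gt0.
  lra.
have rhmu : rh <= mu ^+ 2 by rewrite ge_min lexx orbT.
pose K1 := speed_bound e rh C; pose K2 := 4 * rh + grad_bound e; pose K3 := grad_bound e + 1.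
have K10 : 0 <= K1.
  by rewrite divr_ge0 ?mulr_ge0 ?addr_ge0 ?exprn_ge0 ?divr_ge0 ?mulr_ge0 // ltW.
have K20 : 0 <= K2 by rewrite addr_ge0 // mulr_ge0 // ltW.
have K30 : 0 <= K3 by rewrite addr_ge0.
have b10 : 0 < e / 2 by rewrite divr_gt0.
have b20 : 0 < rh / 4 by rewrite divr_gt0.
have b30 : 0 < c * ste st / 4 by rewrite divr_gt0 // mulr_gt0.
(* In turn: the displacement of far orbits, their loss of [Q], and the drift of the guiding
   centre. *)
pose eta := Num.min (e / 2 / (K1 + 1)) (Num.min (rh / 4 / (K2 + 1)) (c * ste st / 4 / (K3 + 1))).
have eta0 : 0 < eta.
  have K_gt0 (K : R) : 0 <= K -> 0 < K + 1 by move=> K0; exact: ltr_wpDl.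
  by rewrite !lt_min !(divr_gt0 _ (K_gt0 _ _)).
have eta1 : K1 * eta <= e / 2 by apply: ler_small_mul => //; rewrite ge_min lexx.
have eta2 : eta * K2 <= rh / 4.
  by rewrite mulrC; apply: ler_small_mul => //; rewrite !ge_min lexx orbT.
have eta3 : K3 * eta <= c * ste st / 4.
  by apply: ler_small_mul => //; rewrite !ge_min lexx !orbT.
(* The capacity is infinite because no [k] is admissible: each one is refuted by its own
   Hamiltonian. *)
rewrite /cBPS (_ : [set k : R | _] = set0) ?image_set0 ?ereal_inf0 //.
apply/seteqP; split=> // k [k0 hk].
pose ck := clock_exists k0 eta0; have t0 := clkt_gt0 ck.
pose X := ste st * (k * clkt ck) ^+ 2.
have X0 : 0 < X by rewrite mulr_gt0 // exprn_gt0 // mulr_gt0.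
(* Below [rh / 8], far orbits never meet the wall; below [X / 5], the kick carries covectors beyond
   it. *)
pose dl := Num.min (rh / 8) (X / 5).
have dl0 : 0 < dl by rewrite lt_min !divr_gt0.
have dl1 : 8 * dl <= rh by rewrite mulrC -ler_pdivlMr // ge_min lexx.
have dl2 : 5 * dl <= X by rewrite mulrC -ler_pdivlMr // ge_min lexx orbT.
have dlrh : dl <= rh by apply: le_trans dl1; rewrite ler_peMl ?ler1n // ltW.
have hH' : hamiltonian_ge (disk_bundle g r) (zero_section A) k (Ham st ck dl rh).
  split; first exact: (Ham_hamiltonian hC hg e0 he ck dl0 dlrh hr rhr).
  apply/ereal_infP => _ [[t w] [_ w0] <-]; rewrite lee_fin; exact: Ham_zero_section.
have [gam [orb _ aw]] := hk _ hH'.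
apply: (confined_trivial halpha hnt aw).
have [[t0' ht]|nht] := pselect (exists t0', rh <= Qf st (gam t0')).
  exact: (far_confined hH e0 he dl0 rh0 dl1 orb hCx ht eta1 eta2).
apply: (near_confined hH e0 he k0 dl0 rh0 c0 orb _ rhmu eta3 dl2) => t.
by rewrite ltNge; apply/negP => h; apply: nht; exists t.
Qed.
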